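(* Let $s\in\mathbb{N}$ and let $\psi$ be the Cauchy wavelet of order $s$. There exist a continuous function $\rho:[0,1)\to\mathbb{R}_+$ and a constant $c>0$, both uniform (independent of the data below), such that the following holds. Let $f\in L^2(\mathbb{R})$ with $\operatorname{supp}\widehat f\subset\mathbb{R}_+$. Let $k\ge1$ and, for $j=1,\dots,k$, let $z_j=x_j+iy_j\in\mathbb{C}_+$, $0\le r_j<s_j$, $\Delta_j\ge\delta_j>0$, $D_j:=B_{s_j}(z_j)$, $D_{0,j}:=B_{r_j}(z_j)$, $(D_j)_+:=D_j\setminus\overline{D_{0,j}}$, and suppose that $$(W_\psi f)\big|_{D_j}\in\mathcal{H}(D_j,D_{0,j},\delta_j,\Delta_j)\quad\text{for all } j\in\{1,\dots,k\}.$$ Then, for arbitrary $g\in L^2(\mathbb{R})$ with $\operatorname{supp}\widehat g\subset\mathbb{R}_+$, $$\inf_{\alpha_1,\dots,\alpha_k\in\mathbb{R}}\sum_{j=1}^k\|W_\psi f-e^{i\alpha_j}W_\psi g\|_{L^2(D_j)}\le c\cdot\Biggl(\sum_{j=1}^k\frac{\Delta_j^2}{\delta_j^2}\bigl(1+\rho(r_j/s_j)s_j\bigr)\Bigl(1+r_j^{1/2}\rho(r_j/s_j)(s_j^{1/2}+s_j^{-1/2})\Bigl|\frac{1}{1-r_j/y_j}\Bigr|^{s+1/2}\Bigr)\Biggr)\cdot\bigl\||W_\psi f|-|W_\psi g|\bigr\|_{W^{1,2}\left(\bigcup_{j=1}^k(D_j)_+\right)}.$$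
   Context: $\mathbb{R}_+=\{x\in\mathbb{R}:x>0\}$, $\mathbb{C}_+=\{x+iy:\ x\in\mathbb{R},\ y>0\}$; $\mathbb{C}$ is identified with $\mathbb{R}^2$ via $x+iy\leftrightarrow(x,y)$. $B_r(z)$ is the open disc of radius $r$ and center $z$ (empty if $r=0$). The Fourier transform is $\widehat f(\omega)=\int_{\mathbb{R}}f(t)e^{-2\pi i t\omega}\,dt$. Wavelet transform: $W_\psi f(x,y):=\frac{1}{|y|^{1/2}}\int_{\mathbb{R}}f(t)\overline{\psi((t-x)/y)}\,dt$. The Cauchy wavelet $\psi$ of order $s\in\mathbb{N}$ is defined by $\widehat\psi(\omega)=\omega^s e^{-2\pi\omega}\chi_{\omega>0}(\omega)$. Atoll functions: for a bounded domain $D\subset\mathbb{C}$, a hole $D_0$ of $D$ (simply connected domain, possibly empty, with $\overline{D_0}\subset D$), $D_+:=D\setminus\overline{D_0}$, and $\Delta\ge\delta>0$, $$\mathcal{H}(D,D_0,\delta,\Delta):=\{F\in C^1(D):\ \max\{|F(z)|,|\nabla|F|(z)|\}\le\Delta\ \text{for all } z\in D,\ |F(z)|\ge\delta\ \text{for all } z\in D_+\}.$$ Sobolev norm: $\|F\|_{W^{1,p}(D)}=\|F\|_{L^p(D)}+\|\nabla F\|_{L^p(D)}$. *)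

(* Defs.v *)
From HB Require Import structures.
From mathcomp Require Import all_boot all_order all_algebra.
From mathcomp Require Import all_classical all_reals all_analysis.
From mathcomp Require Import complex.

Set Implicit Arguments.
Unset Strict Implicit.
Unset Printing Implicit Defensive.

Import Order.TTheory GRing.Theory Num.Theory.
Import numFieldNormedType.Exports.

Local Open Scope classical_set_scope.
Local Open Scope ring_scope.
Local Open Scope complex_scope.

(* Complex-valued functions take values in R[i]; points x + iy of the domain C
   are pairs (x, y) : R * R, so that product topology, product measure and
   real differentiability are the library's. *)

Definition cmod {R : realType} (w : R[i]) : R := ComplexField.Normc.normc w.

Definition expi {R : realType} (a : R) : R[i] := cos a +i* sin a.

Section Integrals.
Context {R : realType} {d : measure_display} {T : measurableType d}.
Variable mu : {measure set T -> \bar R}.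

Definition cintegral (D : set T) (f : T -> R[i]) : R[i] :=
  (\int[mu]_(t in D) complex.Re (f t)) +i* (\int[mu]_(t in D) complex.Im (f t)).

Definition Lp_norm (p : \bar R) (D : set T) (g : T -> R) : \bar R :=
  ('N[mu]_p [(EFin \o g) \_ D])%E.

End Integrals.

Section RealLine.
Context {R : realType}.
Local Notation lambda := (@lebesgue_measure R).
Implicit Types (f h psi : R -> R[i]).

Definition L2_norm f : \bar R := Lp_norm lambda 2%:E setT (fun t => cmod (f t)).

Definition L2 f : Prop :=
  [/\ measurable_fun setT (fun t => complex.Re (f t)),
      measurable_fun setT (fun t => complex.Im (f t)) &
      (L2_norm f < +oo)%E].

Definition truncated_fourier f (n : nat) (w : R) : R[i] :=
  cintegral lambda `[- n%:R, n%:R] (fun t => f t * expi (- (2 * pi * t * w))).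

(* h is (a representative of) the Fourier transform of f in L^2: the L^2-limit
   of the Fourier integrals of f over [-n, n] (Plancherel's extension). *)
Definition is_fourier f h : Prop :=
  L2 h /\
  (fun n : nat => L2_norm (fun w => truncated_fourier f n w - h w)) @ \oo
    --> 0%:E.

(* f is in L^2 and its Fourier transform is essentially supported in R_+. *)
Definition analytic_signal f : Prop :=
  L2 f /\
  exists2 h, is_fourier f h & {ae lambda, forall w, w <= 0 -> h w = 0}.

Definition is_cauchy_wavelet (s : nat) psi : Prop :=
  L2 psi /\
  is_fourier psi
    (fun w => (if 0 < w then w ^+ s * expR (- (2 * pi * w)) else 0)%:C).

Definition wavelet_transform psi f (z : R * R) : R[i] :=
  ((Num.sqrt `|z.2|)^-1)%:C *
  cintegral lambda setT (fun t => f t * conjc (psi ((t - z.1) / z.2))).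

End RealLine.

Section Plane.
Context {R : realType}.
Implicit Types (D U : set (R * R)) (u : R * R -> R) (F : R * R -> R[i]).

Definition mu2 :
    {measure set (measurableTypeR R * measurableTypeR R) -> \bar R} :=
  ((@lebesgue_measure R) \x (@lebesgue_measure R))%E.

(* The library's norm on R * R is the max norm. *)
Definition enorm (v : R * R) : R := Num.sqrt (v.1 ^+ 2 + v.2 ^+ 2).

Definition disc (r : R) (z : R * R) : set (R * R) :=
  [set w | enorm (w - z) < r].

Definition grad u (z : R * R) : R * R := ('D_(1, 0) u z, 'D_(0, 1) u z).

(* C^1 on an open set D. *)
Definition C1_on D u : Prop :=
  forall z, D z ->
    [/\ differentiable u z,
        {for z, continuous (fun w => (grad u w).1)} &
        {for z, continuous (fun w => (grad u w).2)}].

(* At a zero of F the modulus |F| need not be differentiable (and if it is, its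
   gradient vanishes there), so the gradient bound bears on the points where
   |F| is differentiable; these include all points where F does not vanish. *)
Definition atoll D D0 (delta Delta : R) F : Prop :=
  [/\ C1_on D (fun z => complex.Re (F z)),
      C1_on D (fun z => complex.Im (F z)),
      (forall z, D z -> cmod (F z) <= Delta /\
         (differentiable (fun w => cmod (F w)) z ->
          enorm (grad (fun w => cmod (F w)) z) <= Delta)) &
      (forall z, (D `\` closure D0) z -> delta <= cmod (F z))].

Definition locally_integrable2 U u : Prop :=
  forall K, compact K -> K `<=` U -> mu2.-integrable K (EFin \o u).

Definition test_function U (phi : R * R -> R) : Prop :=
  C1_on setT phi /\
  exists K, [/\ compact K, K `<=` U & forall z, ~ K z -> phi z = 0].

(* G is a weak (distributional) gradient of u on the open set U. *)
Definition weak_gradient U u (G : R * R -> R * R) : Prop :=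
  [/\ measurable_fun U (fun z => (G z).1), measurable_fun U (fun z => (G z).2),
      locally_integrable2 U u,
      locally_integrable2 U (fun z => (G z).1)
        /\ locally_integrable2 U (fun z => (G z).2) &
      forall phi, test_function U phi ->
        (\int[mu2]_(z in U) (u z * (grad phi z).1))%R =
          - (\int[mu2]_(z in U) ((G z).1 * phi z))%R
        /\
        (\int[mu2]_(z in U) (u z * (grad phi z).2))%R =
          - (\int[mu2]_(z in U) ((G z).2 * phi z))%R].

(* The W^{1,p}(U) norm. A weak gradient is unique up to a null set, so the
   infimum is over at most one value; it is +oo when there is none. *)
Definition sobolev_norm (p : \bar R) U u : \bar R :=
  (Lp_norm mu2 p U u +
   ereal_inf [set Lp_norm mu2 p U (fun z => enorm (G z)) |
              G in weak_gradient U u])%E.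

End Plane.

(* Main.v *)
Require Import Defs.
From HB Require Import structures.
From mathcomp Require Import all_boot all_order all_algebra.
From mathcomp Require Import all_classical all_reals all_analysis.
From mathcomp Require Import complex measurable_realfun ring lra zify.

Set Implicit Arguments.
Unset Strict Implicit.
Unset Printing Implicit Defensive.

Import Order.TTheory GRing.Theory Num.Theory.
Import numFieldNormedType.Exports.

Local Open Scope classical_set_scope.
Local Open Scope ring_scope.
Local Open Scope complex_scope.

(** Up to a constant and the factor y ^ (s + 1/2), the transform of f at
    z = x + iy is Phi_f(z), the integral of f(t) (t - z) ^ -(s+1) dt, which is
    holomorphic in the upper half plane (wavelet_transformE,
    cauchy_integral_cderiv).  The quotient W g / W f is therefore a holomorphic
    function h wherever W f does not vanish, and everything rests on estimates
    for h on the annulus between the hole and the boundary of a disc.  The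
    modulus |W f| is bounded below on that annulus but vanishes on the real
    axis, where the factor 1 / sqrt |y| is 1 / sqrt 0 = 0; so a disc that carries
    an atoll lies in the upper half plane (atoll_height).

    On the annulus.  The mean of h over a circle around the center does not
    depend on the circle; let c be this mean.  The Poincare inequality on each
    circle gives the Poincare inequality |h - c| <= 2 pi S |h'| in L^2 of the
    annulus, S being the outer radius (annulus_poincare).  If e^(it) c = |c| then
      |1 - e^(it) h| <= |1 - |h|| + 2 |h - c|,
    and multiplication by W f turns the left side into |W f - e^(it) W g| and the
    first term on the right into | |W f| - |W g| | (alignment_pointwise).  For h'
    put u = |W f| - |W g| = |W f| (1 - |h|).  As |grad |h|| = |h'| off the zeros
    of h, the product rule bounds |h'| by |grad u| / delta and |u| Delta / delta^2.
    The norm in the statement uses a weak gradient of u; where u is of class C^1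
    it agrees with the classical one almost everywhere (weak_gradient_ae), and
    the zeros of h are harmless: those with h' <> 0 are isolated, hence form a
    null set, and at the others there is nothing to bound (ae_simple_zeros,
    quotient_derivative_le).  This gives annulus_alignment, with a constant that
    depends on Delta, delta and S only.

    In the hole.  Phi_f - e^(it) Phi_g is holomorphic in the whole disc, and the
    mean of the square of the modulus of a holomorphic function grows with the
    radius (circle_integral_monotone).  So its L^2 norm over the hole is bounded
    by that over the annulus between the radii r and (r + S) / 2; the weight
    y ^ (2 s + 1) costs a power of 1 / (1 - r / S), because this annulus stays
    away from the real axis (disc_le_annulus, wavelet_disc_le_annulus).  The
    resulting factor hole_factor is the function rho.  The two estimates make up
    disc_alignment, and elementary inequalities compare its constant with the
    one of the statement (radius_constant).

    The Cauchy wavelet.  Only the Fourier transform of psi is given, as a limit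
    in L^2.  Testing it against e^(-2 pi a |w|) e^(2 pi i x w) yields the
    convolution of psi with the Poisson kernel of height a, which is then the
    explicit function s! / (2 pi (1 + a - i x)) ^ (s+1) (poisson_wavelet).
    Integration over x in an interval, with a tending to 0, shows that psi and
    s! / (2 pi (1 - i t)) ^ (s+1) have the same integral over every interval and
    hence agree almost everywhere (cauchy_wavelet_ae). *)

(** * Boxes, null functions and one-dimensional integrals *)

(** The image of Lebesgue measure under u |-> a u + b, scaled by a, gives
    every interval its length, so it is Lebesgue measure. *)
Lemma ge0_integral_affine {R : realType} (a b : R) (f : R -> \bar R) : 0 < a ->
  measurable_fun [set: R] f -> (forall y, 0 <= f y)%E ->
  (\int[@lebesgue_measure R]_y f y = a%:E * \int[@lebesgue_measure R]_u f (a * u + b)%R)%E.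
Proof.
move=> a0 mf f0.
pose phi : measurableTypeR R -> measurableTypeR R := fun u => a * u + b.
have mphi : measurable_fun setT phi.
  by apply: measurable_funD => //; exact: measurable_funM.
pose aN : {nonneg R} := NngNum (ltW a0).
pose nu : {measure set (measurableTypeR R) -> \bar R} :=
  measure_function_pushforward__canonical__measure_function_Measure
     (@lebesgue_measure R) mphi.
pose m1 := mscale aN nu.
have h X : measurable X -> lebesgue_measure X = m1 X.
  apply: lebesgue_measure_unique => _ [[c d]] _ <- /=.
  rewrite /m1 /mscale /= /pushforward.
  have -> : phi @^-1` `]c, d]%classic = `](c - b) / a, (d - b) / a]%classic.
    apply/seteqP; split => u /=; rewrite !in_itv /= /phi;
    rewrite ltr_pdivrMr// ler_pdivlMr// ltrBlDr lerBrDr [u * a]mulrC; by [].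
  rewrite !lebesgue_measure_itv /= !lte_fin ltr_pM2r ?invr_gt0// ltrD2r.
  case: ifP => _; rewrite ?mule0// -!EFinB -EFinM; congr EFin.
  by field; rewrite gt_eqF.
transitivity (\int[m1]_y f y)%E.
  by apply: eq_measure_integral => A mA _; exact: h.
rewrite ge0_integral_mscale//=.
by rewrite ge0_integral_pushforward.
Qed.

Definition obox {R : realType} (q : R * R * (R * R)) : set (R * R) :=
  `]q.1.1, q.1.2[ `*` `]q.2.1, q.2.2[.
Definition cbox {R : realType} (q : R * R * (R * R)) : set (R * R) :=
  `[q.1.1, q.1.2] `*` `[q.2.1, q.2.2].
Definition ratbox {R : realType} (q : rat * rat * (rat * rat)) : R * R * (R * R) :=
  ((ratr q.1.1, ratr q.1.2), (ratr q.2.1, ratr q.2.2)).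

(** Rational boxes form a countable base, through which statements about
    open sets of the plane reduce to countably many boxes. *)
Lemma open_ratbox {R : realType} (U : set (R * R)) (z : R * R) : open U -> U z ->
  exists q, obox (ratbox q) z /\ cbox (ratbox q) `<=` U.
Proof.
move=> oU Uz; have /nbhs_ballP[e /= e0 eU] : nbhs z U by exact: open_nbhs_nbhs.
have [a a1] : exists a : rat, (ratr a : R) \in `]z.1 - e, z.1[ by apply: rat_in_itvoo; rewrite ltrBlDr ltrDl.
have [b b1] : exists a : rat, (ratr a : R) \in `]z.1, z.1 + e[ by apply: rat_in_itvoo; rewrite ltrDl.
have [c c1] : exists a : rat, (ratr a : R) \in `]z.2 - e, z.2[ by apply: rat_in_itvoo; rewrite ltrBlDr ltrDl.
have [d d1] : exists a : rat, (ratr a : R) \in `]z.2, z.2 + e[ by apply: rat_in_itvoo; rewrite ltrDl.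
move: a1 b1 c1 d1; rewrite !in_itv /= => /andP[a1 a2] /andP[b1 b2] /andP[c1 c2] /andP[d1 d2].
exists ((a, b), (c, d)); split; first by split; rewrite /= in_itv /=; apply/andP.
move=> w [] /=; rewrite !in_itv /= => /andP[w1 w2] /andP[w3 w4].
apply: eU; split; rewrite /ball /= ltr_norml; lra.
Qed.

Lemma measurable_obox {R : realType} (q : R * R * (R * R)) : measurable (obox q).
Proof. by apply: measurableX; exact: measurable_itv. Qed.

Lemma measurable_cbox {R : realType} (q : R * R * (R * R)) : measurable (cbox q).
Proof. by apply: measurableX; exact: measurable_itv. Qed.

Lemma open_measurable_plane {R : realType} (U : set (R * R)) : open U ->
  measurable (U : set (measurableTypeR R * measurableTypeR R)).
Proof.
move=> oU; pose F n := if unpickle n is Some q then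
   if `[< cbox (@ratbox R q) `<=` U >] then obox (@ratbox R q) else set0 else set0.
have -> : U = \bigcup_n F n.
  apply/seteqP; split=> [z Uz|z [n _]].
    have [q [qz qU]] := open_ratbox oU Uz.
    have Fq : F (pickle q) = obox (ratbox q) by rewrite /F pickleK; case: asboolP.
    by exists (pickle q); [exact: I|rewrite Fq].
  rewrite /F; case: unpickle => // q; case: asboolP => // qU [/=].
  rewrite !in_itv /= => /andP[a b] /andP[c d].
  by apply: qU; split; rewrite /= in_itv /= !ltW.
apply: bigcupT_measurable => n; rewrite /F; case: unpickle => // q.
by case: asboolP => // _; exact: measurable_obox.
Qed.

Lemma open_continuous_measurable_plane {R : realType} (U : set (R * R)) (u : R * R -> R) :
  open U -> (forall z, U z -> {for z, continuous u}) ->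
  measurable_fun (U : set (measurableTypeR R * measurableTypeR R)) u.
Proof.
move=> oU cu mU; apply: (measurability _ (RGenOpens.measurableE R)).
move=> _ [_ [a [b ->] <-]]; apply: open_measurable_plane.
rewrite openE => z [Uz uz]; rewrite /interior.
apply: filterI; first exact: open_nbhs_nbhs.
by apply: (cu z Uz); apply: open_nbhs_nbhs; split => //; exact: interval_open.
exact: mU.
Qed.

(** The measurable sets over which f has integral 0 form a Dynkin system, so
    it is enough to test a pi-system that generates the measurable sets. *)
Lemma integral_eq0_pi_system d (T : measurableType d) (R : realType)
    (mu : {measure set T -> \bar R}) (G : set (set T)) (f : T -> \bar R) :
  measurable = <<s G >> -> setI_closed G -> mu.-integrable setT f ->
  (\int[mu]_x f x = 0)%E -> (forall A, G A -> \int[mu]_(x in A) f x = 0)%E ->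
  ae_eq mu setT f (cst 0%E).
Proof.
move=> GE GI intf fT fG.
have mf := measurable_int _ intf.
pose C := [set A : set T | measurable A /\ (\int[mu]_(x in A) f x = 0)%E].
have dC : dynkin C.
  split; first by split.
  - move=> A [mA fA]; split; first exact: measurableC.
    move: fT; rewrite -(setUv A) integral_setU//; last 3 first.
    + exact: measurableC.
    + exact: measurable_funTS.
    + by rewrite disj_set2E setICr.
    by rewrite fA add0e.
  - move=> F tF CF; have mF k : measurable (F k) by have [] := CF k.
    split; first exact: bigcupT_measurable.
    rewrite integral_bigcup//; last first.
      by apply: (integrableS measurableT) => //; exact: bigcupT_measurable.
    by apply: eseries0 => i _ _; have [] := CF i.
have mG : G `<=` measurable by rewrite GE; exact: sub_gen_smallest.
have mC : measurable `<=` C.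
  rewrite GE -setI_closed_g_dynkin_g_sigma_algebra//.
  by apply: smallest_sub => // A GA; split; [exact: mG|exact: fG].
apply: integral_ae_eq => //.
by move=> E _ mE; rewrite integral0; have [] := mC _ mE.
Qed.

Lemma setI_itvoo {R : realType} (a b c d : R) :
  `]a, b[%classic `&` `]c, d[%classic = `]Num.max a c, Num.min b d[%classic.
Proof.
apply/seteqP; split=> [x []|x] /=; rewrite !in_itv /= gt_max lt_min.
  by move=> /andP[-> ->] /andP[-> ->].
by move=> /andP[/andP[-> ->] /andP[-> ->]].
Qed.

Lemma ae_eq0_intervals {R : realType} (f : R -> \bar R) :
  (@lebesgue_measure R).-integrable setT f ->
  (\int[@lebesgue_measure R]_x f x = 0)%E ->
  (forall a b, \int[@lebesgue_measure R]_(x in `]a, b[) f x = 0)%E ->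
  ae_eq (@lebesgue_measure R) setT f (cst 0%E).
Proof.
move=> intf fT fab.
apply: (@integral_eq0_pi_system _ (measurableTypeR R) R (@lebesgue_measure R) (@RGenOpens.G R) f) => //.
- exact: RGenOpens.measurableE.
- move=> _ _ [a [b ->]] [c [d ->]]; rewrite setI_itvoo.
  by exists (Num.max a c), (Num.min b d).
- by move=> _ [a [b ->]].
Qed.

(** A strip is a countable union of boxes, so boxes generate the
    product sigma-algebra. *)
Lemma measurable_plane_oboxE {R : realType} :
  @measurable _ (measurableTypeR R * measurableTypeR R)%type =
  <<s range (@obox R) >>.
Proof.
apply/seteqP; split; last first.
  by apply: smallest_sub; [exact: sigma_algebra_measurable|
    move=> _ [q _ <-]; exact: measurable_obox].
have cov : \bigcup_n `](- n%:R), n%:R[%classic = [set: R].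
  apply/seteqP; split => // x _; exists (Num.bound `|x|) => //=.
  by rewrite in_itv /= -ltr_norml archi_boundP.
have boxesU F : (forall n : nat, <<s range (@obox R) >> (F n)) ->
    <<s range (@obox R) >> (\bigcup_n F n).
  by case: (smallest_sigma_algebra [set: R * R] (range (@obox R))) => _ _; exact.
apply: smallest_sub; first exact: smallest_sigma_algebra.
have H (p : R * R -> R) : (forall a b, <<s range (@obox R) >> (p @^-1` `]a, b[%classic)) ->
    preimage_set_system setT p (@measurable _ (measurableTypeR R)) `<=` <<s range (@obox R) >>.
  move=> pab; rewrite RGenOpens.measurableE -g_sigma_preimageE.
  apply: smallest_sub; first exact: smallest_sigma_algebra.
  by move=> _ [_ [a [b ->]] <-]; rewrite setTI.
rewrite subUset; split; apply: H => a b.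
  rewrite (_ : _ @^-1` _ = \bigcup_n obox ((a, b), (- n%:R, n%:R))).
    by apply: boxesU => n; apply: sub_gen_smallest; exists ((a, b), (- n%:R, n%:R)).
  by rewrite /obox /= -setX_bigcupr cov; apply/seteqP; split => [x|x []] //=.
rewrite (_ : _ @^-1` _ = \bigcup_n obox ((- n%:R, n%:R), (a, b))).
  by apply: boxesU => n; apply: sub_gen_smallest; exists ((- n%:R, n%:R), (a, b)).
by rewrite /obox /= -setX_bigcupl cov; apply/seteqP; split => [x|x []] //=.
Qed.

Lemma ae_eq0_boxes {R : realType} (f : R * R -> \bar R) :
  (@mu2 R).-integrable setT f -> (\int[@mu2 R]_x f x = 0)%E ->
  (forall q, \int[@mu2 R]_(x in obox q) f x = 0)%E ->
  ae_eq (@mu2 R) setT f (cst 0%E).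
Proof.
move=> intf fT fab.
apply: (@integral_eq0_pi_system _ (measurableTypeR R * measurableTypeR R)%type R (@mu2 R) (range (@obox R)) f) => //.
- exact: measurable_plane_oboxE.
- move=> _ _ [p _ <-] [q _ <-]; rewrite /obox -setXI !setI_itvoo.
  by exists ((Num.max p.1.1 q.1.1, Num.min p.1.2 q.1.2), (Num.max p.2.1 q.2.1, Num.min p.2.2 q.2.2)).
- by move=> _ [q _ <-].
Qed.

Lemma integral_itv_derive {R : realType} (F f : R -> R) (a b : R) : a <= b ->
  (forall x, x \in `[a, b] -> is_derive x 1 F (f x)) ->
  (forall x, x \in `[a, b] -> {for x, continuous f}) ->
  (\int[@lebesgue_measure R]_(x in `[a, b]) (f x)%:E = (F b - F a)%:E)%E.
Proof.
rewrite le_eqVlt => /predU1P[<- _ _|ab dF cf].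
  by rewrite set_itv1 integral_set1 subrr.
have cF x : x \in `[a, b] -> {for x, continuous F}.
  by move=> xab; apply: differentiable_continuous; apply/derivable1_diffP; have := dF x xab.
rewrite (@continuous_FTC2 _ f F)//.
- by apply: continuous_in_subspaceT => x; rewrite inE => /cf.
- split.
  + by move=> x xab; have := dF x (subset_itv_oo_cc xab).
  + by apply: cvg_at_right_filter; apply: cF; rewrite in_itv /= lexx ltW.
  + by apply: cvg_at_left_filter; apply: cF; rewrite in_itv /= lexx ltW.
- move=> x xab; have := dF x (subset_itv_oo_cc xab) => dFx.
  by rewrite derive1E; apply: derive_val.
Qed.

Lemma Rintegral_itv_derive {R : realType} (F f : R -> R) (a b : R) : a <= b ->
  (forall x, x \in `[a, b] -> is_derive x 1 F (f x)) ->
  (forall x, x \in `[a, b] -> {for x, continuous f}) ->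
  \int[@lebesgue_measure R]_(x in `[a, b]) f x = F b - F a.
Proof. by move=> ab dF cf; rewrite /Rintegral (integral_itv_derive ab dF cf). Qed.

Lemma antiderivative {R : realType} (g : R -> R) (a : R) : continuous g ->
  exists G : R -> R, forall x : R, a < x -> is_derive x 1 G (g x).
Proof.
move=> cg; exists (fun x => \int[@lebesgue_measure R]_(t in `[a, x]) g t) => x ax.
have x1 : x < x + 1 by rewrite ltrDl.
have intg : (@lebesgue_measure R).-integrable `[a, x + 1] (EFin \o g).
  apply: continuous_compact_integrable; first exact: segment_compact.
  exact: continuous_subspaceT.
have [d1 d2] := continuous_FTC1_closed x1 intg ax (cg x).
split; [exact: d1|rewrite -d2 derive1E; reflexivity].
Qed.

(** The substitution t = atan u maps the line onto the open interval; the
    endpoints are reached in the limit over [-n, n]. *)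
Lemma integral_atan {R : realType} (g : R -> R) : continuous g -> (forall x, 0 <= g x) ->
  (\int[@lebesgue_measure R]_u (g (atan u) * (1 + u ^+ 2)^-1)%:E =
   \int[@lebesgue_measure R]_(t in `[(- (pi / 2))%R, (pi / 2)%R]) (g t)%:E)%E.
Proof.
move=> cg g0.
have [G dG] := antiderivative (- pi : R) cg.
have p0 : (0 : R) < pi := pi_gt0 R.
pose H (u : R) : R := G (atan u); pose h (u : R) : R := g (atan u) * (1 + u ^+ 2)^-1.
have datan (u : R) : is_derive u 1 atan (1 + u ^+ 2)^-1.
  by apply: DeriveDef; [exact: derivable_atan|rewrite -derive1E derive1_atan].
have dH (u : R) : is_derive u 1 H (h u).
  have dGa := dG (atan u) _; have := @is_derive1_comp _ G atan u _ _ (dGa _) (datan u).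
  by apply; have := atan_gtNpi2 u; lra.
have ch : continuous h.
  move=> u; apply: cvgM.
    by apply: continuous_comp; [exact: continuous_atan|exact: cg].
  apply: cvgV; first by rewrite lt0r_neq0// ltr_pwDl// sqr_ge0.
  by apply: cvgD; [exact: cvg_cst|exact: exprn_continuous].
have le_pi2 : - (pi / 2) <= pi / 2 :> R by lra.
have dGi (x : R) : x \in `[- (pi / 2), pi / 2] -> is_derive x 1 G (g x).
  by rewrite in_itv /= => /andP[x1 x2]; apply: dG; lra.
rewrite (integral_itv_derive le_pi2 dGi (fun x _ => cg x)).
pose S (n : nat) : set (measurableTypeR R) := `[- (n%:R : R), n%:R]%classic.
have -> : [set: R] = \bigcup_n S n.
  apply/seteqP; split => // x _; exists (Num.bound `|x|)  => //=.
  by rewrite /S /= in_itv /= -ler_norml ltW// archi_boundP.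
have mh : measurable_fun setT h by exact: continuous_measurable_fun.
have /cvg_lim <- := @ge0_nondecreasing_set_cvg_integral _ (measurableTypeR R) R S (EFin \o h) (@lebesgue_measure R)
  ltac:(by apply/nondecreasing_seqP => n; apply/subsetPset => x; rewrite /S /=
    !in_itv /= -natr1 => /andP[? ?]; apply/andP; split; lra)
  (fun i => measurable_itv _)
  (fun i => proj2 (measurable_EFinP _ _) (measurable_funTS mh))
  ltac:(by move=> n x _; rewrite lee_fin mulr_ge0// invr_ge0 addr_ge0// sqr_ge0) => //.
apply/cvg_lim => //.
rewrite (_ : (fun i : nat => _) = (fun n : nat => (H n%:R - H (- n%:R))%:E)); last first.
  apply/funext => n.
  have nn : - n%:R <= n%:R :> R by rewrite (@le_trans _ _ 0)// oppr_le0.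
  by rewrite (integral_itv_derive nn (fun x _ => dH x) (fun x _ => ch x)).
have an : (atan (n%:R : R) : R) @[n --> \oo] --> (pi / 2 : R).
  by apply: (cvg_comp _ _ (@cvgr_idn R)); exact: cvgy_atan.
have cG x : - pi < x -> {for x, continuous G}.
  by move=> xp; apply: differentiable_continuous; apply/derivable1_diffP; have := dG x xp.
apply: cvg_EFin; first exact: nearW.
apply: cvgB.
  by apply: (cvg_comp _ _ an); apply: cG; lra.
have an' : (atan (- (n%:R : R)) : R) @[n --> \oo] --> (- (pi / 2) : R).
  by rewrite (_ : (fun n : nat => _) = (fun n : nat => - atan n%:R :> R));
    [exact: cvgN an|apply/funext => n; rewrite atanN].
by apply: (cvg_comp _ _ an'); apply: cG; lra.
Qed.

(** * Polar coordinates *)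

Section Polar.
Context {R : realType}.
Local Notation lam := (@lebesgue_measure R).
Local Notation R1 := (measurableTypeR R).

Lemma integral_mu2_xy (f : R * R -> R) :
  measurable_fun [set: R1 * R1] f -> (forall z, 0 <= f z) ->
  (\int[@mu2 R]_z (f z)%:E = \int[lam]_x \int[lam]_y (f (x, y))%:E)%E.
Proof.
move=> mf f0; rewrite /mu2 (@fubini_tonelli1 _ _ R1 R1 R lam lam (EFin \o f))//.
exact/measurable_EFinP.
Qed.

Lemma integral_xy_yx (f : R * R -> R) :
  measurable_fun [set: R1 * R1] f -> (forall z, 0 <= f z) ->
  (\int[lam]_x \int[lam]_y (f (x, y))%:E = \int[lam]_y \int[lam]_x (f (x, y))%:E)%E.
Proof.
move=> mf f0; rewrite (@fubini_tonelli _ _ R1 R1 R lam lam (EFin \o f))//.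
exact/measurable_EFinP.
Qed.

Lemma measurable_fun_section (f : R * R -> R) (x : R) :
  measurable_fun [set: R1 * R1] f -> measurable_fun [set: R] (fun y => (f (x, y))%:E).
Proof. by move=> mf; apply/measurable_EFinP; apply: measurable_fun_pair2. Qed.

Lemma measurable_inner_integral (f : R * R -> R) :
  measurable_fun [set: R1 * R1] f -> (forall z, 0 <= f z) ->
  measurable_fun [set: R] (fun x => \int[lam]_y (f (x, y))%:E)%E.
Proof.
move=> mf f0.
apply: (@measurable_fun_fubini_tonelli_F _ _ R1 R1 R lam (EFin \o f)) => //.
exact/measurable_EFinP.
Qed.

Lemma ge0_integral_translate (f : R * R -> R) (z0 : R * R) :
  measurable_fun [set: R1 * R1] f -> (forall z, 0 <= f z) ->
  (\int[@mu2 R]_z (f z)%:E = \int[@mu2 R]_z (f (z0 + z))%:E)%E.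
Proof.
move=> mf f0.
have mfz : measurable_fun [set: R1 * R1] (fun z => f (z0 + z)).
  apply: (measurableT_comp mf).
  by apply: measurable_fun_pair => /=; apply: measurable_funD.
rewrite (integral_mu2_xy mf f0) (integral_mu2_xy mfz (fun z => f0 _)).
rewrite (@ge0_integral_affine R 1 z0.1)//; last 2 first.
- exact: measurable_inner_integral.
- by move=> y; apply: integral_ge0 => x _; rewrite lee_fin.
rewrite mul1e; apply: eq_integral => x _.
rewrite (@ge0_integral_affine R 1 z0.2)//; last 2 first.
- exact: measurable_fun_section.
- by move=> y; rewrite lee_fin.
rewrite mul1e; apply: eq_integral => y _ /=.
by rewrite !mul1r (addrC x) (addrC y).
Qed.

Lemma ge0_integral_half (h : R -> \bar R) : measurable_fun [set: R] h ->
  (forall x, 0 <= h x)%E ->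
  (\int[lam]_x h x = \int[lam]_(x in `]0%R, +oo[) (h x + h (- x)%R))%E.
Proof.
move=> mh h0.
have mhN : measurable_fun [set: R] (fun x : R => h (- x)).
  by apply: (measurableT_comp mh); exact: oppr_measurable.
rewrite ge0_integralD//; [|exact: measurable_funTS|exact: measurable_funTS].
rewrite (integral_itv_obnd_cbnd (f := fun x => h (- x)))//; last exact: measurable_funTS.
rewrite (@ge0_integration_by_substitution0 R (fun x : R => h (- x)))//.
rewrite -[in LHS](itv_setU_setT false (0%R : R)).
rewrite ge0_integral_setU//=.
- by rewrite addeC; congr (_ + _)%E; apply: eq_integral => x _; rewrite opprK.
- exact: measurable_funTS.
- rewrite disj_set2E; apply/eqP/seteqP; split => // x [] /=.
  by rewrite !in_itv /= andbT => /le_lt_trans /[apply]; rewrite ltxx.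
Qed.

(** Polar coordinates with the slope u = y / x in place of the angle: both
    coordinates are reached by one-dimensional substitutions that are affine in
    one variable while the other is fixed, first y = x u and then
    x = r / sqrt (1 + u^2).  The two summands come from the half planes x > 0
    and x < 0. *)
Lemma ge0_integral_fan (f : R * R -> R) :
  measurable_fun [set: R1 * R1] f -> (forall z, 0 <= f z) ->
  (\int[@mu2 R]_z (f z)%:E =
   \int[lam]_(r in `]0%R, +oo[) (r%:E * \int[lam]_u
     ((f (r / Num.sqrt (1 + u ^+ 2), r * u / Num.sqrt (1 + u ^+ 2)) +
       f (- (r / Num.sqrt (1 + u ^+ 2)), - (r * u / Num.sqrt (1 + u ^+ 2))))
      * (1 + u ^+ 2)^-1)%:E))%E.
Proof.
move=> mf f0.
pose g z := f z + f (- z.1, - z.2).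
have g0 z : 0 <= g z by apply: addr_ge0.
have mg : measurable_fun [set: R1 * R1] g.
  apply: measurable_funD => //; apply: (measurableT_comp mf).
  by apply: measurable_fun_pair; apply: (measurableT_comp (@oppr_measurable _ setT)).
rewrite (integral_mu2_xy mf f0) ge0_integral_half; last 2 first.
- exact: measurable_inner_integral.
- by move=> x; apply: integral_ge0 => y _; rewrite lee_fin.
pose k (z : R * R) := if 0 < z.1 then z.1 * g (z.1, z.1 * z.2) else 0.
have mk : measurable_fun [set: R1 * R1] k.
  apply: measurable_fun_ifT => //.
    by apply: measurable_fun_ltr.
  apply: measurable_funM => //; apply: (measurableT_comp mg).
  by apply: measurable_fun_pair => //; apply: measurable_funM.
have k0 z : 0 <= k z by rewrite /k; case: ltP => // z0; rewrite mulr_ge0// ltW.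
transitivity (\int[lam]_x \int[lam]_u (k (x, u))%:E)%E.
  rewrite [LHS]integral_mkcond; apply: eq_integral => x _; rewrite patchE.
  case: ifPn => [|]; rewrite ?inE ?notin_setE /= in_itv /= andbT => x0; last first.
    by rewrite (eq_integral (cst 0%E)) ?integral0// => u _; rewrite /k /=; case: ifP.
  have refl : (\int[lam]_y (f (- x, y))%:E = \int[lam]_y (f (- x, - y))%:E)%E.
    pose phi := fun y => (f (- x, y))%:E.
    have mphi : measurable_fun [set: R] phi by exact: measurable_fun_section.
    have mphiN : measurable_fun [set: R] (fun y : R => phi (- y)).
      by apply: (measurableT_comp mphi); exact: oppr_measurable.
    have phi0 y : (0 <= phi y)%E by rewrite lee_fin.
    apply: (etrans (ge0_integral_half mphi phi0)).
    apply/esym/(etrans (ge0_integral_half mphiN (fun y => phi0 (- y)))).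
    by apply: eq_integral => y _; rewrite opprK addeC.
  rewrite refl -ge0_integralD//; last 4 first.
  - by move=> y _; rewrite lee_fin.
  - exact: measurable_fun_section.
  - by move=> y _; rewrite lee_fin.
  - apply: (measurableT_comp (measurable_fun_section (- x) mf)).
    exact: oppr_measurable.
  rewrite (@ge0_integral_affine R x 0)//; last 2 first.
  - by apply: (measurable_fun_section x mg).
  - by move=> y; rewrite -EFinD lee_fin addr_ge0.
  rewrite -ge0_integralZl//.
  - apply: eq_integral => u _.
    by rewrite /k /= x0 EFinM /g /= addr0 EFinD.
  - apply: (@measurableT_comp _ _ _ R1 R1 _ (fun y => (g (x, y))%:E) _ (fun u => x * u + 0)).
      exact: (measurable_fun_section x mg).
    by apply: measurable_funD => //; apply: measurable_funM.
  - by move=> y _; rewrite -EFinD lee_fin addr_ge0.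
  - by rewrite lee_fin ltW.
rewrite integral_xy_yx//.
pose c (u : R) := (Num.sqrt (1 + u ^+ 2))^-1.
have sq0 (u : R) : 0 < 1 + u ^+ 2 by rewrite ltr_pwDl// sqr_ge0.
have c0 u : 0 < c u by rewrite invr_gt0 sqrtr_gt0.
have c2 u : c u ^+ 2 = (1 + u ^+ 2)^-1 by rewrite exprVn sqr_sqrtr// ltW.
pose l (z : R * R) := if 0 < z.1 then z.1 * (g (z.1 * c z.2, z.1 * z.2 * c z.2) * (1 + z.2 ^+ 2)^-1) else 0.
have mc : measurable_fun [set: R1] c.
  apply: continuous_measurable_fun => u; apply: cvgV.
    by rewrite gt_eqF// sqrtr_gt0.
  apply: continuous_comp; last exact: sqrt_continuous.
  by apply: cvgD; [exact: cvg_cst|exact: exprn_continuous].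
have mc2 : measurable_fun [set: R1] (fun u : R => (1 + u ^+ 2)^-1).
  apply: continuous_measurable_fun => u; apply: cvgV; first by rewrite gt_eqF.
  by apply: cvgD; [exact: cvg_cst|exact: exprn_continuous].
have ml : measurable_fun [set: R1 * R1] l.
  apply: measurable_fun_ifT => //.
    by apply: measurable_fun_ltr.
  apply: measurable_funM => //; apply: measurable_funM.
    have mcs : measurable_fun [set: R1 * R1] (fun z => c z.2) by exact: measurableT_comp.
    apply: (measurableT_comp mg); apply: measurable_fun_pair; last first.
      by apply: measurable_funM => //; apply: measurable_funM.
    by apply: measurable_funM.
  exact: (measurableT_comp mc2).
have l0 z : 0 <= l z.
  rewrite /l; case: ltP => // z0.
  by apply: mulr_ge0; [exact: ltW|apply: mulr_ge0 => //; rewrite invr_ge0; exact: ltW].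
transitivity (\int[lam]_u \int[lam]_r (l (r, u))%:E)%E.
  apply: eq_integral => u _.
  rewrite (@ge0_integral_affine R (c u) 0)//; last 2 first.
  - by apply/measurable_EFinP; apply: measurable_fun_pair1.
  - by move=> y; rewrite lee_fin.
  rewrite -ge0_integralZl//.
  - apply: eq_integral => r _; rewrite /k /l /= addr0 pmulr_rgt0//.
    case: ifP => [_|]; last by rewrite mule0.
    rewrite -EFinM; congr EFin.
    rewrite -c2 [c u * r]mulrC [r * c u * u]mulrAC; ring.
  - apply/measurable_EFinP; apply: (@measurableT_comp _ _ _ R1 R1 R1 (fun x => k (x, u)) _ (fun r => c u * r + 0)).
      by apply: measurable_fun_pair1.
    by apply: measurable_funD => //; apply: measurable_funM.
  - by move=> r _; rewrite lee_fin.
  - by rewrite lee_fin ltW.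
rewrite -integral_xy_yx// [RHS]integral_mkcond.
apply: eq_integral => r _; rewrite patchE.
case: ifPn => [|]; rewrite ?inE ?notin_setE /= in_itv /= andbT => r0; last first.
  by rewrite (eq_integral (cst 0%E)) ?integral0// => u _; rewrite /l /=; case: ifP.
rewrite -ge0_integralZl//.
- apply: eq_integral => u _; rewrite /l /= r0 EFinM; congr (_ * _)%E.
- apply/measurable_EFinP; apply: measurable_funM => //.
  have mgr := measurable_fun_pair2 r ml.
  have -> : (fun u => f (r / Num.sqrt (1 + u ^+ 2), r * u / Num.sqrt (1 + u ^+ 2)) +
     f (- (r / Num.sqrt (1 + u ^+ 2)), - (r * u / Num.sqrt (1 + u ^+ 2)))) =
     g \o (fun u => (r * c u, r * u * c u)) by [].
  apply: (measurableT_comp mg); apply: measurable_fun_pair.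
    by apply: measurable_funM.
  by apply: measurable_funM => //; apply: measurable_funM.
- by move=> u _; rewrite lee_fin; apply: mulr_ge0; [exact: addr_ge0|rewrite invr_ge0; exact: ltW].
- by rewrite lee_fin ltW.
Qed.

Definition polar (z0 : R * R) (r t : R) : R * R :=
  (z0.1 + r * cos t, z0.2 + r * sin t).

Lemma sin_atan_cos (u : R) : sin (atan u) = u * cos (atan u).
Proof.
rewrite -{2}(atanK u) /tan divfK// cos_atan invr_neq0// gt_eqF// sqrtr_gt0.
by rewrite ltr_pwDl// sqr_ge0.
Qed.

(** The angle t = atan u covers the right half plane, and the reflected
    summand is the angle t + pi; together they fill the interval
    [- pi / 2, 3 pi / 2]. *)
Lemma ge0_integral_polar (f : R * R -> R) (z0 : R * R) :
  measurable_fun [set: R1 * R1] f -> (forall z, 0 <= f z) ->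
  (forall r, 0 < r -> continuous (fun t : R => f (polar z0 r t))) ->
  (\int[@mu2 R]_z (f z)%:E =
   \int[lam]_(r in `]0%R, +oo[) (r%:E *
     \int[lam]_(t in `[(- (pi / 2))%R, (pi + pi / 2)%R]) (f (polar z0 r t))%:E))%E.
Proof.
move=> mf f0 cf.
rewrite (ge0_integral_translate z0 mf f0).
have mfz : measurable_fun [set: R1 * R1] (fun z => f (z0 + z)).
  apply: (measurableT_comp mf).
  by apply: measurable_fun_pair => /=; apply: measurable_funD.
rewrite (ge0_integral_fan mfz (fun z => f0 _)).
apply: eq_integral => r; rewrite inE /= in_itv /= andbT => r0; congr (_ * _)%E.
pose F (t : R) := f (polar z0 r t).
have F0 t : 0 <= F t by exact: f0.
have cF : continuous F by exact: cf.
have cFp : continuous (fun t : R => F (1 * t + pi)).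
  move=> t; apply: (@continuous_comp _ _ _ (fun t : R => 1 * t + pi) F); last exact: cF.
  by apply: cvgD; [apply: cvgM => //; exact: cvg_cst|exact: cvg_cst].
have mF : measurable_fun [set: R] (EFin \o F).
  by apply/measurable_EFinP; exact: continuous_measurable_fun.
have mFp : measurable_fun [set: R] (fun t : R => (F (1 * t + pi))%:E).
  by apply/measurable_EFinP; exact: continuous_measurable_fun.
transitivity (\int[lam]_u ((F (atan u) + F (1 * atan u + pi)) * (1 + u ^+ 2)^-1)%:E)%E.
  apply: eq_integral => u _; congr (((_ + _) * _)%:E); congr f; rewrite /polar /=.
    by rewrite sin_atan_cos cos_atan !mulrA.
  by rewrite mul1r cosDpi sinDpi sin_atan_cos cos_atan !mulrN !mulrA.
rewrite (integral_atan (g := fun t => F t + F (1 * t + pi))); last 2 first.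
- by move=> t; apply: cvgD; [exact: cF|exact: cFp].
- by move=> t; exact: addr_ge0.
have p0 : (0 : R) < pi := pi_gt0 R.
under eq_integral do rewrite EFinD.
rewrite ge0_integralD//; last 4 first.
- by move=> t _; rewrite lee_fin.
- exact: measurable_funTS.
- by move=> t _; rewrite lee_fin.
- exact: measurable_funTS.
have cover : [set` `[(- (pi / 2)), (pi + pi / 2)]] =
    [set` `[(- (pi / 2)), pi / 2]] `|` [set` `]pi / 2, pi + pi / 2]] :> set R.
  by rewrite -itv_bndbnd_setU// bnd_simp; lra.
rewrite [in RHS]cover.
rewrite ge0_integral_setU//=; last 3 first.
- exact: measurable_funTS.
- by move=> t _; rewrite lee_fin.
- rewrite disj_set2E; apply/eqP/seteqP; split => // x [] /=.
  by rewrite !in_itv /= => /andP[_ h1] /andP[h2 _]; lra.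
rewrite -/(F _); congr (_ + _)%E.
rewrite integral_itv_obnd_cbnd; last exact: measurable_funTS.
rewrite [LHS]integral_mkcond [RHS]integral_mkcond.
rewrite [RHS](@ge0_integral_affine R 1 pi)//.
- rewrite mul1e; apply: eq_integral => t _; rewrite !patchE.
  rewrite (_ : (t \in `[(- (pi / 2))%R, (pi / 2)%R]%classic) = ((1 * t + pi) \in `[(pi / 2)%R, (pi + pi / 2)%R]%classic))//.
  by apply/idP/idP; rewrite !inE /= !in_itv /= => /andP[? ?]; apply/andP; split; lra.
- apply/(measurable_restrictT _ (measurable_itv _)).
  exact: (measurable_funTS mF).
- by move=> t; rewrite patchE; case: ifP => // _; rewrite lee_fin.
Qed.
End Polar.

(** * Complex derivatives *)

Section ComplexPlane.
Context {R : realType}.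
Implicit Types (z v w : R * R) (a b : R[i]).

Definition toC (v : R * R) : R[i] := v.1 +i* v.2.

Lemma cmodM a b : cmod (a * b) = cmod a * cmod b.
Proof. exact: ComplexField.Normc.normcM. Qed.

Lemma cmodV a : cmod a^-1 = (cmod a)^-1.
Proof. exact: ComplexField.Normc.normcV. Qed.

Lemma cmodX a n : cmod (a ^+ n) = cmod a ^+ n.
Proof.
elim: n => [|n IH]; first by rewrite !expr0 /cmod ComplexField.Normc.normc1.
by rewrite !exprS cmodM IH.
Qed.

Lemma cmodD a b : cmod (a + b) <= cmod a + cmod b.
Proof. exact: le_normcD. Qed.

Lemma cmodN a : cmod (- a) = cmod a.
Proof. exact: normcN. Qed.

Lemma cmodB a b : cmod (a - b) <= cmod a + cmod b.
Proof. by rewrite -(cmodN b) cmodD. Qed.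

Lemma cmodE a : cmod a = Num.sqrt (complex.Re a ^+ 2 + complex.Im a ^+ 2).
Proof. by case: a. Qed.

Lemma cmod_ge0 a : 0 <= cmod a.
Proof. by rewrite cmodE sqrtr_ge0. Qed.

Lemma cmod_sqr a : cmod a ^+ 2 = complex.Re a ^+ 2 + complex.Im a ^+ 2.
Proof. by rewrite cmodE sqr_sqrtr// addr_ge0 ?sqr_ge0. Qed.

Lemma cmod_eq0 a : (cmod a == 0) = (a == 0).
Proof.
apply/eqP/eqP => [/ComplexField.Normc.eq0_normc//|->].
by rewrite /cmod ComplexField.Normc.normc0.
Qed.

Lemma cmod_gt0 a : (0 < cmod a) = (a != 0).
Proof. by rewrite lt_neqAle eq_sym cmod_eq0 cmod_ge0 andbT. Qed.

Lemma cmod_real (x : R) : cmod x%:C = `|x|.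
Proof. by rewrite cmodE /= expr0n /= addr0 sqrtr_sqr. Qed.

Lemma Re_le_cmod a : `|complex.Re a| <= cmod a.
Proof. by rewrite cmodE -sqrtr_sqr ler_wsqrtr// lerDl sqr_ge0. Qed.

Lemma Im_le_cmod a : `|complex.Im a| <= cmod a.
Proof. by rewrite cmodE -sqrtr_sqr ler_wsqrtr// lerDr sqr_ge0. Qed.

Lemma cmod_le_ReIm a : cmod a <= `|complex.Re a| + `|complex.Im a|.
Proof.
rewrite cmodE -[leRHS]ger0_norm ?addr_ge0// -sqrtr_sqr ler_wsqrtr//.
by rewrite sqrrD !real_normK ?num_real// lerD2r lerDl mulrn_wge0// mulr_ge0.
Qed.

Lemma toCD z w : toC (z + w) = toC z + toC w.
Proof. by []. Qed.

Lemma enorm_toC z : enorm z = cmod (toC z).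
Proof. by rewrite cmodE. Qed.

Lemma cmod_toC_le v : cmod (toC v) <= 2 * `|v|.
Proof.
apply: (le_trans (cmod_le_ReIm _)) => /=.
by rewrite mulr2n mulrDl !mul1r lerD// /Num.norm /= le_max lexx ?orbT.
Qed.

Lemma norm_le_cmod_toC v : `|v| <= cmod (toC v).
Proof. by rewrite /Num.norm /= ge_max (Re_le_cmod (toC v)) (Im_le_cmod (toC v)). Qed.

Lemma is_diff_quadratic (u : R * R -> R) z (a b C e : R) : 0 < e -> 0 <= C ->
  (forall v, `|v| < e -> `|u (z + v) - u z - (a * v.1 + b * v.2)| <= C * `|v| ^+ 2) ->
  is_diff z u (fun v => a * v.1 + b * v.2).
Proof.
move=> e0 C0 ub.
pose L : R * R -> R := fun v => a * v.1 + b * v.2.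
have Ll : linear L by move=> k x y; rewrite /L /= /GRing.scale /=; ring.
pose Lm := GRing.isLinear.Build _ _ _ _ L Ll.
pose LL : {linear (R * R)%type -> R} := HB.pack L Lm.
have Lc : continuous LL.
  move=> v; rewrite /LL /= /L; apply: cvgD; apply: cvgM; try exact: cvg_cst.
    exact: cvg_fst.
  exact: cvg_snd.
have E : u \o shift z = cst (u z) + LL +o_ (nbhs (0 : R * R)) id.
  apply/eqaddoP => eps eps0.
  have small (k : R) : 0 < k -> \forall v \near nbhs (0 : R * R), `|v| < k.
    move=> k0; apply/nbhs_ballP; exists k => //= v [] /=; rewrite /ball /= !sub0r !normrN.
    by move=> v1 v2; rewrite /Num.norm /= gt_max v1.
  near=> v; rewrite /=.
  have ve : `|v| < e by near: v; exact: small.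
  have vC : `|v| < eps / (C + 1) by near: v; apply: small; rewrite divr_gt0// ltr_pwDr.
  have -> : (u \o shift z - (cst (u z) + LL)) v = u (v + z) - (u z + L v) by [].
  rewrite (addrC v z) opprD addrA.
  apply: (le_trans (ub _ ve)); rewrite expr2 mulrA ler_wpM2r//.
  move: vC; rewrite ltr_pdivlMr ?ltr_pwDr// => /ltW; apply: le_trans.
  by rewrite mulrC mulrDr mulr1 lerDl.
have D := diff_unique Lc E.
split; last by rewrite D.
apply/diff_locallyP; rewrite D; split => //.
Unshelve. all: by end_near. Qed.
End ComplexPlane.

Section ComplexDerivative.
Context {R : realType}.
Implicit Types (z v w : R * R) (a b d : R[i]) (F : R * R -> R[i]).

Lemma is_derive_curve (u : R * R -> R) (g1 g2 : R -> R) (t p q a b : R) :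
  is_diff (g1 t, g2 t) u (fun v => p * v.1 + q * v.2) ->
  is_derive t 1 g1 a -> is_derive t 1 g2 b ->
  is_derive t 1 (fun s => u (g1 s, g2 s)) (p * a + q * b).
Proof.
move=> du [d1 e1] [d2 e2].
have D (g : R -> R) (c : R) : derivable g t 1 -> 'D_1 g t = c -> is_diff t g (fun x => x *: c).
  by move=> /derivable1_diffP dg gc; split=> //; apply/funext => x;
    rewrite diff1E// derive1E gc.
have dp := is_diff_pair (D g1 a d1 e1) (D g2 b d2 e2).
have dc := @is_diff_comp _ _ _ _ (fun s => (g1 s, g2 s)) _ u _ t dp du.
split.
  by apply: diff_derivable; case: dc.
rewrite deriveE; last by case: dc.
by rewrite (@diff_val _ _ _ _ _ _ _ dc) /= /GRing.scale /= !mul1r.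
Qed.

Lemma is_diff_derive (u : R * R -> R) (L : R * R -> R) z v :
  is_diff z u L -> 'D_v u z = L v.
Proof. by case=> du <-; rewrite deriveE. Qed.

(** The real differential of F is multiplication by d: the Cauchy-Riemann
    equations are built into the shape of the two linear forms. *)
Definition cderiv F z d : Prop :=
  is_diff z (fun w => complex.Re (F w)) (fun v => complex.Re d * v.1 + - complex.Im d * v.2) /\
  is_diff z (fun w => complex.Im (F w)) (fun v => complex.Im d * v.1 + complex.Re d * v.2).

Lemma ReM a b : complex.Re (a * b) = complex.Re a * complex.Re b - complex.Im a * complex.Im b.
Proof. by case: a b => [? ?] []. Qed.

Lemma ImM a b : complex.Im (a * b) = complex.Re a * complex.Im b + complex.Im a * complex.Re b.
Proof. by case: a b => [? ?] []. Qed.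

Lemma ReD a b : complex.Re (a + b) = complex.Re a + complex.Re b.
Proof. by case: a b => [? ?] []. Qed.

Lemma ImD a b : complex.Im (a + b) = complex.Im a + complex.Im b.
Proof. by case: a b => [? ?] []. Qed.

Lemma ReB a b : complex.Re (a - b) = complex.Re a - complex.Re b.
Proof. by case: a b => [? ?] []. Qed.

Lemma ImB a b : complex.Im (a - b) = complex.Im a - complex.Im b.
Proof. by case: a b => [? ?] []. Qed.

(** A remainder of second order in the Taylor formula gives complex
    differentiability with an explicit modulus, which is how functions
    defined by integrals are differentiated below. *)
Lemma cderiv_quadratic F z d (C e : R) : 0 < e -> 0 <= C ->
  (forall v, cmod (toC v) < e ->
     cmod (F (z + v) - F z - d * toC v) <= C * cmod (toC v) ^+ 2) ->
  cderiv F z d.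
Proof.
move=> e0 C0 Fd.
have H v : `|v| < e / 2 -> cmod (F (z + v) - F z - d * toC v) <= 4 * C * `|v| ^+ 2.
  move=> ve; apply: (le_trans (Fd _ _)).
    by apply: (le_lt_trans (cmod_toC_le v)); rewrite mulrC -ltr_pdivlMr.
  rewrite (mulrC 4) -mulrA ler_wpM2l// (_ : 4 = 2 ^+ 2); last by rewrite expr2 -natrM.
  by rewrite -exprMn lerXn2r ?nnegrE ?cmod_ge0 ?mulr_ge0 ?cmod_toC_le.
have e20 : 0 < e / 2 by rewrite divr_gt0.
have C40 : 0 <= 4 * C by rewrite mulr_ge0.
split; apply: (is_diff_quadratic e20 C40) => v /H; apply: le_trans.
  by apply: le_trans (Re_le_cmod _); rewrite !ReB ReM /= mulNr.
by apply: le_trans (Im_le_cmod _); rewrite !ImB ImM /= (addrC (_ * v.1)).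
Qed.

Lemma cderiv_cst d z : cderiv (fun=> d) z 0.
Proof.
by split; apply: is_diff_eq; apply/funext => v /=; rewrite ?oppr0 !mul0r addr0.
Qed.

Lemma cderivD F G z a b : cderiv F z a -> cderiv G z b ->
  cderiv (fun w => F w + G w) z (a + b).
Proof.
move=> [F1 F2] [G1 G2]; split.
  rewrite (_ : (fun w => _) = (fun w => complex.Re (F w)) + (fun w => complex.Re (G w))).
    by apply: is_diff_eq; apply/funext => v; rewrite !fctE; case: a b {F1 F2 G1 G2} => ? ? [? ?] /=; ring.
  by apply/funext => w; rewrite !fctE; case: (F w) (G w) => ? ? [].
rewrite (_ : (fun w => _) = (fun w => complex.Im (F w)) + (fun w => complex.Im (G w))).
  by apply: is_diff_eq; apply/funext => v; rewrite !fctE; case: a b {F1 F2 G1 G2} => ? ? [? ?] /=; ring.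
by apply/funext => w; rewrite !fctE; case: (F w) (G w) => ? ? [].
Qed.

Lemma cderivM F G z a b : cderiv F z a -> cderiv G z b ->
  cderiv (fun w => F w * G w) z (a * G z + F z * b).
Proof.
move=> [F1 F2] [G1 G2]; split.
  rewrite (_ : (fun w => _) = (fun w => complex.Re (F w)) * (fun w => complex.Re (G w))
     - (fun w => complex.Im (F w)) * (fun w => complex.Im (G w))); last first.
    by apply/funext => w; rewrite !fctE ReM.
  apply: (is_diff_eq (is_diffB (is_diffM F1 G1) (is_diffM F2 G2))).
  apply/funext => v; rewrite !fctE.
  by case: a b (F z) (G z) {F1 F2 G1 G2} => ? ? [? ?] [? ?] [? ?] /=; rewrite /GRing.scale /=; ring.
rewrite (_ : (fun w => _) = (fun w => complex.Re (F w)) * (fun w => complex.Im (G w))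
     + (fun w => complex.Im (F w)) * (fun w => complex.Re (G w))); last first.
  by apply/funext => w; rewrite !fctE ImM.
apply: (is_diff_eq (is_diffD (is_diffM F1 G2) (is_diffM F2 G1))).
apply/funext => v; rewrite !fctE.
by case: a b (F z) (G z) {F1 F2 G1 G2} => ? ? [? ?] [? ?] [? ?] /=; rewrite /GRing.scale /=; ring.
Qed.

Lemma is_diff_inv (u L : R * R -> R) z : u z != 0 -> is_diff z u L ->
  is_diff z (fun w => (u w)^-1) (fun v => - (u z) ^- 2 * L v).
Proof.
move=> uz [du Lu]; split; first exact: differentiableV.
by rewrite diffV// Lu.
Qed.

Lemma cderivV F z a : F z != 0 -> cderiv F z a ->
  cderiv (fun w => (F w)^-1) z (- a / F z ^+ 2).
Proof.
move=> Fz [F1 F2].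
pose P w := complex.Re (F w); pose Q w := complex.Im (F w).
(* 1 / F = conj F / N with N = |F|^2, so only real quotients occur *)
pose N : R * R -> R := P * P + Q * Q.
have Nz : N z != 0.
  by rewrite /N !fctE -!expr2 -cmod_sqr expf_neq0// cmod_eq0.
have dN := is_diffD (is_diffM F1 F1) (is_diffM F2 F2).
have dNV := is_diff_inv Nz dN.
have FE w : (F w)^-1 = (P w * (N w)^-1) +i* (- (Q w * (N w)^-1)).
  by rewrite /N !fctE -!expr2 /P /Q; case: (F w) => x y.
have dE : - a / F z ^+ 2 = - a * ((P z * (N z)^-1) +i* (- (Q z * (N z)^-1))) ^+ 2.
  by rewrite -FE exprVn.
have PQ : N z = P z ^+ 2 + Q z ^+ 2 by rewrite /N !fctE !expr2.
split.
  rewrite (_ : (fun w => _) = P * (fun w => (N w)^-1)); last first.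
    by apply/funext => w; rewrite FE !fctE.
  apply: (is_diff_eq (is_diffM F1 dNV)); apply/funext => v; rewrite dE !fctE.
  rewrite -/(P z) -/(Q z).
  case: a {F1 F2 dN dNV dE} => a1 a2; rewrite /= /GRing.scale /= PQ.
  move: Nz; rewrite PQ; move: (P z) (Q z) => p q pq; by field.
rewrite (_ : (fun w => _) = - (Q * (fun w => (N w)^-1))); last first.
  by apply/funext => w; rewrite FE !fctE.
apply: (is_diff_eq (is_diffN (is_diffM F2 dNV))); apply/funext => v; rewrite dE !fctE.
rewrite -/(P z) -/(Q z).
case: a {F1 F2 dN dNV dE} => a1 a2; rewrite /= /GRing.scale /= PQ.
move: Nz; rewrite PQ; move: (P z) (Q z) => p q pq; by field.
Qed.

Lemma cderiv_div F G z a b : G z != 0 -> cderiv F z a -> cderiv G z b ->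
  cderiv (fun w => F w / G w) z ((a * G z - F z * b) / G z ^+ 2).
Proof.
move=> Gz dF dG; have := cderivM dF (cderivV Gz dG).
by congr cderiv; field.
Qed.

Lemma cderiv_lin F G k z a b : cderiv F z a -> cderiv G z b ->
  cderiv (fun w => F w - k * G w) z (a - k * b).
Proof.
move=> dF dG; have := cderivD dF (cderivM (cderiv_cst (- k) z) dG).
by rewrite mul0r add0r mulNr; congr cderiv; apply/funext => w; rewrite mulNr.
Qed.

Lemma cderiv_continuous F z d : cderiv F z d ->
  {for z, continuous (fun w => complex.Re (F w))} /\
  {for z, continuous (fun w => complex.Im (F w))}.
Proof. by move=> [[d1 _] [d2 _]]; split; exact: differentiable_continuous. Qed.

Lemma cderiv_curve F (g1 g2 : R -> R) (t a b : R) d :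
  cderiv F (g1 t, g2 t) d -> is_derive t 1 g1 a -> is_derive t 1 g2 b ->
  is_derive t 1 (fun s => complex.Re (F (g1 s, g2 s))) (complex.Re (d * (a +i* b))) /\
  is_derive t 1 (fun s => complex.Im (F (g1 s, g2 s))) (complex.Im (d * (a +i* b))).
Proof.
move=> [F1 F2] da db; split.
  by have := is_derive_curve F1 da db; rewrite ReM /= mulNr.
by have := is_derive_curve F2 da db; rewrite ImM /= addrC.
Qed.

End ComplexDerivative.

(** * Continuous functions on boxes *)

Section Boxes.
Context {R : realType}.
Local Notation lam := (@lebesgue_measure R).
Local Notation R1 := (measurableTypeR R).

Lemma compact_cbox (q : R * R * (R * R)) : compact (cbox q).
Proof. by apply: compact_setX; exact: segment_compact. Qed.

Lemma continuous_cbox_bounded (U : set (R * R)) (u : R * R -> R) q :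
  (forall z, U z -> {for z, continuous u}) -> cbox q `<=` U ->
  exists M : R, forall z, cbox q z -> `|u z| <= M.
Proof.
move=> cu qU.
have cw : {within cbox q, continuous u}.
  by apply: continuous_in_subspaceT => z; rewrite inE => /qU /cu.
have [M [_ HM]] := compact_bounded (continuous_compact cw (@compact_cbox q)).
exists (M + 1) => z qz; apply: (HM (M + 1)); first by rewrite ltrDl.
by exists z.
Qed.

Lemma continuous_cbox_measurable (U : set (R * R)) (u : R * R -> R) q :
  open U -> (forall z, U z -> {for z, continuous u}) -> cbox q `<=` U ->
  measurable_fun (cbox q : set (R1 * R1)) u.
Proof.
move=> oU cu qU; apply: (@measurable_funS _ _ (R1 * R1)%type R1 U) => //.
  exact: open_measurable_plane.
exact: open_continuous_measurable_plane.
Qed.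

Lemma mu2_cbox_lty q : (@mu2 R (cbox q) < +oo)%E.
Proof.
have -> : @mu2 R (cbox q) = (lam `[q.1.1, q.1.2] * lam `[q.2.1, q.2.2])%E.
  by apply: (@product_measure1E _ _ R1 R1); exact: measurable_itv.
by rewrite lte_mul_pinfty// ?ge0_fin_numE// lebesgue_measure_itv/=;
  case: ifP => _ //; rewrite -EFinB ltry.
Qed.

Lemma continuous_cbox_integrable (U : set (R * R)) (u : R * R -> R) q :
  open U -> (forall z, U z -> {for z, continuous u}) -> cbox q `<=` U ->
  (@mu2 R).-integrable (cbox q) (EFin \o u).
Proof.
move=> oU cu qU; have [M HM] := continuous_cbox_bounded cu qU.
apply: measurable_bounded_integrable.
- exact: measurable_cbox.
- exact: mu2_cbox_lty.
- exact: continuous_cbox_measurable cu qU.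
- exists M; split; rewrite ?num_real// => x Mx z /HM.
  by move=> /le_trans; apply; exact: ltW.
Qed.

Lemma cbox_fubini (u : R * R -> R) (a b c d : R) :
  (@mu2 R).-integrable (cbox ((a, b), (c, d))) (EFin \o u) ->
  (\int[@mu2 R]_(z in cbox ((a, b), (c, d))) (u z)%:E =
     \int[lam]_(x in `[a, b]) \int[lam]_(y in `[c, d]) (u (x, y))%:E)%E /\
  (\int[@mu2 R]_(z in cbox ((a, b), (c, d))) (u z)%:E =
     \int[lam]_(y in `[c, d]) \int[lam]_(x in `[a, b]) (u (x, y))%:E)%E.
Proof.
move=> intu; set q := ((a, b), (c, d)).
pose f := (EFin \o u) \_ (cbox q).
have intf : (@mu2 R).-integrable setT f.
  have mq : measurable (cbox q : set (R1 * R1)) := measurable_cbox q.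
  have X := (@integrable_mkcond _ (R1 * R1)%type R (@mu2 R) _ (EFin \o u) mq).
  exact: (iffLR X intu).
split; rewrite [LHS]integral_mkcond.
  rewrite -/f -(@integral12_prod_meas1 _ _ R1 R1 R lam lam f intf) [RHS]integral_mkcond.
  apply: eq_integral => x _; rewrite patchE /fubini_F.
  case: ifPn => xab.
    rewrite [RHS]integral_mkcond; apply: eq_integral => y _.
    rewrite /f !patchE (_ : ((x, y) \in cbox q) = (y \in `[c, d]%classic))//.
    apply/idP/idP; rewrite !inE; first by case.
    by move=> h; split => //; move: xab; rewrite inE.
  rewrite (eq_integral (cst 0%E)) ?integral0// => y _; rewrite /f patchE ifN//.
  by apply: contra xab; rewrite !inE => -[].
rewrite -/f -(@integral21_prod_meas1 _ _ R1 R1 R lam lam f intf) [RHS]integral_mkcond.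
apply: eq_integral => y _; rewrite patchE /fubini_G.
case: ifPn => xab.
  rewrite [RHS]integral_mkcond; apply: eq_integral => x _.
  rewrite /f !patchE (_ : ((x, y) \in cbox q) = (x \in `[a, b]%classic))//.
  apply/idP/idP; rewrite !inE; first by case.
    by move=> h; split => //; move: xab; rewrite inE.
rewrite (eq_integral (cst 0%E)) ?integral0// => x _; rewrite /f patchE ifN//.
by apply: contra xab; rewrite !inE => -[].
Qed.

Lemma continuous_cbox_fubini (U : set (R * R)) (u : R * R -> R) (a b c d : R) :
  open U -> (forall z, U z -> {for z, continuous u}) -> cbox ((a, b), (c, d)) `<=` U ->
  (\int[lam]_(x in `[a, b]) \int[lam]_(y in `[c, d]) (u (x, y))%:E =
     \int[lam]_(y in `[c, d]) \int[lam]_(x in `[a, b]) (u (x, y))%:E)%E.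
Proof.
move=> oU cu qU.
by have [<- <-] := cbox_fubini (continuous_cbox_integrable oU cu qU).
Qed.
End Boxes.

(** * Circle means and the Poincare inequality *)

Section Circle.
Context {R : realType}.
Local Notation lam := (@lebesgue_measure R).
Local Notation T0 := (- (pi / 2) : R).
Local Notation T1 := (pi + pi / 2 : R).

(** The turn starts at - pi / 2 because polar coordinates come from slopes,
    whose angles fill ] - pi / 2, pi / 2 [. *)
Definition circle_integral (g : R -> R) : R := \int[lam]_(t in `[T0, T1]) g t.

Lemma le_circle : T0 <= T1.
Proof. by have := pi_gt0 R; lra. Qed.

Lemma continuous_itv_integrable (g : R -> R) (a b : R) : continuous g ->
  lam.-integrable `[a, b] (EFin \o g).
Proof.
move=> cg; apply: continuous_compact_integrable; first exact: segment_compact.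
exact: continuous_subspaceT.
Qed.

Lemma circle_integrable (g : R -> R) : continuous g ->
  lam.-integrable `[T0, T1] (EFin \o g).
Proof. exact: continuous_itv_integrable. Qed.

Lemma circle_integralE (g : R -> R) : continuous g ->
  (\int[lam]_(t in `[T0, T1]) (g t)%:E = (circle_integral g)%:E)%E.
Proof.
move=> /circle_integrable intg; rewrite /circle_integral /Rintegral fineK//.
exact: integrable_fin_num intg.
Qed.

Lemma circle_integral_cst (c : R) : circle_integral (fun=> c) = c * (2 * pi).
Proof.
transitivity (c * fine (lam `[T0, T1])); first exact: Rintegral_cst.
rewrite lebesgue_measure_itv/= lte_fin.
have p0 := pi_gt0 R; case: ltP => //= [_|]; last by lra.
by congr (_ * _); lra.
Qed.

Lemma le_circle_integral (g h : R -> R) : continuous g -> continuous h ->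
  (forall t, t \in `[T0, T1] -> g t <= h t) -> circle_integral g <= circle_integral h.
Proof.
move=> cg ch gh; apply: le_Rintegral; [exact: measurable_itv| | |by move=> t /= /gh].
  exact: circle_integrable.
exact: circle_integrable.
Qed.

(** With J the integral of |g'|, the function g differs from each of its
    values, hence from its mean, by at most J; and J^2 is at most 2 pi times
    the integral of g'^2.  The constant is far from optimal, but any absolute
    constant serves. *)
Lemma circle_poincare (g g' : R -> R) :
  (forall t : R, is_derive t 1 g (g' t)) -> continuous g' ->
  circle_integral (fun t => (g t - circle_integral g / (2 * pi)) ^+ 2)
    <= (2 * pi) ^+ 2 * circle_integral (fun t => g' t ^+ 2).
Proof.
move=> dg cg'.
have p0 : 0 < 2 * pi :> R by rewrite mulr_gt0// pi_gt0.
have cg : continuous g.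
  by move=> t; apply: differentiable_continuous; apply/derivable1_diffP; have := dg t.
have cn : continuous (fun t => `|g' t|).
  by move=> t; apply: continuous_comp; [exact: cg'|exact: norm_continuous].
have csq (h : R -> R) : continuous h -> continuous (fun t => h t ^+ 2).
  by move=> ch t; apply: (@continuous_comp _ _ _ h (fun x => x ^+ 2)); [exact: ch|exact: exprn_continuous].
set J := circle_integral (fun t => `|g' t|); set m := _ / _.
set E := circle_integral (fun t => g' t ^+ 2).
have osc s t : s \in `[T0, T1] -> t \in `[T0, T1] -> s <= t -> `|g t - g s| <= J.
  move=> sI tI st.
  rewrite -(Rintegral_itv_derive st (fun x _ => dg x) (fun x _ => cg' x)).
  have sub : `[s, t]%classic `<=` `[T0, T1]%classic.
    by move=> x; move: sI tI; rewrite /= !in_itv /= => /andP[? ?] /andP[? ?] /andP[? ?]; apply/andP; split; lra.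
  have intg : lam.-integrable `[s, t] (EFin \o g').
    exact: continuous_itv_integrable.
  apply: (@le_trans _ _ (\int[lam]_(x in `[s, t]) `|g' x|)).
    by apply: le_normr_Rintegral; [exact: measurable_itv|exact: intg].
  rewrite /J /circle_integral /Rintegral fine_le//.
  - apply: (@integrable_fin_num _ _ _ lam `[s, t] _ (EFin \o (fun x => `|g' x|))).
      exact: measurable_itv.
    exact: continuous_itv_integrable.
  - exact: (@integrable_fin_num _ _ _ lam _ _ _ (circle_integrable cn)).
  - apply: ge0_subset_integral => //=.
    by apply/measurable_EFinP/measurable_funTS; exact: continuous_measurable_fun.
have osc' s t : s \in `[T0, T1] -> t \in `[T0, T1] -> `|g t - g s| <= J.
  move=> sI tI; have [st|/ltW ts] := leP s t; first exact: osc.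
  by rewrite distrC; exact: osc.
have gm t : t \in `[T0, T1] -> (g t - m) ^+ 2 <= J ^+ 2.
  move=> tI.
  have J0 : 0 <= J by apply: le_trans (osc' _ _ tI tI); exact: normr_ge0.
  rewrite -[leLHS]real_normK ?num_real// lerXn2r ?nnegrE//.
  have l1 : circle_integral (fun=> g t - J) <= circle_integral g.
    apply: le_circle_integral => // [|s sI]; first by move=> s; exact: cst_continuous.
    by have := osc' s t sI tI; rewrite ler_norml => /andP[_]; lra.
  have l2 : circle_integral g <= circle_integral (fun=> g t + J).
    apply: le_circle_integral => // [|s sI]; first by move=> s; exact: cst_continuous.
    by have := osc' s t sI tI; rewrite ler_norml => /andP[]; lra.
  rewrite !circle_integral_cst in l1 l2.
  have m1 : g t - J <= m by rewrite ler_pdivlMr.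
  have m2 : m <= g t + J by rewrite ler_pdivrMr.
  by rewrite ler_norml; apply/andP; split; lra.
(* Cauchy-Schwarz, from the square of |g'| - c with c the mean of |g'| *)
have JE : J ^+ 2 <= 2 * pi * E.
  pose c := J / (2 * pi).
  have : 0 <= circle_integral (fun t => g' t ^+ 2 - (2 * c) * `|g' t| + c ^+ 2).
    apply: Rintegral_ge0 => t _.
    rewrite (_ : _ + _ = (`|g' t| - c) ^+ 2) ?sqr_ge0//.
    by rewrite -[g' t ^+ 2]real_normK ?num_real//; ring.
  rewrite /circle_integral RintegralD//; last 2 first.
  - apply: circle_integrable => t; apply: cvgB; first exact: csq.
    by apply: cvgM; [exact: cvg_cst|exact: cn].
  - by apply: circle_integrable => t; exact: cst_continuous.
  rewrite RintegralB//; last 2 first.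
  - by apply: circle_integrable; exact: csq.
  - apply: circle_integrable => t.
    by apply: cvgM; [exact: cvg_cst|exact: cn].
  rewrite RintegralZl//; last exact: circle_integrable.
  have := circle_integral_cst (c ^+ 2); rewrite /circle_integral => ->.
  rewrite -/(circle_integral (fun t => `|g' t|)) -/J -/(circle_integral (fun t => g' t ^+ 2)) -/E /c.
  move: (2 * pi) p0 => P P0.
  have -> : E - 2 * (J / P) * J + (J / P) ^+ 2 * P = E - J ^+ 2 / P.
    by field; rewrite gt_eqF.
  by rewrite subr_ge0 ler_pdivrMr// mulrC.
have := @le_circle_integral (fun t => (g t - m) ^+ 2) (fun=> J ^+ 2).
rewrite circle_integral_cst => H; apply: (le_trans (H _ _ _)) => //.
- by apply: csq => t; apply: cvgB; [exact: cg|exact: cvg_cst].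
- by move=> t; exact: cst_continuous.
- by rewrite [leLHS]mulrC expr2 -[leRHS]mulrA ler_wpM2l// ltW.
Qed.

Lemma continuous_pairr (x t : R) : {for t, continuous (pair x)}.
Proof.
move=> A [[B C] /= [Bx Ct] BCA]; apply: filterS Ct => y Cy.
by apply: BCA; split => //; exact: nbhs_singleton.
Qed.

Lemma continuous_pairl (x t : R) : {for x, continuous (fun x => (x, t))}.
Proof.
move=> A [[B C] /= [Bx Ct] BCA]; apply: filterS Bx => y Cy.
by apply: BCA; split => //; exact: nbhs_singleton.
Qed.

(** The pair (k, l) stands for a function and its conjugate: the radial
    derivative kl of k is, up to the factor x, the angular derivative of l.
    The integral of kl over a circle therefore vanishes by periodicity of l,
    and Fubini over [a, b] times the circle gives the claim.  The hypotheses
    are kept abstract because the lemma is used for holomorphic functions and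
    for a product of two of them with coupled radii. *)
Lemma circle_mean_constant (k l kl : R -> R -> R) (r S a b : R) :
  0 <= r -> r < a -> a <= b -> b < S ->
  (forall x t : R, r < x < S -> is_derive x 1 (k^~ t) (kl x t)) ->
  (forall x t : R, r < x < S -> is_derive t 1 (l x) (x * kl x t)) ->
  (forall x, r < x < S -> l x T1 = l x T0) ->
  (forall z : R * R, r < z.1 < S -> {for z, continuous (fun w => kl w.1 w.2)}) ->
  (forall x, r < x < S -> continuous (k x)) ->
  circle_integral (k b) = circle_integral (k a).
Proof.
move=> r0 ra ab bS dk dl lper ckl ck.
pose U := [set z : R * R | r < z.1 < S].
have oU : open U.
  rewrite (_ : U = (fst @^-1` `]r, S[%classic)); last by apply/seteqP; split => z /=; rewrite in_itv.
  by apply: open_comp; [move=> z _; exact: cvg_fst|exact: interval_open].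
have inU x : x \in `[a, b] -> r < x < S.
  by rewrite in_itv /= => /andP[ax xb]; rewrite (lt_le_trans ra ax) (le_lt_trans xb bS).
have qU : cbox ((a, b), (T0, T1)) `<=` U by move=> z [/= /inU].
have F := continuous_cbox_fubini oU ckl qU.
have ckl1 x : r < x < S -> continuous (kl x).
  move=> xrS t; have := ckl (x, t) xrS => /(@continuous_comp _ _ _ (pair x) _ t); apply.
  exact: continuous_pairr.
have ckl2 x t : r < x < S -> {for x, continuous (kl^~ t)}.
  move=> xrS; have := ckl (x, t) xrS => /(@continuous_comp _ _ _ (fun x => (x, t)) _ x); apply.
  exact: continuous_pairl.
have inta : circle_integral (fun t => k b t - k a t) = 0.
  rewrite /circle_integral /Rintegral.
  transitivity (fine (\int[lam]_(t in `[T0, T1]) \int[lam]_(x in `[a, b]) (kl x t)%:E)%E).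
    congr fine; apply: eq_integral => t _.
    by rewrite (@integral_itv_derive _ (k^~ t) (kl^~ t) a b ab
      (fun x xI => dk x t (inU x xI)) (fun x xI => ckl2 x t (inU x xI))).
  rewrite -F (eq_integral (cst 0%E)) ?integral0// => x; rewrite inE => /inU xI.
  have x0 : x != 0 by rewrite gt_eqF// (le_lt_trans r0)//; case/andP: xI.
  have dlx (t : R) : t \in `[T0, T1] -> is_derive t 1 (fun t => x^-1 * l x t) (kl x t).
    move=> _; have := dl x t xI => dlt.
    by apply: is_derive_eq; rewrite /GRing.scale /= mulrA mulVf// mul1r.
  rewrite (integral_itv_derive le_circle dlx (fun t _ => ckl1 _ xI t)).
  by rewrite lper// subrr.
have aI : r < a < S by rewrite ra (le_lt_trans ab).
have bI : r < b < S by rewrite bS (lt_le_trans ra).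
move: inta; rewrite /circle_integral RintegralB//; last 2 first.
- by apply: circle_integrable; exact: ck.
- by apply: circle_integrable; exact: ck.
by move/eqP; rewrite subr_eq0 => /eqP.
Qed.
End Circle.

Section HolomorphicAnnulus.
Context {R : realType}.
Implicit Types (z w : R * R) (F G : R * R -> R[i]).

Definition annulus (z0 : R * R) (r S : R) : set (R * R) :=
  [set w | r < enorm (w - z0) < S].

Definition ccontinuous_at F z : Prop :=
  {for z, continuous (fun w => complex.Re (F w))} /\
  {for z, continuous (fun w => complex.Im (F w))}.

(** Continuity of the derivative belongs to the notion, so that Fubini applies
    to it without an argument of Goursat type. *)
Definition holomorphic (D : set (R * R)) F F' : Prop :=
  forall z, D z -> cderiv F z (F' z) /\ ccontinuous_at F' z.

Lemma enorm_polar z0 (x t : R) : enorm (polar z0 x t - z0) = `|x|.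
Proof.
have -> : polar z0 x t - z0 = (x * cos t, x * sin t).
  by case: z0 => a b; rewrite /polar /=; congr pair; rewrite addrC addKr.
by rewrite /enorm /= !exprMn -mulrDr cos2Dsin2 mulr1 sqrtr_sqr.
Qed.

Lemma polar_annulus z0 (r S x t : R) : 0 <= r -> r < x < S -> annulus z0 r S (polar z0 x t).
Proof.
by move=> r0 /andP[rx xS]; rewrite /annulus /= enorm_polar ger0_norm ?rx// (le_trans r0)// ltW.
Qed.

Lemma continuous_pairM (T : topologicalType) (f g : T -> R) (x : T) :
  {for x, continuous f} -> {for x, continuous g} ->
  {for x, continuous (fun y => (f y, g y))}.
Proof.
move=> cf cg A [[B C] /= [fB gC] BCA].
have h1 : nbhs x (f @^-1` B) := cf _ fB.
have h2 : nbhs x (g @^-1` C) := cg _ gC.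
suff : nbhs x [set y | A (f y, g y)] by [].
by apply: filterS (filterI h1 h2) => y [fy gy]; exact: BCA.
Qed.

Lemma continuous_polar z0 (g : R -> R) (w : R * R) : {for w.1, continuous g} ->
  {for w, continuous (fun v : R * R => polar z0 (g v.1) v.2)}.
Proof.
move=> cg.
have cg1 : {for w, continuous (fun v : R * R => g v.1)}.
  by apply: (@continuous_comp _ _ _ fst g); [exact: cvg_fst|exact: cg].
have cc : {for w, continuous (fun v : R * R => cos v.2)}.
  by apply: (@continuous_comp _ _ _ snd cos); [exact: cvg_snd|exact: continuous_cos].
have cs : {for w, continuous (fun v : R * R => sin v.2)}.
  by apply: (@continuous_comp _ _ _ snd sin); [exact: cvg_snd|exact: continuous_sin].
apply: (@continuous_pairM (R * R)%type (fun v : R * R => z0.1 + g v.1 * cos v.2) (fun v : R * R => z0.2 + g v.1 * sin v.2)).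
  by apply: cvgD; [exact: cvg_cst|apply: cvgM; [exact: cg1|exact: cc]].
by apply: cvgD; [exact: cvg_cst|apply: cvgM; [exact: cg1|exact: cs]].
Qed.

Lemma ccontinuous_polar F z0 (g : R -> R) (w : R * R) : {for w.1, continuous g} ->
  ccontinuous_at F (polar z0 (g w.1) w.2) ->
  ccontinuous_at (fun v : R * R => F (polar z0 (g v.1) v.2)) w.
Proof.
move=> cg [c1 c2]; have cp := @continuous_polar z0 g w cg; split.
  by apply: (@continuous_comp _ _ _ (fun v : R * R => polar z0 (g v.1) v.2) (fun w => complex.Re (F w))).
by apply: (@continuous_comp _ _ _ (fun v : R * R => polar z0 (g v.1) v.2) (fun w => complex.Im (F w))).
Qed.

Lemma ccontinuousM F G z : ccontinuous_at F z -> ccontinuous_at G z ->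
  ccontinuous_at (fun w => F w * G w) z.
Proof.
move=> [F1 F2] [G1 G2]; split.
  have -> : (fun w => complex.Re (F w * G w)) = (fun w =>
     complex.Re (F w) * complex.Re (G w) - complex.Im (F w) * complex.Im (G w)).
    by apply/funext => w; rewrite ReM.
  by apply: cvgB; apply: cvgM.
have -> : (fun w => complex.Im (F w * G w)) = (fun w =>
   complex.Re (F w) * complex.Im (G w) + complex.Im (F w) * complex.Re (G w)).
  by apply/funext => w; rewrite ImM.
by apply: cvgD; apply: cvgM.
Qed.

Lemma ccontinuous_expi (w : R * R) : ccontinuous_at (fun v : R * R => expi v.2) w.
Proof.
split.
  by apply: (@continuous_comp _ _ _ snd cos); [exact: cvg_snd|exact: continuous_cos].
by apply: (@continuous_comp _ _ _ snd sin); [exact: cvg_snd|exact: continuous_sin].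
Qed.

Lemma cderiv_ccontinuous F z d : cderiv F z d -> ccontinuous_at F z.
Proof. by move=> /cderiv_continuous. Qed.

(** d/dt of z0 + x e^(it) is i x e^(it). *)
Lemma cderiv_angle F z0 (x t : R) d : cderiv F (polar z0 x t) d ->
  is_derive t 1 (fun t => complex.Re (F (polar z0 x t))) (- (x * complex.Im (d * expi t))) /\
  is_derive t 1 (fun t => complex.Im (F (polar z0 x t))) (x * complex.Re (d * expi t)).
Proof.
move=> dF.
have d1 : is_derive t 1 (fun t => z0.1 + x * cos t) (x * - sin t).
  by apply: is_derive_eq; rewrite /GRing.scale /=; ring.
have d2 : is_derive t 1 (fun t => z0.2 + x * sin t) (x * cos t).
  by apply: is_derive_eq; rewrite /GRing.scale /=; ring.
have [D1 D2] := @cderiv_curve _ F (fun t => z0.1 + x * cos t)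
  (fun t => z0.2 + x * sin t) t _ _ d dF d1 d2; split.
  by apply: (is_derive_eq D1); rewrite ReM ImM /=; ring.
by apply: (is_derive_eq D2); rewrite ReM ImM /=; ring.
Qed.

Lemma cderiv_radius F z0 (g : R -> R) (x t g' : R) d :
  is_derive x 1 g g' -> cderiv F (polar z0 (g x) t) d ->
  is_derive x 1 (fun x => complex.Re (F (polar z0 (g x) t))) (g' * complex.Re (d * expi t)) /\
  is_derive x 1 (fun x => complex.Im (F (polar z0 (g x) t))) (g' * complex.Im (d * expi t)).
Proof.
move=> dg dF.
have d1 : is_derive x 1 (fun x => z0.1 + g x * cos t) (g' * cos t).
  by apply: is_derive_eq; rewrite /GRing.scale /=; ring.
have d2 : is_derive x 1 (fun x => z0.2 + g x * sin t) (g' * sin t).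
  by apply: is_derive_eq; rewrite /GRing.scale /=; ring.
have [D1 D2] := @cderiv_curve _ F (fun x => z0.1 + g x * cos t)
  (fun x => z0.2 + g x * sin t) x _ _ d dF d1 d2; split.
  by apply: (is_derive_eq D1); rewrite !ReM /=; ring.
by apply: (is_derive_eq D2); rewrite !ImM /=; ring.
Qed.
End HolomorphicAnnulus.

Section CircleEstimates.
Context {R : realType}.
Implicit Types (z w : R * R) (F G : R * R -> R[i]).

Lemma polar_circle_end z0 (x : R) : polar z0 x (pi + pi / 2) = polar z0 x (- (pi / 2)).
Proof. by rewrite /polar (addrC pi) cosDpi sinDpi cosN sinN cos_pihalf oppr0. Qed.

Lemma cmod_expi (t : R) : cmod (expi t) = 1.
Proof. by rewrite cmodE /= cos2Dsin2 sqrtr1. Qed.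

Lemma is_derive_continuous (g : R -> R) (x d : R) : is_derive x 1 g d -> {for x, continuous g}.
Proof. by case=> dg _; apply: differentiable_continuous; exact/derivable1_diffP. Qed.

Lemma continuous_section (u : R * R -> R) (x : R) :
  (forall t, {for (x, t), continuous u}) -> continuous (fun t => u (x, t)).
Proof.
move=> cu t; apply: (@continuous_comp _ _ _ (pair x) u); first exact: continuous_pairr.
exact: cu.
Qed.

Section OnAnnulus.
Variables (F F' : R * R -> R[i]) (z0 : R * R) (r S : R).
Hypotheses (r0 : 0 <= r) (hF : holomorphic (annulus z0 r S) F F').

Let cF (x t : R) : r < x < S ->
  ccontinuous_at (fun v : R * R => F' (polar z0 v.1 v.2) * expi v.2) (x, t).
Proof.
move=> xI; apply: ccontinuousM; last exact: ccontinuous_expi.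
apply: (@ccontinuous_polar _ F' z0 id (x, t)); first exact: cvg_id.
exact: (hF (polar_annulus z0 t r0 xI)).2.
Qed.

(** By the Cauchy-Riemann equations Re F has the conjugate Im F, and Im F
    has the conjugate - Re F. *)
Lemma circle_mean_holomorphic (a b : R) : r < a -> a <= b -> b < S ->
  circle_integral (fun t => complex.Re (F (polar z0 b t))) =
    circle_integral (fun t => complex.Re (F (polar z0 a t))) /\
  circle_integral (fun t => complex.Im (F (polar z0 b t))) =
    circle_integral (fun t => complex.Im (F (polar z0 a t))).
Proof.
move=> ra ab bS.
have dA x t (xI : r < x < S) := cderiv_angle (hF (polar_annulus z0 t r0 xI)).1.
have dR x t (xI : r < x < S) := @cderiv_radius _ F z0 id x t 1 _ (is_derive_id _ _)
  (hF (polar_annulus z0 t r0 xI)).1.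
split.
  apply: (@circle_mean_constant _ (fun x t => complex.Re (F (polar z0 x t)))
    (fun x t => complex.Im (F (polar z0 x t)))
    (fun x t => complex.Re (F' (polar z0 x t) * expi t)) r S) => //.
  - by move=> x t xI; have [d _] := dR x t xI; rewrite mul1r in d.
  - by move=> x t xI; have [_] := dA x t xI.
  - by move=> x xI; rewrite polar_circle_end.
  - by move=> [x t] xI; have [] := cF t xI.
  - by move=> x xI t; have [d _] := dA x t xI; exact: is_derive_continuous d.
apply: (@circle_mean_constant _ (fun x t => complex.Im (F (polar z0 x t)))
    (fun x t => - complex.Re (F (polar z0 x t)))
    (fun x t => complex.Im (F' (polar z0 x t) * expi t)) r S) => //.
- by move=> x t xI; have [_ d] := dR x t xI; rewrite mul1r in d.
- move=> x t xI; have [d _] := dA x t xI.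
  by apply: (is_derive_eq (is_deriveN d)); rewrite opprK.
- by move=> x xI; rewrite polar_circle_end.
- by move=> [x t] xI; have [] := cF t xI.
- by move=> x xI t; have [_ d] := dA x t xI; exact: is_derive_continuous d.
Qed.

(** The constant c is the mean over the middle circle; it serves all circles
    at once because circle means agree. *)
Lemma circle_poincare_holomorphic : r < S -> exists c : R[i], forall x, r < x < S ->
  circle_integral (fun t => cmod (F (polar z0 x t) - c) ^+ 2) <=
    (2 * pi * x) ^+ 2 * circle_integral (fun t => cmod (F' (polar z0 x t)) ^+ 2).
Proof.
move=> rS; pose m := (r + S) / 2.
have mI : r < m < S by rewrite /m; apply/andP; split; lra.
exists ((circle_integral (fun t => complex.Re (F (polar z0 m t))) / (2 * pi)) +i*
  (circle_integral (fun t => complex.Im (F (polar z0 m t))) / (2 * pi))).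
move=> x xI.
(* the means on the circles of radii x and m agree, whichever is larger *)
have [mR mI'] : circle_integral (fun t => complex.Re (F (polar z0 x t))) =
    circle_integral (fun t => complex.Re (F (polar z0 m t))) /\
  circle_integral (fun t => complex.Im (F (polar z0 x t))) =
    circle_integral (fun t => complex.Im (F (polar z0 m t))).
  move: (xI) (mI) => /andP[rx xS] /andP[rm mS].
  have [xm|/ltW mx] := leP x m; last exact: circle_mean_holomorphic.
  by have [-> ->] := circle_mean_holomorphic rx xm mS.
rewrite -mR -mI'.
have dA t := cderiv_angle (hF (polar_annulus z0 t r0 xI)).1.
pose P t := complex.Re (F (polar z0 x t)); pose Q t := complex.Im (F (polar z0 x t)).
pose A t := complex.Re (F' (polar z0 x t) * expi t).
pose B t := complex.Im (F' (polar z0 x t) * expi t).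
have cA : continuous A.
  by apply: (@continuous_section (fun v => complex.Re (F' (polar z0 v.1 v.2) * expi v.2))) => t; have [] := cF t xI.
have cB : continuous B.
  by apply: (@continuous_section (fun v => complex.Im (F' (polar z0 v.1 v.2) * expi v.2))) => t; have [] := cF t xI.
have cx (g : R -> R) : continuous g -> continuous (fun t => x * g t).
  by move=> cg t; apply: cvgM; [exact: cvg_cst|exact: cg].
have csq (g : R -> R) : continuous g -> continuous (fun t => g t ^+ 2).
  by move=> cg t; apply: (@continuous_comp _ _ _ g (fun x => x ^+ 2)); [exact: cg|exact: exprn_continuous].
have cN (g : R -> R) : continuous g -> continuous (fun t => - g t).
  by move=> cg t; apply: cvgN; exact: cg.
have p1 := circle_poincare (fun t => (dA t).1) (cN _ (cx _ cB)).
have p2 := circle_poincare (fun t => (dA t).2) (cx _ cA).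
have cP : continuous P by move=> t; exact: is_derive_continuous (dA t).1.
have cQ : continuous Q by move=> t; exact: is_derive_continuous (dA t).2.
have cm (g : R -> R) (c : R) : continuous g -> continuous (fun t => (g t - c) ^+ 2).
  by move=> cg; apply: csq => t; apply: cvgB; [exact: cg|exact: cvg_cst].
rewrite -/P -/Q; move: (circle_integral P / _) (circle_integral Q / _) p1 p2 => c1 c2 p1 p2.
have -> : circle_integral (fun t => cmod (F (polar z0 x t) - (c1 +i* c2)) ^+ 2) =
    circle_integral (fun t => (P t - c1) ^+ 2) + circle_integral (fun t => (Q t - c2) ^+ 2).
  rewrite /circle_integral -RintegralD//; last 2 first.
  - by apply: circle_integrable; exact: cm.
  - by apply: circle_integrable; exact: cm.
  by apply: eq_Rintegral => t _; rewrite cmod_sqr ReB ImB.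
apply: (le_trans (lerD p1 p2)).
have -> : circle_integral (fun t => cmod (F' (polar z0 x t)) ^+ 2) =
    circle_integral (fun t => A t ^+ 2) + circle_integral (fun t => B t ^+ 2).
  rewrite /circle_integral -RintegralD//; last 2 first.
  - by apply: circle_integrable; exact: csq.
  - by apply: circle_integrable; exact: csq.
  by apply: eq_Rintegral => t _; rewrite -cmod_sqr cmodM cmod_expi mulr1.
have E (g : R -> R) : continuous g -> circle_integral (fun t => (x * g t) ^+ 2) =
    x ^+ 2 * circle_integral (fun t => g t ^+ 2).
  move=> cg; rewrite /circle_integral -RintegralZl//.
    by apply: eq_Rintegral => t _; rewrite exprMn.
  by apply: circle_integrable; exact: csq.
have -> : circle_integral (fun t => (- (x * B t)) ^+ 2) = circle_integral (fun t => (x * B t) ^+ 2).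
  by apply: eq_Rintegral => t _; rewrite sqrrN.
by rewrite !E// addrC -!mulrDr mulrA -exprMn.
Qed.
End OnAnnulus.

End CircleEstimates.

(** * Monotonicity of quadratic means *)

Section CircleMonotone.
Context {R : realType}.
Variables (F F' : R * R -> R[i]) (z0 : R * R) (S : R).
Hypothesis hF : holomorphic (disc S z0) F F'.

Lemma polar_disc (x t : R) : `|x| < S -> disc S z0 (polar z0 x t).
Proof. by rewrite /disc /= enorm_polar. Qed.

Let M (x : R) := circle_integral (fun t => cmod (F (polar z0 x t)) ^+ 2).

Let cFp (w : R * R) : `|w.1| < S -> ccontinuous_at (fun v : R * R => F (polar z0 v.1 v.2)) w.
Proof.
move=> xS; apply: (@ccontinuous_polar _ F z0 id w); first exact: cvg_id.
exact: cderiv_ccontinuous (hF (polar_disc _ xS)).1.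
Qed.

Let cmF (w : R * R) : `|w.1| < S ->
  {for w, continuous (fun v : R * R => cmod (F (polar z0 v.1 v.2)) ^+ 2)}.
Proof.
move=> xS; have [c1 c2] := cFp xS.
have -> : (fun v : R * R => cmod (F (polar z0 v.1 v.2)) ^+ 2) = (fun v : R * R =>
   complex.Re (F (polar z0 v.1 v.2)) * complex.Re (F (polar z0 v.1 v.2)) +
   complex.Im (F (polar z0 v.1 v.2)) * complex.Im (F (polar z0 v.1 v.2))).
  by apply/funext => v; rewrite cmod_sqr !expr2.
by apply: cvgD; apply: cvgM.
Qed.

(** Logarithmic convexity of the means in a weak form.  The integral over t of
    Re (F (u e^(it)) conj (F (x^2 / u e^(it)))) does not depend on u, since the
    product of the two radii is constant; on monomials this is
    u^n (x^2 / u)^n = x^(2n).  At u = x it is M x, and at u = y it is at most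
    the average of M (x^2 / y) and M y. *)
Let circle_split (x y : R) : 0 < x -> x < y -> y < S ->
  M x <= (M (x ^+ 2 / y) + M y) / 2.
Proof.
move=> x0 xy yS; have y0 : 0 < y := lt_trans x0 xy.
have S0 : 0 < S := lt_trans y0 yS.
pose g (u : R) := x ^+ 2 / u.
pose rr := x ^+ 2 / S.
have rr0 : 0 <= rr by rewrite divr_ge0 ?sqr_ge0 ?ltW.
have inI u : rr < u < S -> [/\ 0 < u, `|u| < S & `|g u| < S].
  move=> /andP[ru uS]; have u0 : 0 < u := le_lt_trans rr0 ru.
  split => //; first by rewrite gtr0_norm.
  rewrite /g ger0_norm; last by rewrite divr_ge0 ?sqr_ge0 ?ltW.
  by rewrite ltr_pdivrMr// mulrC -ltr_pdivrMr.
have dg (u : R) : 0 < u -> is_derive u 1 g (- (x ^+ 2 / u ^+ 2)).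
  move=> u0; have un0 : u != 0 by rewrite gt_eqF.
  have d : is_derive u 1 (fun v : R => v^-1) (- u ^- 2).
    split; first by apply: derivableV => //; exact: derivable_id.
    by rewrite deriveV// derive_id /GRing.scale /= mulr1.
  apply: (is_derive_eq (is_deriveM (is_derive_cst (x ^+ 2) u 1) d)).
  by rewrite /GRing.scale /=; ring.
pose P (u t : R) := complex.Re (F (polar z0 u t)); pose Q (u t : R) := complex.Im (F (polar z0 u t)).
pose A (u t : R) := complex.Re (F' (polar z0 u t) * expi t).
pose B (u t : R) := complex.Im (F' (polar z0 u t) * expi t).
pose k u t := P u t * P (g u) t + Q u t * Q (g u) t.
pose l u t := Q u t * P (g u) t - P u t * Q (g u) t.
pose kl u t := (A u t * P (g u) t + B u t * Q (g u) t)
  - x ^+ 2 / u ^+ 2 * (P u t * A (g u) t + Q u t * B (g u) t).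
have rx : rr < x.
  by rewrite /rr ltr_pdivrMr// expr2 ltr_pM2l//; exact: lt_trans yS.
have dA u t (uS : `|u| < S) := cderiv_angle (hF (polar_disc t uS)).1.
have cP (w : R * R) (h : R -> R) : {for w.1, continuous h} -> `|h w.1| < S ->
    ccontinuous_at (fun v : R * R => F (polar z0 (h v.1) v.2)) w.
  move=> ch hS; apply: (@ccontinuous_polar _ F z0 h w ch).
  exact: cderiv_ccontinuous (hF (polar_disc _ hS)).1.
have cP' (w : R * R) (h : R -> R) : {for w.1, continuous h} -> `|h w.1| < S ->
    ccontinuous_at (fun v : R * R => F' (polar z0 (h v.1) v.2) * expi v.2) w.
  move=> ch hS; apply: ccontinuousM; last exact: ccontinuous_expi.
  apply: (@ccontinuous_polar _ F' z0 h w ch).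
  exact: (hF (polar_disc _ hS)).2.
have cPt u : `|u| < S -> continuous (P u).
  by move=> uS t; exact: is_derive_continuous (dA u t uS).1.
have cQt u : `|u| < S -> continuous (Q u).
  by move=> uS t; exact: is_derive_continuous (dA u t uS).2.
have ck u : rr < u < S -> continuous (k u).
  by move=> /inI[u0 uS gS] t; apply: cvgD; apply: cvgM; [exact: cPt|exact: cPt|exact: cQt|exact: cQt].
(* l is the conjugate of k: both products are differentiated by the Leibniz rule, and d/du (x^2 / u) = - x^2 / u^2 *)
have kE : circle_integral (k y) = circle_integral (k x).
  apply: (@circle_mean_constant _ k l kl rr S) => //.
  - exact: ltW.
  - move=> u t /inI[u0 uS gS].
    have [a1 a2] := @cderiv_radius _ F z0 id u t 1 _ (is_derive_id _ _) (hF (polar_disc t uS)).1.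
    have [b1 b2] := @cderiv_radius _ F z0 g u t _ _ (dg u u0) (hF (polar_disc t gS)).1.
    apply: (is_derive_eq (is_deriveD (is_deriveM a1 b1) (is_deriveM a2 b2))).
    by rewrite /kl /P /Q /A /B /GRing.scale /=; ring.
  - move=> u t /inI[u0 uS gS].
    have [a1 a2] := dA u t uS; have [b1 b2] := dA (g u) t gS.
    apply: (is_derive_eq (is_deriveB (is_deriveM a2 b1) (is_deriveM a1 b2))).
    rewrite /kl /P /Q /A /B /GRing.scale /= /g.
    by field; rewrite gt_eqF.
  - by move=> u _; rewrite /l /P /Q !polar_circle_end.
  - move=> w /inI[u0 uS gS].
    have cg : {for w.1, continuous g} by exact: is_derive_continuous (dg _ u0).
    have [P1 Q1] := @cP w id (@cvg_id _ _) uS.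
    have [P2 Q2] := @cP w g cg gS.
    have [A1 B1] := @cP' w id (@cvg_id _ _) uS.
    have [A2 B2] := @cP' w g cg gS.
    have cq1 : {for w.1, continuous (fun u : R => x ^+ 2 / u ^+ 2)}.
      apply: cvgM; first exact: cvg_cst.
      apply: cvgV; first by rewrite expf_neq0// gt_eqF.
      exact: exprn_continuous.
    have cq : {for w, continuous (fun v : R * R => x ^+ 2 / v.1 ^+ 2)}.
      by apply: (@continuous_comp _ _ _ fst (fun u : R => x ^+ 2 / u ^+ 2)); [exact: cvg_fst|].
    apply: cvgB; first by apply: cvgD; apply: cvgM.
    by apply: cvgM => //; apply: cvgD; apply: cvgM.
have yI : rr < y < S by rewrite yS (lt_trans rx).
have [_ yS' gyS] := inI y yI.
have gxE : g x = x by rewrite /g expr2 mulfK// gt_eqF.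
have -> : M x = circle_integral (k x).
  by apply: eq_Rintegral => t _; rewrite cmod_sqr /k gxE !expr2.
rewrite -kE.
have csq u : `|u| < S -> continuous (fun t => cmod (F (polar z0 u t)) ^+ 2).
  by move=> uS; apply: (@continuous_section _ (fun v => cmod (F (polar z0 v.1 v.2)) ^+ 2)) => t; exact: cmF.
rewrite /M -/(g y) {1}/circle_integral -/circle_integral.
have -> : (circle_integral (fun t => cmod (F (polar z0 (g y) t)) ^+ 2) +
    circle_integral (fun t => cmod (F (polar z0 y t)) ^+ 2)) / 2 =
    circle_integral (fun t => (cmod (F (polar z0 (g y) t)) ^+ 2 + cmod (F (polar z0 y t)) ^+ 2) * 2^-1).
  rewrite /circle_integral RintegralZr//; last first.
    by apply: circle_integrable => t; apply: cvgD; exact: csq.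
  by rewrite RintegralD//; apply: circle_integrable; exact: csq.
apply: le_circle_integral.
- exact: ck.
- by move=> t; apply: cvgM; [apply: cvgD; exact: csq|exact: cvg_cst].
- move=> t _; rewrite ler_pdivlMr// !cmod_sqr /k /P /Q.
  set a := complex.Re _; set b := complex.Re _; set c := complex.Im _; set d := complex.Im _.
  by have := sqr_ge0 (a - b); have := sqr_ge0 (c - d); rewrite !sqrrB; lra.
Qed.

(** Let s be the supremum of M on ]0, y[, finite because F is bounded on
    compact discs.  By circle_split M x <= (s + M y) / 2 for every x < y, so
    s <= (s + M y) / 2, that is s <= M y. *)
Lemma circle_integral_monotone (x y : R) : 0 < x -> x <= y -> y < S -> M x <= M y.
Proof.
move=> x0; rewrite le_eqVlt => /predU1P[->//|xy] yS.
have y0 : 0 < y := lt_trans x0 xy.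
pose U := [set w : R * R | `|w.1| < S].
have [B HB] : exists B : R, forall z, cbox ((0, y), (- (pi / 2), pi + pi / 2)) z ->
    `|cmod (F (polar z0 z.1 z.2)) ^+ 2| <= B.
  apply: (@continuous_cbox_bounded _ U (fun v => cmod (F (polar z0 v.1 v.2)) ^+ 2)); first exact: cmF.
  move=> z [] /=; rewrite in_itv /= => /andP[z1 z2] _.
  by rewrite /U /= ger0_norm// (le_lt_trans z2).
have csq u : `|u| < S -> continuous (fun t => cmod (F (polar z0 u t)) ^+ 2).
  by move=> uS; apply: (@continuous_section _ (fun v => cmod (F (polar z0 v.1 v.2)) ^+ 2)) => t; exact: cmF.
pose E := [set M u | u in `]0, y[%classic].
have Eub : has_ubound E.
  exists (B * (2 * pi)) => _ [u /= + <-]; rewrite in_itv /= => /andP[u0 uy].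
  rewrite -circle_integral_cst; apply: le_circle_integral.
  - by apply: csq; rewrite gtr0_norm// (lt_trans uy).
  - by move=> t; exact: cst_continuous.
  - move=> t tI; apply: le_trans (HB (u, t) _); first exact: ler_norm.
    by split => //=; rewrite in_itv /= !ltW.
have Ex : E (M x) by exists x => //=; rewrite in_itv /= x0.
have le_half u : 0 < u -> u < y -> M u <= (sup E + M y) / 2.
  move=> u0 uy; apply: (le_trans (circle_split u0 uy yS)).
  rewrite ler_pM2r ?invr_gt0// lerD2r; apply: ub_le_sup => //.
  exists (u ^+ 2 / y) => //=; rewrite in_itv /= divr_gt0 ?exprn_gt0//=.
  by rewrite ltr_pdivrMr// expr2; apply: ltr_pM => //; exact: ltW.
have supE : sup E <= (sup E + M y) / 2.
  apply: ge_sup; first by exists (M x).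
  by move=> _ [u /= + <-]; rewrite in_itv /= => /andP[u0 uy]; exact: le_half.
by have := le_half x x0 xy; lra.
Qed.
End CircleMonotone.

(** * Holomorphic functions on discs and annuli *)

Section PolarDomains.
Context {R : realType}.
Local Notation lam := (@lebesgue_measure R).
Local Notation R1 := (measurableTypeR R).
Local Notation T0 := (- (pi / 2) : R).
Local Notation T1 := (pi + pi / 2 : R).
Implicit Types (D : set (R * R)) (g : R * R -> R).

(** Discs and annuli share one formula in polar coordinates: membership of
    a point depends on its radius only.  The center is left out because it
    carries no mass. *)
Definition radial_domain (D : set (R * R)) (z0 : R * R) (r S : R) : Prop :=
  open D /\ forall x t, 0 < x -> D (polar z0 x t) <-> r < x < S.

Lemma continuous_enormB z0 : continuous (fun w : R * R => enorm (w - z0)).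
Proof.
move=> w; apply: (@continuous_comp _ _ _ (fun w : R * R => (w - z0).1 ^+ 2 + (w - z0).2 ^+ 2) Num.sqrt); last exact: sqrt_continuous.
apply: cvgD.
  apply: (@continuous_comp _ _ _ (fun w : R * R => w.1 - z0.1) (fun x => x ^+ 2)); last exact: exprn_continuous.
  by apply: cvgB; [exact: cvg_fst|exact: cvg_cst].
apply: (@continuous_comp _ _ _ (fun w : R * R => w.2 - z0.2) (fun x => x ^+ 2)); last exact: exprn_continuous.
by apply: cvgB; [exact: cvg_snd|exact: cvg_cst].
Qed.

Lemma open_annulus z0 (r S : R) : open (annulus z0 r S).
Proof.
rewrite (_ : annulus z0 r S = (fun w => enorm (w - z0)) @^-1` `]r, S[%classic); last first.
  by apply/seteqP; split => z /=; rewrite in_itv.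
by apply: open_comp; [move=> z _; exact: continuous_enormB|exact: interval_open].
Qed.

Lemma open_disc z0 (S : R) : open (disc S z0).
Proof.
rewrite (_ : disc S z0 = (fun w => enorm (w - z0)) @^-1` `]-oo, S[%classic); last first.
  by apply/seteqP; split => z /=; rewrite in_itv.
by apply: open_comp; [move=> z _; exact: continuous_enormB|exact: interval_open].
Qed.

Lemma radial_annulus z0 (r S : R) : radial_domain (annulus z0 r S) z0 r S.
Proof.
by split=> [|x t x0]; [exact: open_annulus|rewrite /annulus /= enorm_polar gtr0_norm].
Qed.

Lemma radial_disc z0 (S : R) : radial_domain (disc S z0) z0 0 S.
Proof.
by split=> [|x t x0]; [exact: open_disc|rewrite /disc /= enorm_polar gtr0_norm// x0].
Qed.

Lemma measurable_polar z0 : measurable_fun setT (fun v : R1 * R1 => polar z0 v.1 v.2 : R1 * R1).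
Proof.
have mc : measurable_fun setT (fun v : R1 * R1 => cos v.2).
  by apply: (measurableT_comp (@continuous_measurable_fun R cos _)); [exact: continuous_cos|exact: measurable_snd].
have ms : measurable_fun setT (fun v : R1 * R1 => sin v.2).
  by apply: (measurableT_comp (@continuous_measurable_fun R sin _)); [exact: continuous_sin|exact: measurable_snd].
by apply: measurable_fun_pair; apply: measurable_funD => //; apply: measurable_funM.
Qed.

Lemma integral_radial_domain D z0 (r S : R) g : 0 <= r ->
  radial_domain D z0 r S ->
  (forall z, D z -> {for z, continuous g}) -> (forall z, D z -> 0 <= g z) ->
  (\int[@mu2 R]_(z in D) (g z)%:E =
    \int[lam]_(x in `]r, S[) (x * circle_integral (fun t => g (polar z0 x t)))%:E)%E /\
  measurable_fun `]r, S[ (fun x => (x * circle_integral (fun t => g (polar z0 x t)))%:E).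
Proof.
move=> r0 [oD Dr] cg g0.
have mD : measurable (D : set (R1 * R1)) by exact: open_measurable_plane.
pose f := g \_ D.
have fE z : f z = if z \in D then g z else 0 by [].
have mf : measurable_fun [set: R1 * R1] f.
  by apply/(measurable_restrictT _ mD); exact: open_continuous_measurable_plane.
have f0 z : 0 <= f z by rewrite fE; case: ifPn => //; rewrite inE => /g0.
have fin x t : 0 < x -> r < x < S -> f (polar z0 x t) = g (polar z0 x t).
  by move=> x0 xI; rewrite fE mem_set//; apply/Dr.
have fout x t : 0 < x -> ~ (r < x < S) -> f (polar z0 x t) = 0.
  by move=> x0 xI; rewrite fE memNset// => /Dr => /(_ x0).
have cgt x : r < x < S -> continuous (fun t => g (polar z0 x t)).
  move=> xI; have x0 : 0 < x by case/andP: xI => rx _; exact: le_lt_trans rx.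
  apply: (@continuous_section _ (fun v => g (polar z0 v.1 v.2))) => t.
  apply: (@continuous_comp _ _ _ (fun v : R * R => polar z0 v.1 v.2) g).
    by apply: (@continuous_polar _ z0 id); exact: cvg_id.
  by apply: cg; apply/Dr.
have cft x : 0 < x -> continuous (fun t => f (polar z0 x t)).
  move=> x0; have [xI|xI] := pselect (r < x < S).
    by rewrite (_ : (fun t => _) = (fun t => g (polar z0 x t)));
      [exact: cgt|apply/funext => t; exact: fin].
  rewrite (_ : (fun t => _) = cst 0); [|by apply/funext => t; exact: fout].
  by move=> t; exact: cst_continuous.
pose k (v : R * R) := if v.2 \in `[T0, T1] then f (polar z0 v.1 v.2) else 0.
have mk : measurable_fun [set: R1 * R1] k.
  apply: measurable_fun_ifT => //.
    rewrite (_ : (fun v : R1 * R1 => v.2 \in `[T0, T1]) = (fun v => (T0 <= v.2) && (v.2 <= T1))).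
      by apply: measurable_and; apply: measurable_fun_ler.
    by apply/funext => v; rewrite in_itv.
  exact: (measurableT_comp mf (measurable_polar z0)).
have k0 v : 0 <= k v by rewrite /k; case: ifP.
have kI x : (\int[lam]_t (k (x, t))%:E = \int[lam]_(t in `[T0, T1]) (f (polar z0 x t))%:E)%E.
  rewrite [RHS]integral_mkcond; apply: eq_integral => t _; rewrite patchE /k /=.
  by rewrite mem_setE; case: ifP.
have inner x : r < x < S ->
    (x%:E * \int[lam]_t (k (x, t))%:E = (x * circle_integral (fun t => g (polar z0 x t)))%:E)%E.
  move=> xI; have x0 : 0 < x by case/andP: xI => rx _; exact: le_lt_trans rx.
  rewrite kI EFinM -circle_integralE; last exact: cgt.
  by congr (_ * _)%E; apply: eq_integral => t _; rewrite fin.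
have mK : measurable_fun [set: R] (fun x => x%:E * \int[lam]_t (k (x, t))%:E)%E.
  apply: emeasurable_funM; first exact/measurable_EFinP.
  exact: measurable_inner_integral.
split; last first.
  apply: eq_measurable_fun (measurable_funTS mK) => x; rewrite inE /= in_itv /=.
  exact: inner.
rewrite integral_mkcond.
transitivity (\int[@mu2 R]_z (f z)%:E)%E.
  by apply: eq_integral => z _; rewrite fE patchE; case: ifP.
rewrite (ge0_integral_polar (z0 := z0) mf f0 cft) [LHS]integral_mkcond [RHS]integral_mkcond.
apply: eq_integral => x _; rewrite !patchE !mem_setE !in_itv /= andbT.
case: ifPn => [x0|]; last first.
  rewrite -leNgt => x0; rewrite ifF//; apply/negbTE/negP => /andP[rx _].
  by have := le_lt_trans r0 rx; rewrite ltNge x0.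
case: ifPn => xI; first by rewrite -kI inner.
rewrite (eq_integral (cst 0%E)) ?integral0 ?mule0// => t _.
by rewrite fout//; exact/negP.
Qed.
End PolarDomains.

Section HolomorphicDomains.
Context {R : realType}.
Local Notation lam := (@lebesgue_measure R).
Implicit Types (F G : R * R -> R[i]).

Lemma ccontinuous_cmod_sqr F z : ccontinuous_at F z ->
  {for z, continuous (fun w => cmod (F w) ^+ 2)}.
Proof.
move=> [c1 c2].
have -> : (fun w => cmod (F w) ^+ 2) = (fun w => complex.Re (F w) * complex.Re (F w)
   + complex.Im (F w) * complex.Im (F w)).
  by apply/funext => w; rewrite cmod_sqr !expr2.
by apply: cvgD; apply: cvgM.
Qed.

Lemma ccontinuousB F (c : R[i]) z : ccontinuous_at F z -> ccontinuous_at (fun w => F w - c) z.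
Proof.
move=> [c1 c2]; split.
  rewrite (_ : (fun w => _) = (fun w => complex.Re (F w) - complex.Re c)).
    by apply: cvgB => //; exact: cvg_cst.
  by apply/funext => w; rewrite ReB.
rewrite (_ : (fun w => _) = (fun w => complex.Im (F w) - complex.Im c)).
  by apply: cvgB => //; exact: cvg_cst.
by apply/funext => w; rewrite ImB.
Qed.

(** Integration of the Poincare inequality on circles over the radius, with
    x <= S. *)
Lemma annulus_poincare (F F' : R * R -> R[i]) z0 (r S : R) : 0 <= r -> r < S ->
  holomorphic (annulus z0 r S) F F' -> exists c : R[i],
  (\int[@mu2 R]_(z in annulus z0 r S) (cmod (F z - c) ^+ 2)%:E <=
   ((2 * pi * S) ^+ 2)%:E * \int[@mu2 R]_(z in annulus z0 r S) (cmod (F' z) ^+ 2)%:E)%E.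
Proof.
move=> r0 rS hF; have [c Hc] := circle_poincare_holomorphic r0 hF rS; exists c.
have [-> m1] := integral_radial_domain r0 (radial_annulus z0 r S)
  (fun z zr => ccontinuous_cmod_sqr (ccontinuousB c (cderiv_ccontinuous (hF z zr).1)))
  (fun z _ => sqr_ge0 (cmod (F z - c))).
have [-> m2] := integral_radial_domain r0 (radial_annulus z0 r S)
  (fun z zr => ccontinuous_cmod_sqr (hF z zr).2)
  (fun z _ => sqr_ge0 (cmod (F' z))).
have CI0 x : 0 <= circle_integral (fun t => cmod (F' (polar z0 x t)) ^+ 2).
  by apply: Rintegral_ge0 => t _; exact: sqr_ge0.
have CI0' x : 0 <= circle_integral (fun t => cmod (F (polar z0 x t) - c) ^+ 2).
  by apply: Rintegral_ge0 => t _; exact: sqr_ge0.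
have x0 x : x \in `]r, S[ -> 0 <= x.
  by rewrite in_itv /= => /andP[rx _]; exact: le_trans r0 (ltW rx).
rewrite -ge0_integralZl//=; last 2 first.
- by move=> x /x0 xr; rewrite lee_fin mulr_ge0.
- by rewrite lee_fin sqr_ge0.
apply: ge0_le_integral => //=.
- by move=> x /x0 xr; rewrite lee_fin mulr_ge0.
- by apply: emeasurable_funM => //; exact: measurable_cst.
- move=> x xr; have xp := x0 x xr; rewrite in_itv /= in xr.
  rewrite -EFinM lee_fin mulrCA ler_wpM2l//.
  apply: (le_trans (Hc x xr)); rewrite ler_wpM2r//.
  have [rx xS] := andP xr; have p0 := pi_gt0 R.
  have S0 : 0 <= S by rewrite (le_trans xp)// ltW.
  have p2 : 0 <= 2 * pi :> R by lra.
  apply: lerXn2r; rewrite ?nnegrE; [exact: mulr_ge0|exact: mulr_ge0|].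
  by apply: ler_wpM2l => //; exact: ltW.
Qed.

(** Monotonicity makes x M(x) at most r M(r) on ]0, r] and at least r M(r)
    on ]r, r'[, so the two integrals compare like the lengths r and r' - r. *)
Lemma hole_le_annulus (F F' : R * R -> R[i]) z0 (r r' S : R) : 0 < r -> r < r' -> r' <= S ->
  holomorphic (disc S z0) F F' ->
  (\int[lam]_(x in `]0%R, r]) (x * circle_integral (fun t => cmod (F (polar z0 x t)) ^+ 2))%:E <=
   (r / (r' - r))%:E *
     \int[lam]_(x in `]r, r'[) (x * circle_integral (fun t => cmod (F (polar z0 x t)) ^+ 2))%:E)%E.
Proof.
move=> r0 rr' rS hF.
pose M x := circle_integral (fun t => cmod (F (polar z0 x t)) ^+ 2).
have M0 x : 0 <= M x by apply: Rintegral_ge0 => t _; exact: sqr_ge0.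
have [_ mM] := integral_radial_domain (lexx 0) (radial_disc z0 S)
  (fun z zr => ccontinuous_cmod_sqr (cderiv_ccontinuous (hF z zr).1))
  (fun z _ => sqr_ge0 (cmod (F z))).
have mono := circle_integral_monotone hF.
have d0 : 0 < r' - r by rewrite subr_gt0.
have rltS : r < S by exact: lt_le_trans rr' rS.
apply: (@le_trans _ _ (r * M r * r)%:E).
  apply: (@le_trans _ _ (\int[lam]_(x in `]0%R, r]) (r * M r)%:E)%E).
    apply: ge0_le_integral => //=.
    - by move=> x; rewrite in_itv /= => /andP[x0 _]; rewrite lee_fin; apply: mulr_ge0; [exact: ltW|exact: M0].
    - apply: measurable_funS mM; first exact: measurable_itv.
      by move=> x /=; rewrite !in_itv /= => /andP[-> xr]; exact: le_lt_trans xr rltS.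
    - move=> x; rewrite in_itv /= => /andP[x0 xr]; rewrite lee_fin.
      by apply: ler_pM; [exact: ltW|exact: M0|by []|exact: mono].
  rewrite integral_cst//= lebesgue_measure_itv/= lte_fin r0 sube0.
  by rewrite -EFinM.
rewrite -[leLHS]mul1e (_ : 1%E = ((r / (r' - r)) * ((r' - r) / r))%:E :> \bar R); last first.
  by congr EFin; field; rewrite !gt_eqF.
rewrite EFinM -muleA; apply: lee_wpmul2l.
  by rewrite lee_fin; apply: divr_ge0; exact: ltW.
apply: (@le_trans _ _ (\int[lam]_(x in `]r, r'[) (r * M r)%:E)%E).
  rewrite integral_cst//= lebesgue_measure_itv/= lte_fin rr' -EFinB -!EFinM lee_fin.
  rewrite (_ : (r' - r) / r * _ = r * M r * (r' - r))//.
  by field; rewrite gt_eqF.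
apply: ge0_le_integral => //=.
- by move=> x _; rewrite lee_fin; apply: mulr_ge0; [exact: ltW|exact: M0].
- apply: measurable_funS mM; first exact: measurable_itv.
  by move=> x /=; rewrite !in_itv /= => /andP[rx xr]; rewrite (lt_trans r0 rx) (lt_le_trans xr).
- move=> x; rewrite in_itv /= => /andP[rx xr]; rewrite lee_fin.
  apply: ler_pM; [exact: ltW|exact: M0|exact: ltW|].
  by apply: mono => //; [exact: ltW|exact: lt_le_trans xr rS].
Qed.

(** A weight with values at most Mw in the hole and at least m on the part
    of the annulus next to it turns the comparison of the unweighted means
    into one of the weighted integrals, at the price of Mw / m. *)
Lemma disc_le_annulus (F F' : R * R -> R[i]) (w : R * R -> R) z0 (r r' S m Mw : R) :
  0 <= r -> r < r' -> r' <= S -> 0 < m -> 0 <= Mw ->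
  holomorphic (disc S z0) F F' ->
  (forall z, disc S z0 z -> {for z, continuous w}) -> (forall z, disc S z0 z -> 0 <= w z) ->
  (forall z, enorm (z - z0) <= r -> w z <= Mw) ->
  (forall z, r < enorm (z - z0) < r' -> m <= w z) ->
  (\int[@mu2 R]_(z in disc S z0) (w z * cmod (F z) ^+ 2)%:E <=
   (1 + Mw / m * (r / (r' - r)))%:E *
     \int[@mu2 R]_(z in annulus z0 r S) (w z * cmod (F z) ^+ 2)%:E)%E.
Proof.
move=> r0 rr' rS m0 Mw0 hF cw w0 wM wm.
have rltS : r < S by exact: lt_le_trans rr' rS.
have d0 : 0 < r' - r by rewrite subr_gt0.
have sub z : annulus z0 r S z -> disc S z0 z by move=> /andP[].
have cg z : disc S z0 z -> {for z, continuous (fun z => w z * cmod (F z) ^+ 2)}.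
  move=> zD; apply: cvgM; first exact: cw.
  exact: ccontinuous_cmod_sqr (cderiv_ccontinuous (hF z zD).1).
have g0 z : disc S z0 z -> 0 <= w z * cmod (F z) ^+ 2.
  by move=> zD; rewrite mulr_ge0 ?w0 ?sqr_ge0.
have [-> mD] := integral_radial_domain (lexx 0) (radial_disc z0 S) cg g0.
have [-> _] := integral_radial_domain r0 (radial_annulus z0 r S)
  (fun z zr => cg z (sub z zr)) (fun z zr => g0 z (sub z zr)).
set k := fun x => (x * circle_integral _)%:E.
have k0 x : x \in `]0, S[ -> (0 <= k x)%E.
  rewrite in_itv /= => /andP[x0 xS]; rewrite lee_fin; apply: mulr_ge0; first exact: ltW.
  apply: Rintegral_ge0 => t _; apply: g0; apply: polar_disc.
  by rewrite gtr0_norm.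
have cgt x : 0 < x -> x < S -> continuous (fun t => w (polar z0 x t) * cmod (F (polar z0 x t)) ^+ 2).
  move=> x0 xS.
  apply: (@continuous_section _ (fun v => w (polar z0 v.1 v.2) * cmod (F (polar z0 v.1 v.2)) ^+ 2)) => t.
  apply: (@continuous_comp _ _ _ (fun v : R * R => polar z0 v.1 v.2) (fun z => w z * cmod (F z) ^+ 2)).
    by apply: (@continuous_polar _ z0 id); exact: cvg_id.
  by apply: cg; apply: polar_disc; rewrite gtr0_norm.
have cFt x : 0 < x -> x < S -> continuous (fun t => cmod (F (polar z0 x t)) ^+ 2).
  move=> x0 xS.
  apply: (@continuous_section _ (fun v => cmod (F (polar z0 v.1 v.2)) ^+ 2)) => t.
  apply: (@continuous_comp _ _ _ (fun v : R * R => polar z0 v.1 v.2) (fun z => cmod (F z) ^+ 2)).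
    by apply: (@continuous_polar _ z0 id); exact: cvg_id.
  apply: ccontinuous_cmod_sqr; apply: cderiv_ccontinuous (hF _ _).1.
  by apply: polar_disc; rewrite gtr0_norm.
have cZ (c : R) (g : R -> R) : continuous g -> continuous (fun t => c * g t).
  by move=> cg' t; apply: cvgM; [exact: cvg_cst|exact: cg'].
have CIZ (c : R) (g : R -> R) : continuous g -> circle_integral (fun t => c * g t) = c * circle_integral g.
  by move=> cg'; rewrite /circle_integral RintegralZl//; exact: circle_integrable.
have [r00|rn0] := eqVneq r 0.
  by rewrite r00 mul0r mulr0 addr0 mul1e.
have rpos : 0 < r by rewrite lt_neqAle eq_sym rn0.
rewrite (@itv_bndbnd_setU _ _ (BRight 0) (BRight r) (BLeft S)); last 2 first.
- by rewrite bnd_simp ltW.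
- by rewrite bnd_simp.
have s1 : `]0, r]%classic `<=` `]0, S[%classic.
  by move=> x /=; rewrite !in_itv /= => /andP[-> xr]; exact: le_lt_trans xr rltS.
have s2 : `]r, S[%classic `<=` `]0, S[%classic.
  by move=> x /=; rewrite !in_itv /= => /andP[rx ->]; rewrite (lt_trans rpos rx).
rewrite ge0_integral_setU//=; last 3 first.
- apply: measurable_funS mD; first exact: measurable_itv.
  by rewrite subUset.
- by move=> x [/s1|/s2] /= /k0.
- rewrite disj_set2E; apply/eqP/seteqP; split => // x [] /=.
  by rewrite !in_itv /= => /andP[_ h1] /andP[h2 _]; rewrite leNgt h2 in h1.
have kap0 : 0 <= Mw / m * (r / (r' - r)).
  by apply: mulr_ge0; apply: divr_ge0 => //; exact: ltW.
rewrite EFinD ge0_muleDl ?lee_fin//.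
rewrite mul1e addeC leeD2l//.
pose M x := circle_integral (fun t => cmod (F (polar z0 x t)) ^+ 2).
have M0 x : 0 <= M x by apply: Rintegral_ge0 => t _; exact: sqr_ge0.
have [_ mM] := integral_radial_domain (lexx 0) (radial_disc z0 S)
  (fun z zr => ccontinuous_cmod_sqr (cderiv_ccontinuous (hF z zr).1))
  (fun z _ => sqr_ge0 (cmod (F z))).
apply: (@le_trans _ _ (Mw%:E * \int[lam]_(x in `]0%R, r]) (x * M x)%:E)%E).
  rewrite -ge0_integralZl//=; last 2 first.
  - apply: measurable_funS mM; [exact: measurable_itv|exact: s1].
  - by move=> x; rewrite in_itv /= => /andP[x0 _]; rewrite lee_fin mulr_ge0// ltW.
  apply: ge0_le_integral => //=.
  - by move=> x /s1 /k0.
  - apply: measurable_funS mD; [exact: measurable_itv|exact: s1].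
  - apply: emeasurable_funM; first exact: measurable_cst.
    apply: measurable_funS mM; [exact: measurable_itv|exact: s1].
  - move=> x; rewrite in_itv /= => /andP[x0 xr]; have xS : x < S := le_lt_trans xr rltS.
    rewrite /k -EFinM lee_fin mulrCA; apply: ler_wpM2l; first exact: ltW.
    rewrite -CIZ; last exact: cFt.
    apply: le_circle_integral; [exact: cgt|by apply: cZ; exact: cFt|].
    by move=> t _; rewrite ler_wpM2r ?sqr_ge0//; apply: wM; rewrite enorm_polar gtr0_norm.
have H := hole_le_annulus rpos rr' rS hF.
apply: (@le_trans _ _ (Mw%:E * ((r / (r' - r))%:E * \int[lam]_(x in `]r, r'[) (x * M x)%:E))%E).
  by rewrite lee_wpmul2l ?lee_fin//; exact: H.
have s3 : `]r, r'[%classic `<=` `]r, S[%classic.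
  by move=> x /=; rewrite !in_itv /= => /andP[-> xr]; exact: lt_le_trans xr rS.
have s4 : `]r, r'[%classic `<=` `]0, S[%classic by move=> x /s3 /s2.
have K : (m%:E * \int[lam]_(x in `]r, r'[) (x * M x)%:E <= \int[lam]_(x in `]r, S[) k x)%E.
  apply: (@le_trans _ _ (\int[lam]_(x in `]r, r'[) k x)%E); last first.
    apply: ge0_subset_integral => //=.
    - apply: measurable_funS mD; [exact: measurable_itv|exact: s2].
    - by move=> x /s2 /k0.
  rewrite -ge0_integralZl//=; last 3 first.
  - apply: measurable_funS mM; [exact: measurable_itv|exact: s4].
  - by move=> x /s4; rewrite /= in_itv /= => /andP[x0 _]; rewrite lee_fin mulr_ge0// ltW.
  - by rewrite lee_fin ltW.
  apply: ge0_le_integral => //=.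
  - move=> x /s4; rewrite /= in_itv /= => /andP[x0 _].
    by rewrite -EFinM lee_fin; apply: mulr_ge0; [exact: ltW|apply: mulr_ge0 => //; exact: ltW].
  - apply: emeasurable_funM; first exact: measurable_cst.
    apply: measurable_funS mM; [exact: measurable_itv|exact: s4].
  - apply: measurable_funS mD; [exact: measurable_itv|exact: s4].
  - move=> x; rewrite in_itv /= => /andP[rx xr].
    have x0 : 0 < x := lt_trans rpos rx; have xS : x < S := lt_le_trans xr rS.
    rewrite /k -EFinM lee_fin mulrCA; apply: ler_wpM2l; first exact: ltW.
    rewrite -CIZ; last exact: cFt.
    apply: le_circle_integral; [by apply: cZ; exact: cFt|exact: cgt|].
    by move=> t _; rewrite ler_wpM2r ?sqr_ge0//; apply: wm; rewrite enorm_polar gtr0_norm// rx.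
apply: (@le_trans _ _ ((Mw / m * (r / (r' - r)))%:E * (m%:E * \int[lam]_(x in `]r, r'[) (x * M x)%:E))%E).
  rewrite !muleA -!EFinM (_ : Mw * (r / (r' - r)) = Mw / m * (r / (r' - r)) * m)//.
  by field; rewrite !gt_eqF.
by rewrite lee_wpmul2l// lee_fin.
Qed.
End HolomorphicDomains.

(** * Weak gradients of functions of class C^1 *)

Section Bumps.
Context {R : realType}.
Implicit Types (z w : R * R).

Definition pos_part (s : R) : R := Num.max s 0.

Lemma pos_part_quadratic (s v : R) :
  `|pos_part (s + v) ^+ 2 - pos_part s ^+ 2 - 2 * pos_part s * v| <= v ^+ 2.
Proof.
rewrite ler_norml /pos_part.
case: (leP (s + v) 0) => h1; case: (leP s 0) => h2; rewrite ?expr0n /= ?mulr0 ?mul0r;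
  apply/andP; split; nra.
Qed.

Lemma continuous_pos_part : continuous pos_part.
Proof.
move=> s; apply: (@continuous_max _ _ (@id R) (fun=> 0)); [exact: cvg_id|exact: cvg_cst].
Qed.

Lemma is_diff_pos_part_sqr (k1 k2 c : R) z : `|k1| + `|k2| <= 1 ->
  is_diff z (fun w => pos_part (k1 * w.1 + k2 * w.2 + c) ^+ 2)
    (fun v => (2 * pos_part (k1 * z.1 + k2 * z.2 + c) * k1) * v.1 +
              (2 * pos_part (k1 * z.1 + k2 * z.2 + c) * k2) * v.2).
Proof.
move=> k1_le; apply: (@is_diff_quadratic _ _ _ _ _ 1 1) => // v _.
rewrite mul1r.
set s := k1 * z.1 + k2 * z.2 + c; set d := k1 * v.1 + k2 * v.2.
have -> : k1 * (z + v).1 + k2 * (z + v).2 + c = s + d by rewrite /s /d /=; ring.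
have -> : 2 * pos_part s * k1 * v.1 + 2 * pos_part s * k2 * v.2 = 2 * pos_part s * d.
  by rewrite /d; ring.
apply: (le_trans (pos_part_quadratic _ _)).
rewrite -[leLHS]real_normK ?num_real// lerXn2r ?nnegrE//.
apply: (le_trans (ler_normD _ _)); rewrite !normrM.
have h1 : `|v.1| <= `|v| by rewrite /Num.norm /= le_max lexx.
have h2 : `|v.2| <= `|v| by rewrite /Num.norm /= le_max lexx orbT.
apply: (@le_trans _ _ ((`|k1| + `|k2|) * `|v|)).
  by rewrite mulrDl lerD// ler_wpM2l.
by rewrite -[leRHS]mul1r ler_wpM2r.
Qed.

(** Positive exactly on the open box: each factor vanishes beyond one side.
    The squares make it of class C^1. *)
Definition box_product (q : R * R * (R * R)) z : R :=
  pos_part (1 * z.1 + 0 * z.2 + - q.1.1) ^+ 2 * pos_part ((-1) * z.1 + 0 * z.2 + q.1.2) ^+ 2 *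
  (pos_part (0 * z.1 + 1 * z.2 + - q.2.1) ^+ 2 * pos_part (0 * z.1 + (-1) * z.2 + q.2.2) ^+ 2).

Lemma box_product_ge0 q z : 0 <= box_product q z.
Proof. by apply: mulr_ge0; apply: mulr_ge0; exact: sqr_ge0. Qed.

Lemma box_product_gt0 q z : (0 < box_product q z) <-> obox q z.
Proof.
have P (s : R) : (0 < pos_part s ^+ 2) = (0 < s).
  by rewrite exprn_even_gt0//= /pos_part; case: (leP s 0) => h; rewrite ?eqxx ?gt_eqF.
have Q (a b c d : R) : 0 <= a -> 0 <= b -> 0 <= c -> 0 <= d ->
    (0 < a * b * (c * d)) = ((0 < a) && (0 < b)) && ((0 < c) && (0 < d)).
  move=> a0 b0 c0 d0; rewrite !lt_neqAle !(eq_sym 0) a0 b0 c0 d0 !mulr_ge0//.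
  by rewrite !mulf_eq0 !negb_or !andbT.
rewrite /box_product Q ?sqr_ge0// !P.
rewrite /obox /= !in_itv /= !mul0r !mul1r !addr0 !add0r !mulN1r.
rewrite !(addrC (- _)) !subr_gt0.
by split=> [/andP[/andP[-> ->] /andP[-> ->]]|[/andP[-> ->] /andP[-> ->]]].
Qed.

Definition C1_gradient (phi px py : R * R -> R) : Prop :=
  [/\ forall z, is_diff z phi (fun v => px z * v.1 + py z * v.2),
      continuous px & continuous py].

Lemma C1_gradientM f fx fy g gx gy : C1_gradient f fx fy -> C1_gradient g gx gy ->
  C1_gradient (fun z => f z * g z) (fun z => f z * gx z + g z * fx z)
     (fun z => f z * gy z + g z * fy z).
Proof.
move=> [df cfx cfy] [dg cgx cgy].
have cf : continuous f by move=> z; apply: differentiable_continuous; case: (df z).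
have cg : continuous g by move=> z; apply: differentiable_continuous; case: (dg z).
split.
- move=> z; apply: (is_diff_eq (is_diffM (df z) (dg z))).
  by apply/funext => v; rewrite !fctE /GRing.scale /=; ring.
- by move=> z; apply: cvgD; apply: cvgM; [exact: cf|exact: cgx|exact: cg|exact: cfx].
- by move=> z; apply: cvgD; apply: cvgM; [exact: cf|exact: cgy|exact: cg|exact: cfy].
Qed.

Lemma C1_gradient_pos_part_sqr (k1 k2 c : R) : `|k1| + `|k2| <= 1 ->
  C1_gradient (fun w => pos_part (k1 * w.1 + k2 * w.2 + c) ^+ 2)
    (fun z => 2 * pos_part (k1 * z.1 + k2 * z.2 + c) * k1)
    (fun z => 2 * pos_part (k1 * z.1 + k2 * z.2 + c) * k2).
Proof.
move=> kle; have cl : continuous (fun z : R * R => pos_part (k1 * z.1 + k2 * z.2 + c)).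
  move=> z; apply: (@continuous_comp _ _ _ (fun z : R * R => k1 * z.1 + k2 * z.2 + c) pos_part).
    apply: cvgD; last exact: cvg_cst.
    by apply: cvgD; apply: cvgM; [exact: cvg_cst|exact: cvg_fst|exact: cvg_cst|exact: cvg_snd].
  exact: continuous_pos_part.
split; first by move=> z; exact: is_diff_pos_part_sqr.
- by move=> z; apply: cvgM; [apply: cvgM; [exact: cvg_cst|exact: cl]|exact: cvg_cst].
- by move=> z; apply: cvgM; [apply: cvgM; [exact: cvg_cst|exact: cl]|exact: cvg_cst].
Qed.

Lemma C1_box_product q : exists px py, C1_gradient (box_product q) px py.
Proof.
have k10 : `|1 : R| + `|0 : R| <= 1 by rewrite normr1 normr0 addr0.
have kN0 : `|-1 : R| + `|0 : R| <= 1 by rewrite normrN1 normr0 addr0.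
have k01 : `|0 : R| + `|1 : R| <= 1 by rewrite normr1 normr0 add0r.
have k0N : `|0 : R| + `|-1 : R| <= 1 by rewrite normrN1 normr0 add0r.
have H := C1_gradientM
  (C1_gradientM (C1_gradient_pos_part_sqr (- q.1.1) k10) (C1_gradient_pos_part_sqr q.1.2 kN0))
  (C1_gradientM (C1_gradient_pos_part_sqr (- q.2.1) k01) (C1_gradient_pos_part_sqr q.2.2 k0N)).
by eexists; eexists; exact: H.
Qed.

(** With b = box_product q, the functions n b / (1 + n b) are of class C^1 and
    increase to the indicator of the box. *)
Definition bump (n : nat) (q : R * R * (R * R)) z : R :=
  n%:R * box_product q z * (1 + n%:R * box_product q z)^-1.

Lemma bump_den n q z : 0 < 1 + n%:R * box_product q z.
Proof. by rewrite ltr_pwDl// mulr_ge0// box_product_ge0. Qed.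

Lemma C1_bump n q : exists px py, C1_gradient (bump n q) px py.
Proof.
have [px [py [d cx cy]]] := C1_box_product q.
have cb : continuous (box_product q) by move=> z; apply: differentiable_continuous; case: (d z).
have cden : continuous (fun z => (1 + n%:R * box_product q z) ^- 2).
  move=> z; apply: cvgV; first by rewrite expf_neq0// gt_eqF// bump_den.
  apply: (@continuous_comp _ _ _ (fun z => 1 + n%:R * box_product q z) (fun x => x ^+ 2)); last exact: exprn_continuous.
  by apply: cvgD; [exact: cvg_cst|apply: cvgM; [exact: cvg_cst|exact: cb]].
exists (fun z => n%:R * px z * (1 + n%:R * box_product q z) ^- 2),
  (fun z => n%:R * py z * (1 + n%:R * box_product q z) ^- 2); split.
- move=> z; have d0 := bump_den n q z.
  have dn : is_diff z (n%:R *: box_product q) (n%:R *: (fun v : R * R => px z * v.1 + py z * v.2)).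
    exact: is_diffZ (d z).
  have dd := is_diffD (is_diff_cst (1 : R) z) dn.
  have dV := @is_diff_inv _ _ _ z _ dd.
  have dV' := dV (lt0r_neq0 d0).
  apply: (is_diff_eq (is_diffM dn dV')); apply/funext => v.
  rewrite !fctE /GRing.scale /= (_ : (0 : R * R -> R) v = 0)//.
  by field; exact: lt0r_neq0.
- by move=> z; apply: cvgM; [apply: cvgM; [exact: cvg_cst|exact: cx]|exact: cden].
- by move=> z; apply: cvgM; [apply: cvgM; [exact: cvg_cst|exact: cy]|exact: cden].
Qed.

Lemma bump_ge0 n q z : 0 <= bump n q z.
Proof.
rewrite /bump; apply: mulr_ge0; first by rewrite mulr_ge0// box_product_ge0.
by rewrite invr_ge0 ltW// bump_den.
Qed.

Lemma bump_le1 n q z : bump n q z <= 1.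
Proof. by rewrite /bump ler_pdivrMr ?bump_den// mul1r lerDr. Qed.

Lemma bump_out n q z : ~ obox q z -> bump n q z = 0.
Proof.
move=> qz; rewrite /bump (_ : box_product q z = 0) ?mulr0 ?mul0r//.
apply/eqP; apply/negPn/negP => h; apply: qz; apply/box_product_gt0.
by rewrite lt_neqAle eq_sym h box_product_ge0.
Qed.

Lemma bump_cvg q z : obox q z -> bump n q z @[n --> \oo] --> (1 : R).
Proof.
move=> /box_product_gt0 b0.
have -> : (fun n => bump n q z) = (fun n => 1 - (1 + n%:R * box_product q z)^-1).
  apply/funext => n; have d0 := bump_den n q z.
  by rewrite /bump; field; exact: lt0r_neq0.
rewrite -[X in _ --> X]subr0; apply: cvgB; first exact: cvg_cst.
apply/gtr0_cvgV0; first by apply: nearW => n; exact: bump_den.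
apply/cvgryPge => A; near=> n.
have : A / box_product q z <= n%:R by near: n; exact: nbhs_infty_ger.
by rewrite ler_pdivrMr// => /le_trans; apply; rewrite lerDr.
Unshelve. all: by end_near. Qed.

Lemma bump_test_function n q (U : set (R * R)) : cbox q `<=` U -> test_function U (bump n q).
Proof.
move=> qU; have [px [py [d cx cy]]] := C1_bump n q; split.
  have g1 : (fun w => (grad (bump n q) w).1) = px.
    by apply/funext => w; rewrite /grad /= (is_diff_derive _ (d w)) /= mulr1 mulr0 addr0.
  have g2 : (fun w => (grad (bump n q) w).2) = py.
    by apply/funext => w; rewrite /grad /= (is_diff_derive _ (d w)) /= mulr1 mulr0 add0r.
  move=> z _; split; first by case: (d z).
    by rewrite g1; exact: cx.
  by rewrite g2; exact: cy.
exists (cbox q); split => //; first exact: compact_cbox.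
move=> z qz; apply: bump_out => -[h1 h2]; apply: qz; split; apply: subset_itv_oo_cc; [exact: h1|exact: h2].
Qed.
End Bumps.

Section WeakGradient.
Context {R : realType}.
Local Notation R1 := (measurableTypeR R).
Implicit Types (z w : R * R) (O U : set (R * R)).

Lemma obox_cbox (q : R * R * (R * R)) : obox q `<=` cbox q.
Proof. by move=> z [h1 h2]; split; apply: subset_itv_oo_cc; [exact: h1|exact: h2]. Qed.

(** The integrand is the partial derivative of u phi, and phi vanishes on the
    sides of the box. *)
Lemma box_integration_by_parts O (u p s phi px py : R * R -> R) (a b c d : R) :
  a <= b -> c <= d -> open O -> cbox ((a, b), (c, d)) `<=` O ->
  (forall z, O z -> is_diff z u (fun v => p z * v.1 + s z * v.2)) ->
  (forall z, O z -> {for z, continuous p}) -> (forall z, O z -> {for z, continuous s}) ->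
  C1_gradient phi px py -> (forall z, ~ obox ((a, b), (c, d)) z -> phi z = 0) ->
  (\int[@mu2 R]_(z in cbox ((a, b), (c, d))) (u z * px z + phi z * p z)%:E = 0)%E /\
  (\int[@mu2 R]_(z in cbox ((a, b), (c, d))) (u z * py z + phi z * s z)%:E = 0)%E.
Proof.
move=> ab cd oO qO du cp cs [dphi cpx cpy] phi0.
have cu z : O z -> {for z, continuous u}.
  by move=> Oz; apply: differentiable_continuous; case: (du z Oz).
have cphi : continuous phi by move=> z; apply: differentiable_continuous; case: (dphi z).
have cX z : O z -> {for z, continuous (fun z => u z * px z + phi z * p z)}.
  by move=> Oz; apply: cvgD; apply: cvgM; [exact: cu|exact: cpx|exact: cphi|exact: cp].
have cY z : O z -> {for z, continuous (fun z => u z * py z + phi z * s z)}.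
  by move=> Oz; apply: cvgD; apply: cvgM; [exact: cu|exact: cpy|exact: cphi|exact: cs].
have d1 x y : O (x, y) -> is_derive x 1 (fun x => u (x, y) * phi (x, y))
    (u (x, y) * px (x, y) + phi (x, y) * p (x, y)).
  move=> Oz.
  have D (f fx fy : R * R -> R) : is_diff (x, y) f (fun v => fx (x, y) * v.1 + fy (x, y) * v.2) ->
      is_derive x 1 (fun x => f (x, y)) (fx (x, y)).
    move=> df; have := @is_derive_curve _ f id (fun=> y) x _ _ 1 0 df (is_derive_id _ _) (is_derive_cst _ _ _).
    by rewrite mulr1 mulr0 addr0.
  exact: (is_derive_eq (is_deriveM (D _ _ _ (du _ Oz)) (D _ _ _ (dphi (x, y))))).
have d2 x y : O (x, y) -> is_derive y 1 (fun y => u (x, y) * phi (x, y))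
    (u (x, y) * py (x, y) + phi (x, y) * s (x, y)).
  move=> Oz.
  have D (f fx fy : R * R -> R) : is_diff (x, y) f (fun v => fx (x, y) * v.1 + fy (x, y) * v.2) ->
      is_derive y 1 (fun y => f (x, y)) (fy (x, y)).
    move=> df; have := @is_derive_curve _ f (fun=> x) id y _ _ 0 1 df (is_derive_cst _ _ _) (is_derive_id _ _).
    by rewrite mulr1 mulr0 add0r.
  exact: (is_derive_eq (is_deriveM (D _ _ _ (du _ Oz)) (D _ _ _ (dphi (x, y))))).
split.
  have [_ ->] := cbox_fubini (continuous_cbox_integrable oO cX qO).
  rewrite (eq_integral (cst 0%E)) ?integral0// => y; rewrite inE => yI.
  have Oxy x : x \in `[a, b] -> O (x, y) by move=> xI; apply: qO; split.
  rewrite (@integral_itv_derive _ (fun x => u (x, y) * phi (x, y))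
    (fun x => u (x, y) * px (x, y) + phi (x, y) * p (x, y)) a b ab
    (fun x xI => d1 x y (Oxy x xI))); last first.
    move=> x xI; apply: (@continuous_comp _ _ _ (fun x => (x, y)) (fun z => u z * px z + phi z * p z)).
      exact: continuous_pairl.
    by apply: cX; exact: Oxy.
  rewrite !phi0 ?mulr0 ?subrr//.
  - by case; rewrite /= in_itv /= ltxx.
  - by case; rewrite /= in_itv /= ltxx andbF.
have [-> _] := cbox_fubini (continuous_cbox_integrable oO cY qO).
rewrite (eq_integral (cst 0%E)) ?integral0// => x; rewrite inE => xI.
have Oxy y : y \in `[c, d] -> O (x, y) by move=> yI; apply: qO; split.
rewrite (@integral_itv_derive _ (fun y => u (x, y) * phi (x, y))
  (fun y => u (x, y) * py (x, y) + phi (x, y) * s (x, y)) c d cd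
  (fun y yI => d2 x y (Oxy y yI))); last first.
  move=> y yI; apply: (@continuous_comp _ _ _ (pair x) (fun z => u z * py z + phi z * s z)).
    exact: continuous_pairr.
  by apply: cY; exact: Oxy.
rewrite !phi0 ?mulr0 ?subrr//.
- by case=> _; rewrite /= in_itv /= ltxx.
- by case=> _; rewrite /= in_itv /= ltxx andbF.
Qed.

(** Dominated convergence along the bumps of the box. *)
Lemma bump_integral_limit (q : R * R * (R * R)) (w : R * R -> R) :
  (@mu2 R).-integrable (cbox q) (EFin \o w) ->
  (forall n, \int[@mu2 R]_(z in cbox q) (w z * bump n q z)%:E = 0)%E ->
  (\int[@mu2 R]_(z in obox q) (w z)%:E = 0)%E.
Proof.
move=> intw w0.
have mq : measurable (cbox q : set (R1 * R1)) := measurable_cbox q.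
have mo : measurable (obox q : set (R1 * R1)) := measurable_obox q.
have mw : measurable_fun (cbox q : set (R1 * R1)) w by apply/measurable_EFinP; exact: measurable_int intw.
have mb n : measurable_fun setT (bump n q : R1 * R1 -> R1).
  have [px [py [d _ _]]] := C1_bump n q.
  apply: open_continuous_measurable_plane; first exact: openT.
  by move=> z _; apply: differentiable_continuous; case: (d z).
pose f := fun z => ((w \_ (obox q)) z)%:E.
have mf : measurable_fun (cbox q : set (R1 * R1)) f.
  apply/measurable_EFinP/(measurable_restrict _ mo mq).
  by apply: measurable_funS mw => //; exact: subIsetl.
have [] := @dominated_convergence _ (R1 * R1)%type R (@mu2 R) (cbox q) mq
  (fun n z => (w z * bump n q z)%:E) f (fun z => `|w z|%:E).
- by move=> n; apply/measurable_EFinP/measurable_funM; [exact: mw|exact: (measurable_funTS (mb n))].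
- exact: mf.
- apply: aeW => z _; rewrite /f; apply: cvg_EFin; first exact: nearW.
  rewrite patchE; have [zq|zq] := pselect (obox q z).
    rewrite mem_set// -[X in _ --> X]mulr1.
    by apply: cvgM; [exact: cvg_cst|exact: bump_cvg].
  rewrite memNset//; apply: cvg_near_cst; apply: nearW => n.
  by rewrite /= (bump_out _ zq) mulr0.
- exact: (integrable_norm intw).
- apply: aeW => z n _; rewrite abse_EFin lee_fin normrM.
  rewrite -[leRHS]mulr1 ler_wpM2l// ger0_norm ?bump_ge0//; exact: bump_le1.
move=> _ _; rewrite (_ : [sequence _]_n = cst 0%E); last first.
  by apply/funext => n; exact: w0.
move=> /cvg_unique => /(_ (@ereal_hausdorff R) _ (@cvg_cst _ _ _ _ _)) fE.
transitivity (\int[@mu2 R]_(z in cbox q) f z)%E; last by rewrite fE.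
rewrite [RHS]integral_mkcond [LHS]integral_mkcond; apply: eq_integral => z _.
rewrite !patchE /f patchE; have [zq|zq] := boolP (z \in obox q).
  by rewrite mem_set//; apply: obox_cbox; rewrite inE in zq.
by case: ifP.
Qed.

(** The intersection of two boxes is a box, so the restriction of w to q has
    integral 0 over all boxes. *)
Lemma ae_eq0_on_box (q : R * R * (R * R)) (w : R * R -> R) :
  (@mu2 R).-integrable (cbox q) (EFin \o w) ->
  (forall a b c d : R, a <= b -> c <= d -> cbox ((a, b), (c, d)) `<=` cbox q ->
     (\int[@mu2 R]_(z in obox ((a, b), (c, d))) (w z)%:E = 0)%E) ->
  {ae @mu2 R, forall z, obox q z -> w z = 0}.
Proof.
move=> intw w0.
have mo : measurable (obox q : set (R1 * R1)) := measurable_obox q.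
have intwo : (@mu2 R).-integrable (obox q : set (R1 * R1)) (EFin \o w).
  apply: (@integrableS _ (R1 * R1)%type R (@mu2 R) (cbox q)) => //.
  - exact: measurable_cbox.
  - exact: obox_cbox.
pose f := (EFin \o w) \_ (obox q).
have intf : (@mu2 R).-integrable setT f.
  have X := (@integrable_mkcond _ (R1 * R1)%type R (@mu2 R) _ (EFin \o w) mo).
  exact: (iffLR X intwo).
have inter (q' : R * R * (R * R)) : (\int[@mu2 R]_(z in obox q' `&` obox q) (w z)%:E = 0)%E.
  rewrite /obox -setXI !setI_itvoo.
  set a := Num.max _ _; set b := Num.min _ _; set c := Num.max _ _; set d := Num.min _ _.
  have [ab|ba] := ltP a b; last by rewrite set_itv_ge ?bnd_simp -?leNgt// set0X integral_set0.
  have [cd|dc] := ltP c d; last by rewrite (@set_itv_ge _ _ _ (BLeft d)) ?bnd_simp -?leNgt// setX0 integral_set0.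
  apply: (w0 a b c d (ltW ab) (ltW cd)) => z [] /=; rewrite !in_itv /= => /andP[za zb] /andP[zc zd].
  move: za zb zc zd; rewrite /a /b /c /d !ge_max !le_min => /andP[_ ?] /andP[_ ?] /andP[_ ?] /andP[_ ?].
  by split; rewrite /= in_itv /=; apply/andP.
have : ae_eq (@mu2 R) setT f (cst 0%E).
  apply: ae_eq0_boxes => //.
    by rewrite -integral_mkcond -[X in integral _ X]setIid inter.
  by move=> q'; rewrite -integral_mkcondr inter.
apply: filterS => z /(_ I) fz zq; move: fz.
by rewrite /f patchE mem_set// => -[].
Qed.

Lemma ae2_mono2 (P Q S : R * R -> Prop) :
  {ae @mu2 R, forall z, P z} -> {ae @mu2 R, forall z, Q z} ->
  (forall z, P z -> Q z -> S z) -> {ae @mu2 R, forall z, S z}.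
Proof.
move=> aeP aeQ PQS; have FF := @ae_filter_ringOfSetsType _ (R1 * R1)%type R (@mu2 R).
exact: (@filterS2 _ _ FF _ _ _ PQS aeP aeQ).
Qed.

Lemma ae2_mono (P S : R * R -> Prop) : {ae @mu2 R, forall z, P z} ->
  (forall z, P z -> S z) -> {ae @mu2 R, forall z, S z}.
Proof. by move=> aeP PS; apply: (ae2_mono2 aeP aeP) => z Pz _; exact: PS. Qed.

Lemma ae2_countable (Q : countType) (P : Q -> R * R -> Prop) :
  (forall q, {ae @mu2 R, forall z, P q z}) -> {ae @mu2 R, forall z q, P q z}.
Proof.
move=> aeP.
have FF := @ae_foralln _ (R1 * R1)%type R (@mu2 R) (fun n z => forall q, unpickle n = Some q -> P q z).
apply: (ae2_mono (FF _)) => [n|z Pz q]; last by apply: (Pz (pickle q)); exact: pickleK.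
case: (unpickle n) => [q|]; last by apply: aeW => z q.
by apply: (ae2_mono (aeP q)) => z Pz _ [<-].
Qed.

Lemma C1_gradient_at_min (phi px py : R * R -> R) z : C1_gradient phi px py ->
  (forall w, phi z <= phi w) -> px z = 0 /\ py z = 0.
Proof.
move=> [db _ _] zmin.
have N11 : -1 <= 1 :> R by lra.
have in0 : (0 : R) \in `]-1, 1[ by rewrite in_itv /=; apply/andP; split; lra.
have D (e1 e2 : R) : px z * e1 + py z * e2 = 0.
  have dl (k e t : R) : is_derive t 1 (fun t => k + t * e) e.
    by apply: is_derive_eq; rewrite /GRing.scale /=; ring.
  have dt t := @is_derive_curve _ phi (fun t => z.1 + t * e1)
    (fun t => z.2 + t * e2) t _ _ e1 e2 (db _) (dl z.1 e1 t) (dl z.2 e2 t).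
  have zE : (z.1 + 0 * e1, z.2 + 0 * e2) = z by rewrite !mul0r !addr0; case: (z).
  have le0 t : t \in `]-1, 1[ -> phi (z.1 + 0 * e1, z.2 + 0 * e2) <= phi (z.1 + t * e1, z.2 + t * e2).
    by rewrite zE.
  have [_ m] := @derive1_at_min _ (fun t => phi (z.1 + t * e1, z.2 + t * e2)) (-1) 1 0 N11
    (fun t _ => @ex_derive _ _ _ _ _ _ _ (dt t)) in0 le0.
  by have [_] := dt 0; rewrite m zE.
by have := D 1 0; have := D 0 1; rewrite !mulr1 !mulr0 addr0 add0r.
Qed.

(** On a box inside O, the definition of V and integration by parts give the
    same integrals against the bumps of every smaller box.  These bumps tend
    to indicators, so V and the classical gradient have the same integrals
    over boxes and agree almost everywhere.  Countably many boxes cover O. *)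
Lemma weak_gradient_ae U O (u p s : R * R -> R) (V : R * R -> R * R) :
  weak_gradient U u V -> open O -> O `<=` U ->
  (forall z, O z -> is_diff z u (fun v => p z * v.1 + s z * v.2)) ->
  (forall z, O z -> {for z, continuous p}) -> (forall z, O z -> {for z, continuous s}) ->
  {ae @mu2 R, forall z, O z -> V z = (p z, s z)}.
Proof.
move=> [mV1 mV2 lu [lV1 lV2] HV] oO OU du cp cs.
have Rsub (q : R * R * (R * R)) (g : R * R -> R) : cbox q `<=` U -> (forall z, ~ obox q z -> g z = 0) ->
    \int[@mu2 R]_(z in U) g z = \int[@mu2 R]_(z in cbox q) g z.
  move=> qU g0; rewrite Rintegral_mkcond [RHS]Rintegral_mkcond.
  congr (Rintegral _ _ _); apply/funext => z; rewrite !patchE.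
  have [zq|zq] := boolP (z \in cbox q).
    by rewrite mem_set//; apply: qU; rewrite inE in zq.
  case: ifP => // _; apply: g0 => zo; move/negP: zq; apply.
  by rewrite inE; exact: obox_cbox.
have box (q : R * R * (R * R)) : cbox q `<=` O ->
    {ae @mu2 R, forall z, obox q z -> V z = (p z, s z)}.
  move=> qO.
  have qU : cbox q `<=` U by exact: subset_trans qO OU.
  have core (W P : R * R -> R) : locally_integrable2 U W ->
    (forall z, O z -> {for z, continuous P}) ->
    (forall (a b c d : R) n, a <= b -> c <= d -> cbox ((a, b), (c, d)) `<=` cbox q ->
       \int[@mu2 R]_(z in cbox ((a, b), (c, d))) (P z * bump n ((a, b), (c, d)) z)
       = \int[@mu2 R]_(z in cbox ((a, b), (c, d))) (W z * bump n ((a, b), (c, d)) z)) ->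
    {ae @mu2 R, forall z, obox q z -> W z - P z = 0}.
    move=> lW cP HWP.
    have intW Q : cbox Q `<=` cbox q -> (@mu2 R).-integrable (cbox Q) (EFin \o W).
      by move=> Qq; apply: lW; [exact: compact_cbox|exact: subset_trans Qq qU].
    have intP Q : cbox Q `<=` cbox q -> (@mu2 R).-integrable (cbox Q) (EFin \o P).
      by move=> Qq; apply: (continuous_cbox_integrable oO cP); exact: subset_trans Qq qO.
    have intD Q : cbox Q `<=` cbox q -> (@mu2 R).-integrable (cbox Q) (EFin \o (fun z => W z - P z)).
      move=> Qq; have mQ : measurable (cbox Q : set (R1 * R1)) := measurable_cbox Q.
      exact: (integrableB mQ (intW Q Qq) (intP Q Qq)).
    apply: ae_eq0_on_box; first exact: intD.
    move=> a b c d ab cd Qq; set Q := ((a, b), (c, d)).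
    apply: bump_integral_limit; first exact: intD.
    move=> n; have mQ : measurable (cbox Q : set (R1 * R1)) := measurable_cbox Q.
    have mb : measurable_fun (cbox Q : set (R1 * R1)) (bump n Q).
      have [px [py [db _ _]]] := C1_bump n Q.
      apply: measurable_funTS; apply: open_continuous_measurable_plane; first exact: openT.
      by move=> z _; apply: differentiable_continuous; case: (db z).
    have bb : [bounded bump n Q x | x in (cbox Q : set (R1 * R1))].
      exists 1; split; rewrite ?num_real// => x x1 z _.
      by rewrite /= ger0_norm ?bump_ge0// (le_trans (bump_le1 _ _ _))// ltW.
    have i1 : (@mu2 R).-integrable (cbox Q) (EFin \o (fun z => W z * bump n Q z)).
      exact: (integrableMl mQ (intW Q Qq) mb bb).
    have i2 : (@mu2 R).-integrable (cbox Q) (EFin \o (fun z => P z * bump n Q z)).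
      exact: (integrableMl mQ (intP Q Qq) mb bb).
    have E := RintegralB mQ i1 i2.
    rewrite -HWP// subrr in E.
    have i3 : (@mu2 R).-integrable (cbox Q) (EFin \o (fun z => W z * bump n Q z - P z * bump n Q z)).
      exact: (integrableB mQ i1 i2).
    transitivity (\int[@mu2 R]_(z in cbox Q) (W z * bump n Q z - P z * bump n Q z)%:E)%E.
      by apply: eq_integral => z _; rewrite mulrBl.
    rewrite -[LHS]fineK; last exact: (integrable_fin_num mQ i3).
    by rewrite -/(Rintegral _ _ _) E.
  have ibp a b c d n (ab : a <= b) (cd : c <= d) (Qq : cbox ((a, b), (c, d)) `<=` cbox q) :
    let Q := ((a, b), (c, d)) in
    \int[@mu2 R]_(z in cbox Q) (p z * bump n Q z) = \int[@mu2 R]_(z in cbox Q) ((V z).1 * bump n Q z) /\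
    \int[@mu2 R]_(z in cbox Q) (s z * bump n Q z) = \int[@mu2 R]_(z in cbox Q) ((V z).2 * bump n Q z).
    move=> Q.
    have mQ : measurable (cbox Q : set (R1 * R1)) := measurable_cbox Q.
    have QO : cbox Q `<=` O by exact: subset_trans Qq qO.
    have QU : cbox Q `<=` U by exact: subset_trans QO OU.
    have [px [py Cb]] := C1_bump n Q.
    have [db cpx cpy] := Cb.
    have gE w : grad (bump n Q) w = (px w, py w).
      by rewrite /grad !(is_diff_derive _ (db w)) /= !mulr1 !mulr0 addr0 add0r.
    have g0 z : ~ obox Q z -> bump n Q z = 0 by exact: bump_out.
    have [HV1 HV2] := HV _ (bump_test_function n QU).
    have cu z : O z -> {for z, continuous u}.
      by move=> Oz; apply: differentiable_continuous; case: (du z Oz).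
    have cb : continuous (bump n Q) by move=> z; apply: differentiable_continuous; case: (db z).
    have [I1 I2] := box_integration_by_parts ab cd oO QO du cp cs Cb g0.
    (* off the open box the bump is at its minimum 0 *)
    have gz z : ~ obox Q z -> px z = 0 /\ py z = 0.
      move=> zQ; have bz : bump n Q z = 0 by exact: bump_out.
      by apply: (C1_gradient_at_min Cb) => w; rewrite bz bump_ge0.
    have i1 : (@mu2 R).-integrable (cbox Q) (EFin \o (fun z => u z * px z)).
      by apply: (continuous_cbox_integrable oO _ QO) => z Oz; apply: cvgM; [exact: cu|exact: cpx].
    have i2 : (@mu2 R).-integrable (cbox Q) (EFin \o (fun z => bump n Q z * p z)).
      by apply: (continuous_cbox_integrable oO _ QO) => z Oz; apply: cvgM; [exact: cb|exact: cp].
    have i3 : (@mu2 R).-integrable (cbox Q) (EFin \o (fun z => u z * py z)).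
      by apply: (continuous_cbox_integrable oO _ QO) => z Oz; apply: cvgM; [exact: cu|exact: cpy].
    have i4 : (@mu2 R).-integrable (cbox Q) (EFin \o (fun z => bump n Q z * s z)).
      by apply: (continuous_cbox_integrable oO _ QO) => z Oz; apply: cvgM; [exact: cb|exact: cs].
    have S1 : \int[@mu2 R]_(z in cbox Q) (u z * px z) + \int[@mu2 R]_(z in cbox Q) (bump n Q z * p z) = 0.
      by rewrite -RintegralD// /Rintegral I1.
    have S2 : \int[@mu2 R]_(z in cbox Q) (u z * py z) + \int[@mu2 R]_(z in cbox Q) (bump n Q z * s z) = 0.
      by rewrite -RintegralD// /Rintegral I2.
    have H1 : \int[@mu2 R]_(z in cbox Q) (u z * px z) = - \int[@mu2 R]_(z in cbox Q) ((V z).1 * bump n Q z).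
      rewrite -(Rsub Q (fun z => (V z).1 * bump n Q z) QU (fun z zQ => etrans (congr1 _ (g0 z zQ)) (mulr0 _))).
      rewrite -HV1 -(Rsub Q (fun z => u z * px z) QU (fun z zQ => etrans (congr1 _ (gz z zQ).1) (mulr0 _))).
      by apply: eq_Rintegral => z _; rewrite gE.
    have H2 : \int[@mu2 R]_(z in cbox Q) (u z * py z) = - \int[@mu2 R]_(z in cbox Q) ((V z).2 * bump n Q z).
      rewrite -(Rsub Q (fun z => (V z).2 * bump n Q z) QU (fun z zQ => etrans (congr1 _ (g0 z zQ)) (mulr0 _))).
      rewrite -HV2 -(Rsub Q (fun z => u z * py z) QU (fun z zQ => etrans (congr1 _ (gz z zQ).2) (mulr0 _))).
      by apply: eq_Rintegral => z _; rewrite gE.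
    split.
      have -> : \int[@mu2 R]_(z in cbox Q) (p z * bump n Q z) = \int[@mu2 R]_(z in cbox Q) (bump n Q z * p z).
        by apply: eq_Rintegral => z _; rewrite mulrC.
      by move/eqP: S1; rewrite H1 addrC subr_eq0 => /eqP.
    have -> : \int[@mu2 R]_(z in cbox Q) (s z * bump n Q z) = \int[@mu2 R]_(z in cbox Q) (bump n Q z * s z).
      by apply: eq_Rintegral => z _; rewrite mulrC.
    by move/eqP: S2; rewrite H2 addrC subr_eq0 => /eqP.
  have c1 : {ae @mu2 R, forall z, obox q z -> (V z).1 - p z = 0}.
    by apply: core => // a b c d n ab cd Qq; have [] := ibp a b c d n ab cd Qq.
  have c2 : {ae @mu2 R, forall z, obox q z -> (V z).2 - s z = 0}.
    by apply: core => // a b c d n ab cd Qq; have [] := ibp a b c d n ab cd Qq.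
  apply: (ae2_mono2 c1 c2) => z h1 h2 zq.
  move: (h1 zq) (h2 zq); case: (V z) => v1 v2 /=.
  by move=> /eqP; rewrite subr_eq0 => /eqP -> /eqP; rewrite subr_eq0 => /eqP ->.
pose P (q : rat * rat * (rat * rat)) z := cbox (@ratbox R q) `<=` O ->
  obox (@ratbox R q) z -> V z = (p z, s z).
have aeP q : {ae @mu2 R, forall z, P q z}.
  rewrite /P; have [qO|qO] := pselect (cbox (@ratbox R q) `<=` O).
    by apply: (ae2_mono (box _ qO)) => z bz _; exact: bz.
  exact: aeW.
apply: (ae2_mono (ae2_countable aeP)) => z Pz Oz.
have [q [qz qO]] := open_ratbox oO Oz.
exact: (Pz q qO qz).
Qed.
End WeakGradient.

(** * Zeros of holomorphic functions *)

Section IsolatedZeros.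
Context {R : realType}.
Local Notation lam := (@lebesgue_measure R).
Local Notation R1 := (measurableTypeR R).
Implicit Types (z w : R * R) (F : R * R -> R[i]).

Lemma is_diff_little (u L : R * R -> R) z (e : R) : 0 < e -> is_diff z u L ->
  \forall v \near (0 : R * R), `|u (z + v) - u z - L v| <= e * `|v|.
Proof.
move=> e0 [du Lu]; have /eqaddoP := diff_locally du.
move=> /(_ e e0); apply: filterS => v /=.
by rewrite -Lu !fctE /= (addrC v) opprD addrA.
Qed.

(** Near a zero F (z + v) is d v up to an error smaller than |d v|. *)
Lemma cderiv_isolated_zero F z d : cderiv F z d -> d != 0 -> F z = 0 ->
  \forall w \near z, F w = 0 -> w = z.
Proof.
move=> [d1 d2] dn0 Fz.
have d0 : 0 < cmod d by rewrite cmod_gt0.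
have e0 : 0 < cmod d / 4 by rewrite divr_gt0.
have H1 := is_diff_little e0 d1; have H2 := is_diff_little e0 d2.
have : \forall v \near (0 : R * R), F (z + v) = 0 -> v = 0.
  apply: filterS2 H1 H2 => v.
  rewrite Fz /= !subr0 => h1 h2 Fv; move: h1 h2; rewrite Fv /= !sub0r !normrN => h1 h2.
  have L1 : complex.Re (d * toC v) = complex.Re d * v.1 + - complex.Im d * v.2.
    by rewrite ReM /= mulNr.
  have L2' : complex.Im (d * toC v) = complex.Im d * v.1 + complex.Re d * v.2.
    by rewrite ImM /= addrC.
  have := cmod_le_ReIm (d * toC v); rewrite L1 L2' cmodM => h3.
  have h4 : cmod d * `|v| <= cmod d * cmod (toC v) by rewrite ler_pM2l// norm_le_cmod_toC.
  have h5 : cmod d * `|v| <= cmod d * `|v| / 2.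
    apply: (le_trans h4); apply: (le_trans h3); apply: (le_trans (lerD h1 h2)).
    by rewrite le_eqVlt; apply/orP; left; apply/eqP; field.
  have v0 : cmod d * `|v| <= 0 by lra.
  by apply/eqP; rewrite -normr_le0; rewrite pmulr_rle0 in v0.
move=> H; have H' : \forall w \near z, F (z + (w - z)) = 0 -> w - z = 0.
  have : (fun w => w - z) @ z --> (0 : R * R).
    by rewrite -[X in _ --> X](subrr z); apply: cvgB; [exact: cvg_id|exact: cvg_cst].
  by move=> /(_ _ H).
apply: filterS H' => w; rewrite addrC subrK => h /h /eqP.
by rewrite subr_eq0 => /eqP.
Qed.

Lemma mu2_set1 z : measurable ([set z] : set (R1 * R1)) /\ @mu2 R [set z] = 0%E.
Proof.
have -> : [set z] = [set z.1] `*` [set z.2].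
  by apply/seteqP; split => [w ->//|[a b] [/= -> ->]]; case: z.
split; first by apply: measurableX; exact: measurable_set1.
have -> : @mu2 R ([set z.1] `*` [set z.2]) = (lam [set z.1] * lam [set z.2])%E.
  by apply: (@product_measure1E _ _ R1 R1); exact: measurable_set1.
by rewrite lebesgue_measure_set1 mul0e.
Qed.

(** A zero with non-zero derivative is the only zero in some rational box, so
    there are countably many of them. *)
Lemma ae_simple_zeros F F' (O : set (R * R)) : open O ->
  (forall z, O z -> cderiv F z (F' z)) ->
  {ae @mu2 R, forall z, O z -> F z = 0 -> F' z = 0}.
Proof.
move=> oO dF.
(* P q excludes only the zero of F in the box q when it is the unique one there: at most one point *)
pose P (q : rat * rat * (rat * rat)) z :=
  obox (@ratbox R q) z -> F z = 0 -> ~ (forall w, cbox (@ratbox R q) w -> F w = 0 -> w = z).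
have aeP q : {ae @mu2 R, forall z, P q z}.
  have [[z0 z0P]|nz] := pselect (exists z, ~ P q z); last first.
    by apply: aeW => z; apply: contrapT => nP; apply: nz; exists z.
  have [mz0 z00] := mu2_set1 z0.
  exists [set z0]; split => // z /= nPz.
  move: nPz z0P => /not_implyP[zq /not_implyP[Fz /contrapT zu]] /not_implyP[z0q /not_implyP[Fz0 _]].
  by apply/esym/zu => //; exact: obox_cbox.
apply: (ae2_mono (ae2_countable aeP)) => z Pz Oz Fz.
apply/eqP/negPn/negP => F'z.
have iso := cderiv_isolated_zero (dF z Oz) F'z Fz.
have [q [qz qO]] := open_ratbox (open_interior _) iso.
by apply: (Pz q qz Fz) => w /qO wO; have := interior_subset wO.
Qed.
End IsolatedZeros.

(** * The modulus of a holomorphic function *)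

Section Modulus.
Context {R : realType}.
Implicit Types (z w : R * R) (F : R * R -> R[i]) (O : set (R * R)).

(** A version of C1_on that exhibits the partial derivatives p and s, so that
    the rules of calculus can be stated by formulas. *)
Definition C1_with O (u p s : R * R -> R) : Prop :=
  forall z, O z -> [/\ is_diff z u (fun v => p z * v.1 + s z * v.2),
    {for z, continuous p} & {for z, continuous s}].

Lemma C1_on_grad O u : C1_on O u -> C1_with O u (fun z => (grad u z).1) (fun z => (grad u z).2).
Proof.
move=> C1 z Oz; have [du c1 c2] := C1 z Oz; split; [|exact: c1|exact: c2].
split; first exact: du.
apply/funext => v; rewrite /grad /= !deriveE; [|exact: du|exact: du].
have {1}-> : v = v.1 *: (1, 0) + v.2 *: (0, 1).
  by case: v => a b; congr pair; rewrite /= /GRing.scale /= ?mulr1 ?mulr0 ?addr0 ?add0r.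
by rewrite linearD !linearZ /= /GRing.scale /= mulrC [X in _ + X]mulrC.
Qed.

Lemma C1_with_grad O u p s z : C1_with O u p s -> O z -> grad u z = (p z, s z).
Proof.
move=> C1 /C1[du _ _].
by rewrite /grad !(is_diff_derive _ du) /= !mulr1 !mulr0 addr0 add0r.
Qed.

Lemma C1_with_continuous O u p s : C1_with O u p s -> forall z, O z -> {for z, continuous u}.
Proof. by move=> C1 z /C1[[du _] _ _]; exact: differentiable_continuous. Qed.

Lemma C1_withM O u p s v q t : C1_with O u p s -> C1_with O v q t ->
  C1_with O (fun z => u z * v z) (fun z => u z * q z + v z * p z)
    (fun z => u z * t z + v z * s z).
Proof.
move=> C1 C2 z Oz; have [du cp cs] := C1 z Oz; have [dv cq ct] := C2 z Oz.
have cu := C1_with_continuous C1 Oz; have cv := C1_with_continuous C2 Oz.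
split; last 2 first.
- by apply: cvgD; apply: cvgM.
- by apply: cvgD; apply: cvgM.
apply: (is_diff_eq (is_diffM du dv)).
by apply/funext => x; rewrite !fctE /GRing.scale /=; ring.
Qed.

Lemma C1_withB O u p s v q t : C1_with O u p s -> C1_with O v q t ->
  C1_with O (fun z => u z - v z) (fun z => p z - q z) (fun z => s z - t z).
Proof.
move=> C1 C2 z Oz; have [du cp cs] := C1 z Oz; have [dv cq ct] := C2 z Oz.
split; [|exact: cvgB|exact: cvgB].
by apply: (is_diff_eq (is_diffB du dv)); apply/funext => x; rewrite !fctE; ring.
Qed.

Lemma C1_withD O u p s v q t : C1_with O u p s -> C1_with O v q t ->
  C1_with O (fun z => u z + v z) (fun z => p z + q z) (fun z => s z + t z).
Proof.
move=> C1 C2 z Oz; have [du cp cs] := C1 z Oz; have [dv cq ct] := C2 z Oz.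
split; [|exact: cvgD|exact: cvgD].
by apply: (is_diff_eq (is_diffD du dv)); apply/funext => x; rewrite !fctE; ring.
Qed.

Lemma C1_with_sqrt O u p s : (forall z, O z -> 0 < u z) -> C1_with O u p s ->
  C1_with O (fun z => Num.sqrt (u z)) (fun z => (2 * Num.sqrt (u z))^-1 * p z)
    (fun z => (2 * Num.sqrt (u z))^-1 * s z).
Proof.
move=> u0 C1 z Oz; have [du cp cs] := C1 z Oz; have uz := u0 z Oz.
have cu := C1_with_continuous C1 Oz.
have ci : {for z, continuous (fun z => (2 * Num.sqrt (u z))^-1)}.
  apply: cvgV; first by rewrite mulf_neq0// gt_eqF// sqrtr_gt0.
  apply: cvgM; first exact: cvg_cst.
  by apply: (@continuous_comp _ _ _ u Num.sqrt) => //; exact: sqrt_continuous.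
split; [|exact: cvgM|exact: cvgM].
have ds : is_diff (u z) Num.sqrt (fun x => x *: (2 * Num.sqrt (u z))^-1).
  have [d1 d2] := is_derive1_sqrt uz.
  split; first exact/derivable1_diffP.
  by apply/funext => x; rewrite diff1E ?derive1E ?d2//; exact/derivable1_diffP.
apply: (is_diff_eq (is_diff_comp du ds)).
by apply/funext => x; rewrite /= /GRing.scale /=; ring.
Qed.

Lemma C1_cmod O F p1 s1 p2 s2 : (forall z, O z -> F z != 0) ->
  C1_with O (fun z => complex.Re (F z)) p1 s1 -> C1_with O (fun z => complex.Im (F z)) p2 s2 ->
  C1_with O (fun z => cmod (F z))
   (fun z => (complex.Re (F z) * p1 z + complex.Im (F z) * p2 z) / cmod (F z))
   (fun z => (complex.Re (F z) * s1 z + complex.Im (F z) * s2 z) / cmod (F z)).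
Proof.
move=> F0 C1 C2.
have C := C1_with_sqrt (O := O) _ (C1_withD (C1_withM C1 C1) (C1_withM C2 C2)).
have E z : complex.Re (F z) * complex.Re (F z) + complex.Im (F z) * complex.Im (F z) = cmod (F z) ^+ 2.
  by rewrite cmod_sqr !expr2.
have {}C := C _; have /C {}C : forall z, O z -> 0 < complex.Re (F z) * complex.Re (F z) + complex.Im (F z) * complex.Im (F z).
  by move=> z Oz; rewrite E exprn_gt0// cmod_gt0 F0.
have D (a b c d x : R) : x != 0 -> (2 * x)^-1 * (a * b + a * b + (c * d + c * d)) = (a * b + c * d) / x.
  by move=> x0; field.
have S z : Num.sqrt (complex.Re (F z) * complex.Re (F z) + complex.Im (F z) * complex.Im (F z)) = cmod (F z).
  by rewrite E sqrtr_sqr ger0_norm// cmod_ge0.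
move: C; rewrite /C1_with => C z Oz; have [] := C z Oz.
under eq_fun do rewrite S.
have X (p q : R * R -> R) : (fun z => (2 * Num.sqrt (complex.Re (F z) * complex.Re (F z) + complex.Im (F z) * complex.Im (F z)))^-1 *
   (complex.Re (F z) * p z + complex.Re (F z) * p z + (complex.Im (F z) * q z + complex.Im (F z) * q z)))
   = (fun z => (complex.Re (F z) * p z + complex.Im (F z) * q z) / cmod (F z)).
  apply/funext => w; rewrite S.
  have [Fw|Fw] := eqVneq (cmod (F w)) 0; first by rewrite Fw mulr0 invr0 mulr0 mul0r.
  exact: D.
by rewrite !X /= S -!/(_ / _) !D// cmod_eq0 F0.
Qed.

(** The gradient of |F| is conj F times F' over |F|, as a complex number up to
    conjugation, so its norm is |F'|. *)
Lemma C1_cmod_holomorphic O F F' : (forall z, O z -> F z != 0) -> holomorphic O F F' ->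
  exists p s, C1_with O (fun z => cmod (F z)) p s /\
    forall z, O z -> p z ^+ 2 + s z ^+ 2 = cmod (F' z) ^+ 2.
Proof.
move=> F0 hF.
have C1 : C1_with O (fun z => complex.Re (F z)) (fun z => complex.Re (F' z)) (fun z => - complex.Im (F' z)).
  by move=> z /hF[[d1 d2] [c1 c2]]; split => //; apply: cvgN.
have C2 : C1_with O (fun z => complex.Im (F z)) (fun z => complex.Im (F' z)) (fun z => complex.Re (F' z)).
  by move=> z /hF[[d1 d2] [c1 c2]]; split.
have C := C1_cmod F0 C1 C2; do 2!eexists; split; first exact: C.
move=> z Oz; rewrite !expr_div_n !cmod_sqr.
have : cmod (F z) ^+ 2 != 0 by rewrite expf_neq0// cmod_eq0 F0.
by rewrite cmod_sqr => n0; field.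
Qed.

Lemma expi_onto (c : R[i]) : cmod c = 1 -> exists t : R, expi t = c.
Proof.
move=> c1; have c2 : complex.Re c ^+ 2 + complex.Im c ^+ 2 = 1 by rewrite -cmod_sqr c1 expr1n.
have cI : -1 <= complex.Re c <= 1.
  by have := Re_le_cmod c; rewrite c1 ler_norml.
have cc : cos (acos (complex.Re c)) = complex.Re c by rewrite acosK// in_itv.
have ss : sin (acos (complex.Re c)) = `|complex.Im c|.
  by rewrite sin_acos// -c2 addrC addKr sqrtr_sqr.
have [i0|i0] := leP 0 (complex.Im c).
  exists (acos (complex.Re c)); rewrite /expi cc ss ger0_norm//; by case: (c).
exists (- acos (complex.Re c)); rewrite /expi cosN sinN cc ss ltr0_norm// opprK; by case: (c).
Qed.

Lemma unit_alignment (c : R[i]) : exists t : R, expi t * c = (cmod c)%:C.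
Proof.
have [->|c0] := eqVneq c 0.
  by exists 0; rewrite mulr0 /cmod ComplexField.Normc.normc0.
have [t tE] : exists t : R, expi t = (cmod c)%:C / c.
  apply: expi_onto; rewrite cmodM cmodV cmod_real ger0_norm ?cmod_ge0// divff// cmod_eq0//.
by exists t; rewrite tE divfK.
Qed.
End Modulus.

(** * The derivative of a quotient *)

Section GradientOfQuotient.
Context {R : realType}.
Implicit Types (z w : R * R) (F : R * R -> R[i]) (A U O : set (R * R)).

Lemma is_diff_near_eq (u v L : R * R -> R) z : (\forall w \near z, u w = v w) ->
  is_diff z u L -> is_diff z v L.
Proof.
move=> uv du; have uvz := nbhs_singleton uv.
have /nbhs_ballP[e /= e0 eU] := uv.
have d0 : is_diff z (fun w => v w - u w) (fun v => 0 * v.1 + 0 * v.2).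
  apply: (@is_diff_quadratic _ _ _ _ _ 0 e) => // x xe.
  rewrite !mul0r addr0 subr0 -uvz subrr subr0.
  have -> : u (z + x) = v (z + x).
    by apply: eU; rewrite -ball_normE /ball_ /= opprD addNKr normrN.
  by rewrite subrr normr0.
have dv := is_diffD du d0.
have -> : v = u + (fun w => v w - u w) by apply/funext => w; rewrite !fctE addrC subrK.
by apply: (is_diff_eq dv); apply/funext => x; rewrite !fctE !mul0r !addr0.
Qed.

Lemma open_nonzero A F : open A -> (forall z, A z -> ccontinuous_at F z) ->
  open (A `&` [set z | F z != 0]).
Proof.
move=> oA cF; rewrite openE => z [Az Fz]; rewrite /interior.
apply: filterI; first exact: open_nbhs_nbhs.
have N0 : cmod (F z) ^+ 2 != 0 by rewrite expf_neq0// cmod_eq0.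
have nN : nbhs (cmod (F z) ^+ 2) [set x : R | x != 0].
  by apply: open_nbhs_nbhs; split => //; exact: open_neq.
have H : nbhs z ((fun w => cmod (F w) ^+ 2) @^-1` [set x | x != 0]) :=
  ccontinuous_cmod_sqr (cF z Az) nN.
apply: filterS H => w /=.
by apply: contra => /eqP ->; rewrite /cmod ComplexField.Normc.normc0 expr0n.
Qed.

(** B = |F1|, H = |h| and their gradients b, h; V is the gradient of B - B H.
    Solve for the gradient of H: h = ((1 - H) b - V) / B, where
    1 - H = (B - B H) / B; then bound b by Delta and B from below by delta. *)
Lemma quotient_gradient_arith (B H b1 b2 h1 h2 V1 V2 delta Delta : R) :
  0 < delta -> delta <= B -> b1 ^+ 2 + b2 ^+ 2 <= Delta ^+ 2 ->
  V1 = b1 - (B * h1 + H * b1) -> V2 = b2 - (B * h2 + H * b2) ->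
  h1 ^+ 2 + h2 ^+ 2 <= 2 / delta ^+ 2 * (V1 ^+ 2 + V2 ^+ 2) +
    2 * Delta ^+ 2 / delta ^+ 4 * (B - B * H) ^+ 2.
Proof.
move=> d0 dB bD V1E V2E.
have B0 : 0 < B by exact: lt_le_trans dB.
set k := 1 - H.
have h1E : h1 = (b1 * k - V1) / B by rewrite V1E /k; field; exact: lt0r_neq0.
have h2E : h2 = (b2 * k - V2) / B by rewrite V2E /k; field; exact: lt0r_neq0.
have step : h1 ^+ 2 + h2 ^+ 2 <= (2 * (V1 ^+ 2 + V2 ^+ 2) + 2 * Delta ^+ 2 * k ^+ 2) / B ^+ 2.
  rewrite h1E h2E !expr_div_n -mulrDl ler_pM2r ?invr_gt0 ?exprn_gt0//.
  have k2 : 0 <= k ^+ 2 by exact: sqr_ge0.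
  have m := ler_wpM2r k2 bD.
  have := sqr_ge0 (b1 * k + V1); have := sqr_ge0 (b2 * k + V2).
  by clear -m; clearbody k; lra.
apply: (le_trans step); rewrite mulrDl; apply: lerD.
  rewrite mulrAC ler_wpM2r ?addr_ge0 ?sqr_ge0// ler_wpM2l// lef_pV2 ?posrE ?exprn_gt0//.
  by rewrite ler_pXn2r ?nnegrE// ltW.
have -> : (B - B * H) ^+ 2 = B ^+ 2 * k ^+ 2 by rewrite /k; ring.
have -> : 2 * Delta ^+ 2 * k ^+ 2 / B ^+ 2 = 2 * Delta ^+ 2 * (B ^+ 2 * k ^+ 2) / B ^+ 4.
  by field; exact: lt0r_neq0.
rewrite [leRHS]mulrAC ler_wpM2l//; first by apply: mulr_ge0; [apply: mulr_ge0|apply: mulr_ge0]; rewrite ?sqr_ge0.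
rewrite lef_pV2 ?posrE ?exprn_gt0//.
by rewrite ler_pXn2r ?nnegrE// ltW.
Qed.

(** Off the zeros of h, |F1| - |F2| = |F1| (1 - |h|) is of class C^1 and V is
    its gradient almost everywhere.  At almost every zero of h the derivative
    h' vanishes. *)
Lemma quotient_derivative_le A U (F1 F2 h h' : R * R -> R[i]) (V : R * R -> R * R)
    (delta Delta : R) : open A -> A `<=` U -> 0 < delta ->
  C1_on A (fun z => complex.Re (F1 z)) -> C1_on A (fun z => complex.Im (F1 z)) ->
  (forall z, A z -> delta <= cmod (F1 z)) ->
  (forall z, A z -> differentiable (fun w => cmod (F1 w)) z ->
     enorm (grad (fun w => cmod (F1 w)) z) <= Delta) ->
  holomorphic A h h' -> (forall z, A z -> F2 z = F1 z * h z) ->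
  weak_gradient U (fun z => cmod (F1 z) - cmod (F2 z)) V ->
  {ae @mu2 R, forall z, A z -> cmod (h' z) ^+ 2 <=
     2 / delta ^+ 2 * enorm (V z) ^+ 2 +
     2 * Delta ^+ 2 / delta ^+ 4 * (cmod (F1 z) - cmod (F2 z)) ^+ 2}.
Proof.
move=> oA AU d0 CR CI dF gF hh F2E wV.
have ch z : A z -> ccontinuous_at h z by move=> /hh[/cderiv_ccontinuous].
have F10 z : A z -> F1 z != 0 by move=> /dF dFz; rewrite -cmod_gt0; exact: lt_le_trans dFz.
have CB := C1_cmod F10 (C1_on_grad CR) (C1_on_grad CI).
move: CB; set b1 := (fun z => _ / _); set b2 := (fun z => _ / _) => CB.
set O := A `&` [set z | h z != 0].
have oO : open O by exact: open_nonzero.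
have OA : O `<=` A by exact: subIsetl.
have OU : O `<=` U by exact: subset_trans OA AU.
have hO : holomorphic O h h' by move=> z /OA; exact: hh.
have [h1 [h2 [CH hE]]] := C1_cmod_holomorphic (fun z (Oz : O z) => Oz.2) hO.
have CBO : C1_with O (fun z => cmod (F1 z)) b1 b2 by move=> z /OA; exact: CB.
have Cu := C1_withB CBO (C1_withM CBO CH).
have uE : forall z, O z -> \forall w \near z, cmod (F1 w) - cmod (F1 w) * cmod (h w) = cmod (F1 w) - cmod (F2 w).
  move=> z Oz; have : nbhs z O by exact: open_nbhs_nbhs.
  by apply: filterS => w [Aw _]; rewrite F2E// cmodM.
have aeV := weak_gradient_ae wV oO OU
  (fun z Oz => is_diff_near_eq (uE z Oz) (let: And3 d _ _ := Cu z Oz in d))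
  (fun z Oz => let: And3 _ c _ := Cu z Oz in c) (fun z Oz => let: And3 _ _ c := Cu z Oz in c).
have aeZ := ae_simple_zeros oA (fun z Az => (hh z Az).1).
apply: (ae2_mono2 aeV aeZ) => z Vz Zz Az.
have [hz|hz] := eqVneq (h z) 0.
  rewrite (Zz Az hz) /cmod ComplexField.Normc.normc0 expr0n /=.
  have p2 : 0 <= 2 / delta ^+ 2 by rewrite divr_ge0 ?sqr_ge0.
  apply: addr_ge0; apply: mulr_ge0; rewrite ?sqr_ge0//.
  by rewrite divr_ge0 ?exprn_even_ge0// mulr_ge0// sqr_ge0.
have Oz : O z by split.
rewrite -(hE z Oz) F2E// cmodM.
have eE (v : R * R) : enorm v ^+ 2 = v.1 ^+ 2 + v.2 ^+ 2.
  by rewrite sqr_sqrtr// addr_ge0 ?sqr_ge0.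
rewrite eE; have VE := Vz Oz.
apply: (quotient_gradient_arith d0 (dF z Az) (b1 := b1 z) (b2 := b2 z)); [|by rewrite VE|by rewrite VE].
have dB : differentiable (fun w => cmod (F1 w)) z by have [[]] := CB z Az.
have := gF z Az dB; rewrite (C1_with_grad CB Az) => gD.
have -> : b1 z ^+ 2 + b2 z ^+ 2 = enorm (b1 z, b2 z) ^+ 2 by rewrite eE.
have e0 : 0 <= enorm (b1 z, b2 z) by exact: sqrtr_ge0.
by rewrite ler_pXn2r ?nnegrE//; exact: le_trans gD.
Qed.
End GradientOfQuotient.

(** * Alignment of phases on an annulus *)

Section AnnulusAlignment.
Context {R : realType}.
Local Notation R1 := (measurableTypeR R).
Implicit Types (z w : R * R) (F : R * R -> R[i]) (A U O : set (R * R)).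

Lemma integral_le_lin A (f g k : R * R -> R) (a b : R) :
  measurable (A : set (R1 * R1)) -> 0 <= a -> 0 <= b ->
  measurable_fun (A : set (R1 * R1)) f -> measurable_fun (A : set (R1 * R1)) g ->
  measurable_fun (A : set (R1 * R1)) k ->
  (forall z, 0 <= f z) -> (forall z, 0 <= g z) -> (forall z, 0 <= k z) ->
  {ae @mu2 R, forall z, A z -> f z <= a * g z + b * k z} ->
  (\int[@mu2 R]_(z in A) (f z)%:E <=
   a%:E * \int[@mu2 R]_(z in A) (g z)%:E + b%:E * \int[@mu2 R]_(z in A) (k z)%:E)%E.
Proof.
move=> mA a0 b0 mf mg mk f0 g0 k0 H.
have g0' z : (0 <= (g z)%:E)%E by rewrite lee_fin.
have k0' z : (0 <= (k z)%:E)%E by rewrite lee_fin.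
have mg' : measurable_fun (A : set (R1 * R1)) (EFin \o g) by exact/measurable_EFinP.
have mk' : measurable_fun (A : set (R1 * R1)) (EFin \o k) by exact/measurable_EFinP.
have mag : measurable_fun (A : set (R1 * R1)) (fun z => a%:E * (g z)%:E)%E by exact: measurable_funeM.
have mbk : measurable_fun (A : set (R1 * R1)) (fun z => b%:E * (k z)%:E)%E by exact: measurable_funeM.
have ag0 z : A z -> (0 <= a%:E * (g z)%:E)%E by rewrite mule_ge0// lee_fin.
have bk0 z : A z -> (0 <= b%:E * (k z)%:E)%E by rewrite mule_ge0// lee_fin.
rewrite -(@ge0_integralZl_EFin _ (R1 * R1)%type R (@mu2 R) A mA _ (fun z _ => g0' z) mg' a a0).
rewrite -(@ge0_integralZl_EFin _ (R1 * R1)%type R (@mu2 R) A mA _ (fun z _ => k0' z) mk' b b0).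
rewrite -(@ge0_integralD _ (R1 * R1)%type R (@mu2 R) A mA _ _ ag0 mag bk0 mbk).
apply: (@ae_ge0_le_integral _ (R1 * R1)%type R (@mu2 R)) => //.
- by move=> z _; rewrite lee_fin.
- exact/measurable_EFinP.
- by move=> z Az; rewrite adde_ge0// ?ag0 ?bk0.
- exact: emeasurable_funD.
Qed.

(** Since e^(it) c = |c|,
      1 - e^(it) h = (1 - |h|) + (|h| - |c|) - e^(it) (h - c),
    and | |h| - |c| | <= |h - c|. *)
Lemma alignment_pointwise (a b h c : R[i]) (t delta Delta : R) :
  0 < delta -> delta <= cmod a <= Delta -> b = a * h -> expi t * c = (cmod c)%:C ->
  cmod (a - expi t * b) ^+ 2 <=
    8 * Delta ^+ 2 * cmod (h - c) ^+ 2 + 2 * Delta ^+ 2 / delta ^+ 2 * (cmod a - cmod b) ^+ 2.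
Proof.
move=> d0 /andP[da aD] bE tE.
have a0 : 0 < cmod a by exact: lt_le_trans da.
have ha : cmod b = cmod a * cmod h by rewrite bE cmodM.
have -> : a - expi t * b = a * (1 - expi t * h) by rewrite bE; ring.
rewrite cmodM exprMn.
(* rounding |h| to |c| and h to c costs |h - c| each *)
have k1 : cmod (1 - expi t * h) <= `|1 - cmod h| + 2 * cmod (h - c).
  have -> : 1 - expi t * h = (1 - cmod c)%:C - expi t * (h - c).
    by rewrite mulrBr tE rmorphB /=; ring.
  apply: (le_trans (cmodB _ _)); rewrite cmod_real cmodM cmod_expi mul1r mulr2n mulrDl mul1r addrA lerD2r.
  have -> : 1 - cmod c = (1 - cmod h) + (cmod h - cmod c) by ring.
  apply: (le_trans (ler_normD _ _)); rewrite lerD2l ler_norml.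
  have := cmodD (h - c) c; rewrite subrK => h1.
  have := cmodB h (h - c); rewrite opprB addrC subrK => h2.
  by apply/andP; split; lra.
have k2 : cmod (1 - expi t * h) ^+ 2 <= 2 * (1 - cmod h) ^+ 2 + 8 * cmod (h - c) ^+ 2.
  have x0 := cmod_ge0 (1 - expi t * h).
  apply: (@le_trans _ _ ((`|1 - cmod h| + 2 * cmod (h - c)) ^+ 2)).
    by rewrite ler_pXn2r ?nnegrE//; exact: le_trans k1.
  rewrite -[in leRHS](real_normK (num_real (1 - cmod h))).
  have := sqr_ge0 (`|1 - cmod h| - 2 * cmod (h - c)); clear; lra.
have -> : cmod a - cmod b = cmod a * (1 - cmod h) by rewrite ha; ring.
have aD2 : cmod a ^+ 2 <= Delta ^+ 2 by rewrite ler_pXn2r ?nnegrE//; rewrite ltW//; exact: lt_le_trans aD.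
have da2 : 1 <= cmod a ^+ 2 / delta ^+ 2.
  by rewrite ler_pdivlMr ?exprn_gt0// mul1r ler_pXn2r ?nnegrE// ltW.
apply: (le_trans (ler_wpM2r (sqr_ge0 _) aD2)).
apply: (le_trans (ler_wpM2l (sqr_ge0 _) k2)).
rewrite mulrDr addrC; apply: lerD; first by rewrite mulrA (mulrC _ 8).
have -> : 2 * Delta ^+ 2 / delta ^+ 2 * (cmod a * (1 - cmod h)) ^+ 2 =
  (cmod a ^+ 2 / delta ^+ 2) * (Delta ^+ 2 * (2 * (1 - cmod h) ^+ 2)) by field; exact: lt0r_neq0.
by apply: ler_peMl => //; apply: mulr_ge0; [|apply: mulr_ge0]; rewrite ?sqr_ge0.
Qed.

Lemma ereal_lin_le (a b c d K : R) (x y : \bar R) : 0 <= a -> 0 <= b -> 0 <= c -> 0 <= d ->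
  (0 <= x)%E -> (0 <= y)%E -> a * b <= K -> a * c + d <= K ->
  (a%:E * (b%:E * y + c%:E * x) + d%:E * x <= K%:E * (x + y))%E.
Proof.
move=> a0 b0 c0 d0 x0 y0 h1 h2.
rewrite ge0_muleDr ?mule_ge0 ?lee_fin// !muleA -!EFinM -addeA.
rewrite -ge0_muleDl ?lee_fin ?mulr_ge0// -EFinD ge0_muleDr// addeC.
by apply: leeD; apply: lee_wpmul2r; rewrite ?lee_fin.
Qed.

(** The phase t aligns the circle mean c of h.  The pointwise estimate, the
    Poincare inequality for h and the bound on h' combine: 64 pi^2 S^2 is
    8 (2 pi S)^2 times 2, the factor 2 from the bound on h'. *)
Lemma annulus_alignment U (F1 F2 h h' : R * R -> R[i]) (V : R * R -> R * R) z0
    (r S delta Delta : R) : let A := annulus z0 r S in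
  0 <= r -> r < S -> open U -> A `<=` U -> 0 < delta <= Delta ->
  C1_on A (fun z => complex.Re (F1 z)) -> C1_on A (fun z => complex.Im (F1 z)) ->
  (forall z, A z -> delta <= cmod (F1 z) <= Delta) ->
  (forall z, A z -> differentiable (fun w => cmod (F1 w)) z ->
     enorm (grad (fun w => cmod (F1 w)) z) <= Delta) ->
  holomorphic A h h' -> (forall z, A z -> F2 z = F1 z * h z) ->
  weak_gradient U (fun z => cmod (F1 z) - cmod (F2 z)) V ->
  exists t : R,
  (\int[@mu2 R]_(z in A) (cmod (F1 z - expi t * F2 z) ^+ 2)%:E <=
   (Delta ^+ 4 / delta ^+ 4 * (64 * pi ^+ 2 * S ^+ 2 + 2))%:E *
   (\int[@mu2 R]_(z in A) ((cmod (F1 z) - cmod (F2 z)) ^+ 2)%:E +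
    \int[@mu2 R]_(z in A) (enorm (V z) ^+ 2)%:E))%E.
Proof.
move=> A r0 rS oU AU /andP[d0 dD] CR CI bF gF hh F2E wV.
have oA : open A by exact: open_annulus.
have mA : measurable (A : set (R1 * R1)) by exact: open_measurable_plane.
have [c Hc] := annulus_poincare r0 rS hh.
have [t tE] := unit_alignment c; exists t.
have [mV1 mV2 _ _ _] := wV.
have cF1 z : A z -> ccontinuous_at F1 z.
  by move=> Az; split; apply: differentiable_continuous; [have [] := CR z Az|have [] := CI z Az].
have ch z : A z -> ccontinuous_at h z by move=> /hh[/cderiv_ccontinuous].
have ch' z : A z -> ccontinuous_at h' z by move=> /hh[].
have eE (v : R * R) : enorm v ^+ 2 = v.1 ^+ 2 + v.2 ^+ 2.
  by rewrite sqr_sqrtr// addr_ge0 ?sqr_ge0.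
have mV : measurable_fun (A : set (R1 * R1)) (fun z => enorm (V z) ^+ 2).
  have -> : (fun z => enorm (V z) ^+ 2) = (fun z => (V z).1 ^+ 2 + (V z).2 ^+ 2).
    by apply/funext => z; rewrite eE.
  have mU : measurable (U : set (R1 * R1)) by exact: open_measurable_plane.
  have m1 := measurable_funS mU AU mV1; have m2 := measurable_funS mU AU mV2.
  by apply: measurable_funD; exact: measurable_funX.
have mF2 : {in A, (fun z => cmod (F1 z) * cmod (h z)) =1 (fun z => cmod (F2 z))}.
  by move=> z; rewrite inE => Az; rewrite F2E// cmodM.
have ccm F z : ccontinuous_at F z -> {for z, continuous (fun w => cmod (F w))}.
  move=> cF; have -> : (fun w => cmod (F w)) = (fun w => Num.sqrt (cmod (F w) ^+ 2)).
    by apply/funext => w; rewrite sqrtr_sqr ger0_norm// cmod_ge0.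
  apply: (@continuous_comp _ _ _ (fun w => cmod (F w) ^+ 2) Num.sqrt); last exact: sqrt_continuous.
  exact: ccontinuous_cmod_sqr.
have mu : measurable_fun (A : set (R1 * R1)) (fun z => (cmod (F1 z) - cmod (F2 z)) ^+ 2).
  apply: (@eq_measurable_fun _ _ (R1 * R1)%type R1 A (fun z => (cmod (F1 z) - cmod (F1 z) * cmod (h z)) ^+ 2)).
    by move=> z zA; rewrite mF2.
  apply: open_continuous_measurable_plane => // z Az.
  apply: (@continuous_comp _ _ _ (fun z => cmod (F1 z) - cmod (F1 z) * cmod (h z)) (fun x => x ^+ 2)); last exact: exprn_continuous.
  by apply: cvgB; [|apply: cvgM]; apply: ccm; [exact: cF1|exact: cF1|exact: ch].
have mh' : measurable_fun (A : set (R1 * R1)) (fun z => cmod (h' z) ^+ 2).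
  by apply: open_continuous_measurable_plane => // z Az; apply: ccontinuous_cmod_sqr; exact: ch'.
have mhc : measurable_fun (A : set (R1 * R1)) (fun z => cmod (h z - c) ^+ 2).
  by apply: open_continuous_measurable_plane => // z Az; apply/ccontinuous_cmod_sqr/ccontinuousB; exact: ch.
have mD : measurable_fun (A : set (R1 * R1)) (fun z => cmod (F1 z - expi t * F2 z) ^+ 2).
  apply: (@eq_measurable_fun _ _ (R1 * R1)%type R1 A (fun z => cmod (F1 z * (1 + - expi t * h z)) ^+ 2)).
    by move=> z; rewrite inE => Az; rewrite F2E//; congr (cmod _ ^+ 2); ring.
  apply: open_continuous_measurable_plane => // z Az.
  apply: ccontinuous_cmod_sqr; apply: ccontinuousM; first exact: cF1.
  have [h1 h2] := ccontinuousM (cderiv_ccontinuous (cderiv_cst (- expi t) z)) (ch z Az).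
  split.
    rewrite (_ : (fun w => _) = (fun w => 1 + complex.Re (- expi t * h w))).
      by apply: cvgD => //; exact: cvg_cst.
    by apply/funext => w; rewrite ReD.
  rewrite (_ : (fun w => _) = (fun w => 0 + complex.Im (- expi t * h w))).
    by apply: cvgD => //; exact: cvg_cst.
  by apply/funext => w; rewrite ImD.
have sq (F : R * R -> R) z : 0 <= F z ^+ 2 by exact: sqr_ge0.
set IU := (X in (_ * (X + _))%E).
set IV := (X in (_ * (_ + X))%E).
have IU0 : (0 <= IU)%E by apply: integral_ge0 => z _; rewrite lee_fin sqr_ge0.
have IV0 : (0 <= IV)%E by apply: integral_ge0 => z _; rewrite lee_fin sqr_ge0.
have D0 : 0 < Delta by exact: lt_le_trans dD.
have Dd : 1 <= Delta ^+ 2 / delta ^+ 2.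
  by rewrite ler_pdivlMr ?exprn_gt0// mul1r ler_pXn2r ?nnegrE// ltW.
have D2 : 0 <= Delta ^+ 2 by exact: sqr_ge0.
have e2 : 0 <= (delta ^+ 2)^-1 by rewrite invr_ge0 sqr_ge0.
have e4 : 0 <= (delta ^+ 4)^-1 by rewrite invr_ge0 exprn_ge0// ltW.
have p1 : 0 <= 8 * Delta ^+ 2 by exact: mulr_ge0.
have p2 : 0 <= 2 * Delta ^+ 2 / delta ^+ 2 by apply: mulr_ge0; [exact: mulr_ge0|exact: e2].
have p3 : 0 <= 2 / delta ^+ 2 by exact: mulr_ge0.
have p4 : 0 <= 2 * Delta ^+ 2 / delta ^+ 4 by apply: mulr_ge0; [exact: mulr_ge0|exact: e4].
have p5 : 0 <= 8 * Delta ^+ 2 * (2 * pi * S) ^+ 2 by apply: mulr_ge0; [exact: p1|exact: sqr_ge0].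
have p6 : 0 <= 64 * pi ^+ 2 * S ^+ 2 by apply: mulr_ge0; [apply: mulr_ge0|]; rewrite ?sqr_ge0.
have p7 : 0 <= Delta ^+ 2 / delta ^+ 2 by exact: mulr_ge0.
have s1 : (\int[@mu2 R]_(z in A) (cmod (F1 z - expi t * F2 z) ^+ 2)%:E <=
   (8 * Delta ^+ 2)%:E * \int[@mu2 R]_(z in A) (cmod (h z - c) ^+ 2)%:E +
   (2 * Delta ^+ 2 / delta ^+ 2)%:E * IU)%E.
  apply: (integral_le_lin mA p1 p2 mD mhc mu (fun=> sqr_ge0 _) (fun=> sqr_ge0 _) (fun=> sqr_ge0 _)).
  apply: aeW => z Az; exact: (alignment_pointwise d0 (bF z Az) (F2E z Az) tE).
have s2 : (\int[@mu2 R]_(z in A) (cmod (h' z) ^+ 2)%:E <=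
   (2 / delta ^+ 2)%:E * IV + (2 * Delta ^+ 2 / delta ^+ 4)%:E * IU)%E.
  apply: (integral_le_lin mA p3 p4 mh' mV mu (fun=> sqr_ge0 _) (fun=> sqr_ge0 _) (fun=> sqr_ge0 _)).
  exact: (quotient_derivative_le oA AU d0 CR CI (fun z Az => (andP (bF z Az)).1) gF hh F2E wV).
apply: (le_trans s1).
have s3 : ((8 * Delta ^+ 2)%:E * \int[@mu2 R]_(z in A) (cmod (h z - c) ^+ 2)%:E <=
    (8 * Delta ^+ 2 * (2 * pi * S) ^+ 2)%:E * ((2 / delta ^+ 2)%:E * IV + (2 * Delta ^+ 2 / delta ^+ 4)%:E * IU))%E.
  rewrite [in leRHS]EFinM -muleA; apply: lee_wpmul2l; first by rewrite lee_fin mulr_ge0// sqr_ge0.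
  apply: (le_trans Hc); apply: lee_wpmul2l => //; by rewrite lee_fin sqr_ge0.
apply: (le_trans (leeD s3 (lexx _))).
(* Delta / delta >= 1, so that all powers of it are dominated by the fourth *)
have DD : Delta ^+ 2 / delta ^+ 2 <= Delta ^+ 4 / delta ^+ 4.
  have -> : Delta ^+ 4 / delta ^+ 4 = (Delta ^+ 2 / delta ^+ 2) * (Delta ^+ 2 / delta ^+ 2) by field; exact: lt0r_neq0.
  exact: ler_peMl.
apply: (ereal_lin_le p5 p3 p4 p2 IU0 IV0).
  have -> : 8 * Delta ^+ 2 * (2 * pi * S) ^+ 2 * (2 / delta ^+ 2) =
     Delta ^+ 2 / delta ^+ 2 * (64 * pi ^+ 2 * S ^+ 2) by field; exact: lt0r_neq0.
  by apply: ler_pM => //; rewrite lerDl.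
have -> : 8 * Delta ^+ 2 * (2 * pi * S) ^+ 2 * (2 * Delta ^+ 2 / delta ^+ 4) =
   Delta ^+ 4 / delta ^+ 4 * (64 * pi ^+ 2 * S ^+ 2) by field; exact: lt0r_neq0.
by rewrite mulrDr lerD2l [leRHS]mulrC -mulrA ler_wpM2l.
Qed.
End AnnulusAlignment.

(** * Integrals of complex-valued functions *)

Section ComplexIntegral.
Context {R : realType} {d : measure_display} {T : measurableType d}.
Variable mu : {measure set T -> \bar R}.
Implicit Types (D : set T) (f g : T -> R[i]) (k : T -> R).

Definition cmeasurable D g : Prop :=
  measurable_fun D (fun t => complex.Re (g t)) /\
  measurable_fun D (fun t => complex.Im (g t)).

Definition cintegrable D g : Prop :=
  mu.-integrable D (EFin \o (fun t => complex.Re (g t))) /\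
  mu.-integrable D (EFin \o (fun t => complex.Im (g t))).

Lemma cmeasurableM D f g : cmeasurable D f -> cmeasurable D g ->
  cmeasurable D (fun t => f t * g t).
Proof.
move=> [f1 f2] [g1 g2]; split.
  rewrite (_ : (fun t => _) = (fun t => complex.Re (f t) * complex.Re (g t) - complex.Im (f t) * complex.Im (g t))).
    by apply: measurable_funB; exact: measurable_funM.
  by apply/funext => t; rewrite ReM.
rewrite (_ : (fun t => _) = (fun t => complex.Re (f t) * complex.Im (g t) + complex.Im (f t) * complex.Re (g t))).
  by apply: measurable_funD; exact: measurable_funM.
by apply/funext => t; rewrite ImM.
Qed.

Lemma cmeasurable_cst D (c : R[i]) : cmeasurable D (fun=> c).
Proof. by split; exact: measurable_cst. Qed.

Lemma cmeasurableX D g n : cmeasurable D g -> cmeasurable D (fun t => g t ^+ n).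
Proof.
move=> mg; elim: n => [|n IH].
  rewrite (_ : (fun t => _) = (fun=> 1)); first exact: cmeasurable_cst.
  by apply/funext => t; rewrite expr0.
rewrite (_ : (fun t => _) = (fun t => g t * g t ^+ n)); first exact: cmeasurableM.
by apply/funext => t; rewrite exprS.
Qed.

Lemma cmeasurable_conj D g : cmeasurable D g -> cmeasurable D (fun t => conjc (g t)).
Proof.
move=> [g1 g2]; split.
  by rewrite (_ : (fun t => _) = (fun t => complex.Re (g t)))//; apply/funext => t; case: (g t).
rewrite (_ : (fun t => _) = (fun t => - complex.Im (g t))); first exact: measurableT_comp.
by apply/funext => t; case: (g t).
Qed.

Lemma cmeasurableB D f g : cmeasurable D f -> cmeasurable D g ->
  cmeasurable D (fun t => f t - g t).
Proof.
move=> [f1 f2] [g1 g2]; split.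
  rewrite (_ : (fun t => _) = (fun t => complex.Re (f t) - complex.Re (g t))); first exact: measurable_funB.
  by apply/funext => t; rewrite ReB.
rewrite (_ : (fun t => _) = (fun t => complex.Im (f t) - complex.Im (g t))); first exact: measurable_funB.
by apply/funext => t; rewrite ImB.
Qed.

Lemma measurable_cmod D g : measurable D -> cmeasurable D g -> measurable_fun D (fun t => cmod (g t)).
Proof.
move=> mD [g1 g2].
rewrite (_ : (fun t => _) = (fun t => Num.sqrt (complex.Re (g t) ^+ 2 + complex.Im (g t) ^+ 2))).
  apply: (@measurableT_comp _ _ _ _ _ _ (@Num.sqrt R)).
    by apply: continuous_measurable_fun; exact: sqrt_continuous.
  by apply: measurable_funD; exact: measurable_funX.
by apply/funext => t; rewrite cmodE.
Qed.

Lemma cintegrable_le D g k : measurable D -> cmeasurable D g ->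
  mu.-integrable D (EFin \o k) ->
  (forall t, D t -> cmod (g t) <= k t) -> cintegrable D g.
Proof.
move=> mD [g1 g2] ik gk; split.
  apply: (le_integrable mD _ _ ik); first exact/measurable_EFinP.
  move=> t Dt; rewrite /= lee_fin; apply: (le_trans (Re_le_cmod _)).
  by apply: (le_trans (gk t Dt)); exact: ler_norm.
apply: (le_integrable mD _ _ ik); first exact/measurable_EFinP.
move=> t Dt; rewrite /= lee_fin; apply: (le_trans (Im_le_cmod _)).
by apply: (le_trans (gk t Dt)); exact: ler_norm.
Qed.

Lemma cintegralB D f g : measurable D -> cintegrable D f -> cintegrable D g ->
  cintegral mu D (fun t => f t - g t) = cintegral mu D f - cintegral mu D g.
Proof.
move=> mD [f1 f2] [g1 g2]; rewrite /cintegral; congr Complex.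
  by rewrite -RintegralB//; apply: eq_Rintegral => t _; rewrite ReB.
by rewrite -RintegralB//; apply: eq_Rintegral => t _; rewrite ImB.
Qed.

Lemma cintegralZ D g (c : R[i]) : measurable D -> cintegrable D g ->
  cintegral mu D (fun t => c * g t) = c * cintegral mu D g.
Proof.
move=> mD [g1 g2]; rewrite /cintegral.
have iZ a u : mu.-integrable D (EFin \o u) -> mu.-integrable D (EFin \o (fun t => a * u t)).
  by move=> iu; exact: (integrableZl mD a iu).
apply/eqP; rewrite eq_complex ReM ImM /=; apply/andP; split; apply/eqP.
  by rewrite -!RintegralZl// -RintegralB ?iZ//; apply: eq_Rintegral => t _; rewrite ReM.
by rewrite -!RintegralZl// -RintegralD ?iZ//; apply: eq_Rintegral => t _; rewrite ImM.
Qed.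

Lemma cintegrableB D f g : measurable D -> cintegrable D f -> cintegrable D g ->
  cintegrable D (fun t => f t - g t).
Proof.
move=> mD [f1 f2] [g1 g2]; split.
  rewrite (_ : _ \o _ = (EFin \o (fun t => complex.Re (f t))) \- (EFin \o (fun t => complex.Re (g t))))%E.
    exact: integrableB.
  by apply/funext => t /=; rewrite ReB.
rewrite (_ : _ \o _ = (EFin \o (fun t => complex.Im (f t))) \- (EFin \o (fun t => complex.Im (g t))))%E.
  exact: integrableB.
by apply/funext => t /=; rewrite ImB.
Qed.

Lemma cintegrableZ D g (c : R[i]) : measurable D -> cintegrable D g ->
  cintegrable D (fun t => c * g t).
Proof.
move=> mD [g1 g2].
have iZ a u : mu.-integrable D (EFin \o u) -> mu.-integrable D (EFin \o (fun t => a * u t)).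
  by move=> iu; exact: (integrableZl mD a iu).
split.
  rewrite (_ : _ \o _ = (EFin \o (fun t => (complex.Re c * complex.Re (g t))%R)) \- (EFin \o (fun t => (complex.Im c * complex.Im (g t))%R)))%E.
    by apply: integrableB => //; exact: iZ.
  by apply/funext => t /=; rewrite ReM.
rewrite (_ : _ \o _ = (EFin \o (fun t => (complex.Re c * complex.Im (g t))%R)) \+ (EFin \o (fun t => (complex.Im c * complex.Re (g t))%R)))%E.
  by apply: integrableD => //; exact: iZ.
by apply/funext => t /=; rewrite ImM.
Qed.

(** The factor 2 comes from treating the real and the imaginary part
    separately. *)
Lemma cmod_cintegral_le D g k : measurable D -> cmeasurable D g ->
  mu.-integrable D (EFin \o k) -> (forall t, D t -> cmod (g t) <= k t) ->
  cmod (cintegral mu D g) <= 2 * \int[mu]_(t in D) k t.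
Proof.
move=> mD mg ik gk; have [i1 i2] := cintegrable_le mD mg ik gk.
apply: (le_trans (cmod_le_ReIm _)) => /=; rewrite mulr2n mulrDl mul1r; apply: lerD.
  apply: (le_trans (le_normr_Rintegral mD i1)); apply: le_Rintegral => //; first exact: (integrable_norm i1).
  by move=> t Dt; exact: le_trans (Re_le_cmod _) (gk t Dt).
apply: (le_trans (le_normr_Rintegral mD i2)); apply: le_Rintegral => //; first exact: (integrable_norm i2).
by move=> t Dt; exact: le_trans (Im_le_cmod _) (gk t Dt).
Qed.

Lemma ge0_integrable_lty D k : measurable_fun D k -> (forall t, 0 <= k t) ->
  (\int[mu]_(t in D) (k t)%:E < +oo)%E -> mu.-integrable D (EFin \o k).
Proof.
move=> mk k0 ky; apply/integrableP; split; first exact/measurable_EFinP.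
by rewrite (eq_integral (fun t => (k t)%:E)) // => t _ /=; rewrite ger0_norm.
Qed.

Lemma Lp_norm2E D (u : T -> R) : measurable D ->
  Lp_norm mu 2%:E D u = sqrte (\int[mu]_(t in D) (u t ^+ 2)%:E)%E.
Proof.
move=> mD; rewrite /Lp_norm unlock /= [in RHS]integral_mkcond.
rewrite poweR12_sqrt; last by apply: integral_ge0 => t _; exact: poweR_ge0.
congr sqrte; apply: eq_integral => t _.
rewrite !patchE; case: ifP => _ /=; last by rewrite normr0 powR0.
by rewrite powR_mulrn// real_normK// num_real.
Qed.

Lemma sqrte_lty (x : \bar R) : (sqrte x < +oo)%E -> (x < +oo)%E.
Proof. by case: x => // r _; exact: ltry. Qed.

End ComplexIntegral.

(** * Cauchy integrals *)

Section CauchyKernel.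
Context {R : realType}.
Local Notation lam := (@lebesgue_measure R).
Implicit Types (f : R -> R[i]) (z : R * R).

Lemma L2_cmeasurable f : L2 f -> cmeasurable setT f.
Proof. by case. Qed.

Lemma L2_integrable f : L2 f -> lam.-integrable setT (EFin \o (fun t => cmod (f t) ^+ 2)).
Proof.
move=> [f1 f2 fy]; apply: ge0_integrable_lty.
- by apply/measurable_funX; exact: measurable_cmod.
- by move=> t; exact: sqr_ge0.
- by move: fy; rewrite /L2_norm Lp_norm2E// => /sqrte_lty.
Qed.

Lemma continuous_inv1Dsqr : continuous (fun u : R => (1 + u ^+ 2)^-1).
Proof.
move=> x; apply: cvgV; first by rewrite gt_eqF// ltr_pwDl// sqr_ge0.
by apply: cvgD; [exact: cvg_cst|exact: exprn_continuous].
Qed.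

Lemma integrable_inv1Dsqr :
  lam.-integrable setT (EFin \o (fun u : R => (1 + u ^+ 2)^-1)) /\
  (\int[lam]_u ((1 + u ^+ 2)^-1)%:E < +oo)%E.
Proof.
have I1 : (\int[lam]_u ((1 + u ^+ 2)^-1)%:E < +oo)%E.
  have c1 : continuous (fun _ : R => 1 : R) by move=> x; exact: cvg_cst.
  have := integral_atan c1 (fun=> ler01).
  have -> : (fun u : R => (1 * (1 + u ^+ 2)^-1)%:E) = (fun u => ((1 + u ^+ 2)^-1)%:E).
    by apply/funext => u; rewrite mul1r.
  move=> ->; rewrite integral_cst//= lebesgue_measure_itv /=.
  by case: ifP => _; rewrite ?mule0// -?EFinB -?EFinM ltry.
split=> //; apply: ge0_integrable_lty => //.
  exact: (continuous_measurable_fun continuous_inv1Dsqr).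
by move=> u; rewrite invr_ge0 addr_ge0// sqr_ge0.
Qed.

Definition cauchy_kernel z (t : R) : R[i] := (t%:C - toC z)^-1.

Lemma cmod_kernel_inv z t : cmod (t%:C - toC z) ^+ 2 = (t - z.1) ^+ 2 + z.2 ^+ 2.
Proof. by rewrite cmod_sqr ReB ImB /= sub0r sqrrN. Qed.

Lemma kernel_nonzero z t : 0 < z.2 -> t%:C - toC z != 0.
Proof.
move=> z2; apply/eqP => /(congr1 (@complex.Im R)); rewrite ImB /= sub0r => /eqP.
by rewrite oppr_eq0 gt_eqF.
Qed.

Lemma continuous_quad (z : R * R) : continuous (fun t : R => (t - z.1) ^+ 2 + z.2 ^+ 2).
Proof.
move=> t; apply: cvgD; last exact: cvg_cst.
apply: (@continuous_comp _ _ _ (fun t => t - z.1) (fun x => x ^+ 2)); last exact: exprn_continuous.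
by apply: cvgB; [exact: cvg_id|exact: cvg_cst].
Qed.

Lemma cauchy_kernelE z t : 0 < z.2 ->
  cauchy_kernel z t = ((t - z.1) / ((t - z.1) ^+ 2 + z.2 ^+ 2)) +i* (z.2 / ((t - z.1) ^+ 2 + z.2 ^+ 2)).
Proof.
move=> z2; have n0 : (t - z.1) ^+ 2 + z.2 ^+ 2 != 0.
  by rewrite gt_eqF// ltr_wpDl ?sqr_ge0// exprn_gt0.
apply: (mulfI (kernel_nonzero t z2)); rewrite divff ?kernel_nonzero//.
by apply/eqP; rewrite eq_complex ReM ImM !ReB !ImB /= sub0r; apply/andP; split; apply/eqP; field.
Qed.

Lemma cmeasurable_kernel z : 0 < z.2 -> cmeasurable setT (cauchy_kernel z).
Proof.
move=> z2; have ci : continuous (fun t : R => ((t - z.1) ^+ 2 + z.2 ^+ 2)^-1).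
  move=> t; apply: cvgV; last exact: continuous_quad.
  by rewrite gt_eqF// ltr_wpDl ?sqr_ge0// exprn_gt0.
have mi := continuous_measurable_fun ci.
split.
  rewrite (_ : (fun t => _) = (fun t => (t - z.1) * ((t - z.1) ^+ 2 + z.2 ^+ 2)^-1)).
    by apply: measurable_funM => //; exact: measurable_funB.
  by apply/funext => t; rewrite cauchy_kernelE.
rewrite (_ : (fun t => _) = (fun t => z.2 * ((t - z.1) ^+ 2 + z.2 ^+ 2)^-1)).
  by apply: measurable_funM => //; exact: measurable_cst.
by apply/funext => t; rewrite cauchy_kernelE.
Qed.

Lemma cmod_kernel_le z t : 0 < z.2 -> cmod (cauchy_kernel z t) <= z.2^-1.
Proof.
move=> z2; rewrite cmodV lef_pV2 ?posrE ?cmod_gt0 ?kernel_nonzero//.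
apply: le_trans (Im_le_cmod _); rewrite ImB /= sub0r normrN; exact: ler_norm.
Qed.

Lemma kernel_sqr_integrable z : 0 < z.2 ->
  lam.-integrable setT (EFin \o (fun t => cmod (cauchy_kernel z t) ^+ 2)).
Proof.
move=> z2; have mk := measurable_cmod measurableT (cmeasurable_kernel z2).
apply: ge0_integrable_lty; [exact: measurable_funX|by move=> t; exact: sqr_ge0|].
rewrite (ge0_integral_affine z.1 z2); last 2 first.
- exact/measurable_EFinP/measurable_funX.
- by move=> y; rewrite lee_fin sqr_ge0.
have kE (u : R) : cmod (cauchy_kernel z (z.2 * u + z.1)) ^+ 2 = (z.2 ^+ 2)^-1 * (1 + u ^+ 2)^-1.
  rewrite cmodV exprVn cmod_kernel_inv.
  have -> : (z.2 * u + z.1 - z.1) ^+ 2 + z.2 ^+ 2 = z.2 ^+ 2 * (1 + u ^+ 2) by ring.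
  by rewrite invfM.
under eq_integral => u _ do rewrite kE EFinM.
rewrite ge0_integralZl_EFin//; last 3 first.
- by move=> u _; rewrite lee_fin invr_ge0 ltW// ltr_pwDl// sqr_ge0.
- apply/measurable_EFinP; exact: (continuous_measurable_fun continuous_inv1Dsqr).
- by rewrite invr_ge0 sqr_ge0.
have [_ I1] := integrable_inv1Dsqr.
by rewrite !lte_mul_pinfty// ?lee_fin ?invr_ge0 ?sqr_ge0// ltW.
Qed.

(** An integrable bound for |f| |kernel|^(m+1): all factors but one are
    bounded by 1 / y, and |f| |kernel| <= |f|^2 + |kernel|^2. *)
Definition kernel_majorant f z m (t : R) : R :=
  z.2^-1 ^+ m * (cmod (f t) ^+ 2 + cmod (cauchy_kernel z t) ^+ 2).

Lemma kernel_majorant_integrable f z m : L2 f -> 0 < z.2 ->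
  lam.-integrable setT (EFin \o kernel_majorant f z m).
Proof.
move=> Lf z2; have i1 := L2_integrable Lf; have i2 := kernel_sqr_integrable z2.
exact: (integrableZl measurableT _ (integrableD measurableT i1 i2)).
Qed.

Lemma kernel_majorantP f z m t : 0 < z.2 ->
  cmod (f t) * cmod (cauchy_kernel z t) ^+ m.+1 <= kernel_majorant f z m t.
Proof.
move=> z2; rewrite exprSr mulrCA.
have z20 : 0 <= z.2^-1 by rewrite invr_ge0 ltW.
apply: ler_pM; [exact/exprn_ge0/cmod_ge0|by apply: mulr_ge0; exact: cmod_ge0| |].
  by rewrite lerXn2r ?nnegrE ?cmod_ge0 ?cmod_kernel_le.
have := sqr_ge0 (cmod (f t) - cmod (cauchy_kernel z t)).
have := sqr_ge0 (cmod (f t)); have := sqr_ge0 (cmod (cauchy_kernel z t)).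
rewrite sqrrB; lra.
Qed.

Lemma kernel_power_measurable f z m : L2 f -> 0 < z.2 ->
  cmeasurable setT (fun t => f t * cauchy_kernel z t ^+ m).
Proof.
by move=> Lf z2; apply: cmeasurableM; [exact: L2_cmeasurable|exact/cmeasurableX/cmeasurable_kernel].
Qed.

Lemma kernel_power_integrable f z m : L2 f -> 0 < z.2 ->
  cintegrable lam setT (fun t => f t * cauchy_kernel z t ^+ m.+1).
Proof.
move=> Lf z2; apply: (@cintegrable_le _ _ (measurableTypeR R) lam setT _ _ measurableT (kernel_power_measurable m.+1 Lf z2)
  (kernel_majorant_integrable m Lf z2)) => t _.
by rewrite cmodM cmodX; exact: kernel_majorantP.
Qed.

Definition cauchy_integral f (m : nat) z : R[i] :=
  cintegral lam setT (fun t => f t * cauchy_kernel z t ^+ m).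

(** The recursion of the constant mirrors the induction in kernel_taylor. *)
Fixpoint taylor_cst (m : nat) : R :=
  if m is n.+1 then 2 * taylor_cst n + 2 * n.+1%:R else 0.

Lemma taylor_cst_ge0 m : 0 <= taylor_cst m.
Proof. by elim: m => //= n IH; rewrite addr_ge0// mulr_ge0. Qed.

(** Write A and B for the kernels at z and z + v, and e for v.  Then
    B - A = e A B, and |B| <= 2 |A| as |v| is at most half the distance from z
    to the real axis.  The remainder for the exponent m + 1 is B times that for
    m, plus (m + 1) e^2 A^(m+2) B, which explains the recursion of the
    constant. *)
Lemma kernel_taylor z v t m : 0 < z.2 -> cmod (toC v) <= z.2 / 2 ->
  cmod (cauchy_kernel (z + v) t ^+ m - cauchy_kernel z t ^+ m
        - m%:R * toC v * cauchy_kernel z t ^+ m.+1) <=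
  taylor_cst m * cmod (toC v) ^+ 2 * cmod (cauchy_kernel z t) ^+ m.+2.
Proof.
move=> z2 vz.
set A := cauchy_kernel z t; set B := cauchy_kernel (z + v) t; set e := toC v.
have e2 : `|v.2| <= z.2 / 2 by exact: le_trans (Im_le_cmod (toC v)) vz.
have zv2 : 0 < (z + v).2 by move: e2; rewrite ler_norml /= => /andP[]; lra.
have nA := kernel_nonzero t z2; have nB := kernel_nonzero t zv2.
have tB : t%:C - toC (z + v) = (t%:C - toC z) - e by rewrite toCD opprD addrA.
have BA : B = A + e * A * B.
  move: nA nB; rewrite /A /B /cauchy_kernel tB; set a := t%:C - toC z => nA nB.
  by field; rewrite nA nB.
have B2A : cmod B <= 2 * cmod A.
  have a1 : z.2 <= cmod (t%:C - toC z).
    by apply: le_trans (Im_le_cmod _); rewrite ImB /= sub0r normrN; exact: ler_norm.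
  have b1 : cmod (t%:C - toC z) / 2 <= cmod (t%:C - toC (z + v)).
    have := cmodD (t%:C - toC (z + v)) e; rewrite tB subrK -/e => h.
    by have := vz; rewrite -/e; lra.
  rewrite !cmodV -[2]invrK -invfM lef_pV2 ?posrE ?cmod_gt0// ?mulr_gt0 ?cmod_gt0//.
  by rewrite mulrC.
elim: m => [|m IH].
  by rewrite [taylor_cst 0]/= !expr0 subrr !mul0r subrr /cmod ComplexField.Normc.normc0.
have -> : B ^+ m.+1 - A ^+ m.+1 - m.+1%:R * e * A ^+ m.+2 =
  (B ^+ m - A ^+ m - m%:R * e * A ^+ m.+1) * B + m.+1%:R * e ^+ 2 * A ^+ m.+2 * B.
  transitivity ((B ^+ m - A ^+ m - m%:R * e * A ^+ m.+1) * B + m.+1%:R * e ^+ 2 * A ^+ m.+2 * B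
    + (A ^+ m + m.+1%:R * e * A ^+ m.+1) * (B - (A + e * A * B))).
    by rewrite !exprS -natr1; ring.
  by rewrite -BA subrr mulr0 addr0.
have -> : taylor_cst m.+1 = 2 * taylor_cst m + 2 * m.+1%:R by [].
apply: (le_trans (cmodD _ _)); rewrite (mulrDl (2 * taylor_cst m)) (mulrDl (_ * _ * _)).
have P0 := exprn_ge0 m.+2 (cmod_ge0 A).
apply: lerD.
  rewrite cmodM; apply: (@le_trans _ _ (taylor_cst m * cmod e ^+ 2 * cmod A ^+ m.+2 * (2 * cmod A))).
    by apply: ler_pM; [exact: cmod_ge0|exact: cmod_ge0|exact: IH|exact: B2A].
  by rewrite [in leRHS](exprSr _ m.+2) le_eqVlt; apply/orP; left; apply/eqP; ring.
rewrite 3!cmodM !cmodX; have -> : cmod (m.+1%:R : R[i]) = m.+1%:R.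
  by rewrite -(rmorph_nat (@real_complex R)) cmod_real ger0_norm.
apply: (@le_trans _ _ (m.+1%:R * cmod e ^+ 2 * cmod A ^+ m.+2 * (2 * cmod A))).
  by apply: ler_wpM2l => //; apply: mulr_ge0 => //; apply: mulr_ge0 => //; exact: sqr_ge0.
by rewrite [in leRHS](exprSr _ m.+2) le_eqVlt; apply/orP; left; apply/eqP; ring.
Qed.

(** The Taylor remainder of the kernel is quadratic in v with an integrable
    factor, so differentiation under the integral sign is immediate. *)
Lemma cauchy_integral_cderiv f m z : L2 f -> 0 < z.2 ->
  cderiv (cauchy_integral f m.+1) z (m.+1%:R * cauchy_integral f m.+2 z).
Proof.
move=> Lf z2; pose k := kernel_majorant f z m.+2.
have ik : lam.-integrable setT (EFin \o k) by exact: kernel_majorant_integrable.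
have k0 : 0 <= \int[lam]_(t in setT) k t.
  apply: Rintegral_ge0 => t _; apply: le_trans (kernel_majorantP f m.+2 t z2).
  by apply: mulr_ge0; [exact: cmod_ge0|exact/exprn_ge0/cmod_ge0].
pose K := 2 * (taylor_cst m.+1 * \int[lam]_(t in setT) k t).
apply: (@cderiv_quadratic _ _ _ _ K (z.2 / 2)).
- by rewrite divr_gt0.
- by apply: mulr_ge0 => //; apply: mulr_ge0 => //; exact: taylor_cst_ge0.
move=> v /ltW vz.
have zv2 : 0 < (z + v).2.
  have : `|v.2| <= z.2 / 2 by exact: le_trans (Im_le_cmod (toC v)) vz.
  by rewrite ler_norml /= => /andP[]; lra.
have I n w (w2 : 0 < w.2) := kernel_power_integrable n Lf w2.
have m' n w (w2 : 0 < w.2) := kernel_power_measurable n Lf w2.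
pose g t := f t * cauchy_kernel (z + v) t ^+ m.+1 - f t * cauchy_kernel z t ^+ m.+1
        - m.+1%:R * toC v * (f t * cauchy_kernel z t ^+ m.+2).
have mg : cmeasurable setT g.
  apply: cmeasurableB; first by apply: cmeasurableB; exact: m'.
  by apply: cmeasurableM; [exact: cmeasurable_cst|exact: m'].
have gE t : g t = f t * (cauchy_kernel (z + v) t ^+ m.+1 - cauchy_kernel z t ^+ m.+1
        - m.+1%:R * toC v * cauchy_kernel z t ^+ m.+2).
  by rewrite /g !mulrBr [in RHS]mulrCA.
have -> : cauchy_integral f m.+1 (z + v) - cauchy_integral f m.+1 z -
    m.+1%:R * cauchy_integral f m.+2 z * toC v = cintegral lam setT g.
  rewrite cintegralB//; last 2 first.
  - by apply: cintegrableB => //; exact: I.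
  - by apply: cintegrableZ => //; exact: I.
  rewrite cintegralB//; [|exact: I|exact: I].
  by rewrite cintegralZ//; [rewrite mulrAC|exact: I].
pose c := taylor_cst m.+1 * cmod (toC v) ^+ 2.
have ick : lam.-integrable setT (EFin \o (fun t => c * k t)) by exact: (integrableZl measurableT c ik).
apply: (le_trans (@cmod_cintegral_le _ _ (measurableTypeR R) lam setT g _ measurableT mg ick _)).
  move=> t _; rewrite gE cmodM.
  apply: (le_trans (ler_wpM2l (cmod_ge0 _) (kernel_taylor t m.+1 z2 vz))).
  rewrite -/c mulrCA; apply: ler_wpM2l; last exact: kernel_majorantP.
  by apply: mulr_ge0; [exact: taylor_cst_ge0|exact: sqr_ge0].
rewrite RintegralZl// /K /c le_eqVlt; apply/orP; left; apply/eqP; ring.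
Qed.
End CauchyKernel.

(** * Moments of the exponential function *)

Section Exhaustion.
Context {R : realType} {d : measure_display} {T : measurableType d}.
Variable mu : {measure set T -> \bar R}.

Lemma Rintegral_dominated (D : set T) (k : nat -> T -> R) (l g : T -> R) :
  measurable D -> (forall n, measurable_fun D (k n)) -> measurable_fun D l ->
  {ae mu, forall t, D t -> k n t @[n --> \oo] --> l t} ->
  mu.-integrable D (EFin \o g) ->
  (forall n t, D t -> `|k n t| <= g t) ->
  \int[mu]_(t in D) k n t @[n --> \oo] --> \int[mu]_(t in D) l t.
Proof.
move=> mD mk ml kl ig kg.
have [] := @dominated_convergence _ T R mu D mD (fun n t => (k n t)%:E) (EFin \o l) (EFin \o g).
- by move=> n; exact/measurable_EFinP.
- exact/measurable_EFinP.
- by apply: filterS kl => t H Dt; apply: cvg_EFin; [exact: nearW|exact: H].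
- exact: ig.
- by apply: aeW => t n Dt; rewrite /= lee_fin kg.
move=> il _ cv; apply: fine_cvg; rewrite fineK; last exact: (integrable_fin_num mD il).
exact: cv.
Qed.

Lemma Rintegral_exhaust (D : set T) (Dn : nat -> set T) (k : T -> R) :
  measurable D -> (forall n, measurable (Dn n)) -> (forall n, Dn n `<=` D) ->
  (forall t, D t -> \forall n \near \oo, Dn n t) ->
  mu.-integrable D (EFin \o k) ->
  \int[mu]_(t in Dn n) k t @[n --> \oo] --> \int[mu]_(t in D) k t.
Proof.
move=> mD mDn DnD DnT ik.
have mk : measurable_fun D k by apply/measurable_EFinP; exact: measurable_int ik.
have E n : \int[mu]_(t in Dn n) k t = \int[mu]_(t in D) (k \_ (Dn n)) t.
  rewrite [LHS]Rintegral_mkcond [RHS]Rintegral_mkcond; congr (Rintegral _ _ _).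
  apply/funext => t; rewrite !patchE; case: ifPn => [tn|]; last by case: ifP.
  by rewrite mem_set//; apply: (DnD n); rewrite inE in tn.
rewrite (_ : (fun n => _) = (fun n => \int[mu]_(t in D) (k \_ (Dn n)) t)); last exact/funext.
apply: (@Rintegral_dominated D _ k (fun t => `|k t|)) => //.
- move=> n; apply/(measurable_restrict _ (mDn n) mD).
  by apply: measurable_funS mk => //; exact: subIsetl.
- apply: aeW => t Dt; apply: cvg_near_cst.
  by have := DnT t Dt; apply: filterS => n tn; rewrite patchE mem_set.
- exact: integrable_norm ik.
- by move=> n t _; rewrite patchE; case: ifP; rewrite ?normr0.
Qed.
End Exhaustion.

Section ExponentialMoments.
Context {R : realType}.
Local Notation lam := (@lebesgue_measure R).

Lemma pow_expR_le (k : nat) (b w : R) : 0 < b -> 0 <= w ->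
  w ^+ k * expR (- (b * w)) <= k`!%:R / b ^+ k.
Proof.
move=> b0 w0; have bw0 : 0 <= b * w by rewrite mulr_ge0// ltW.
rewrite expRN ler_pdivrMr ?expR_gt0// mulrAC ler_pdivlMr ?exprn_gt0//.
rewrite -exprMn mulrC.
have kP : 0 < k`!%:R :> R by rewrite ltr0n fact_gt0.
rewrite -ler_pdivrMl// mulrC (mulrC w); case: k kP => [|k] kP.
  by rewrite expr0 fact0 invr1 mulr1 -expR0 ler_expR.
by apply: (le_trans _ (expR_ge1Dxn k bw0)); rewrite [X in X <= _]mulrC lerDr ler01.
Qed.

(** The integrand of the exponential moment, w^s e^(- zeta w) for
    zeta = b - i c. *)
Definition damped (s : nat) (b c w : R) : R[i] :=
  (w ^+ s * expR (- (b * w)))%:C * expi (c * w).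

Lemma cmod_damped s (b c w : R) : 0 <= w -> cmod (damped s b c w) = w ^+ s * expR (- (b * w)).
Proof.
move=> w0; rewrite cmodM cmod_expi mulr1 cmod_real ger0_norm//.
by rewrite mulr_ge0 ?exprn_ge0 ?expR_ge0.
Qed.

Lemma Re_damped s b c w : complex.Re (damped s b c w) = w ^+ s * expR (- (b * w)) * cos (c * w).
Proof. by rewrite ReM /= mul0r subr0. Qed.

Lemma Im_damped s b c w : complex.Im (damped s b c w) = w ^+ s * expR (- (b * w)) * sin (c * w).
Proof. by rewrite ImM /= mul0r addr0. Qed.

Lemma continuous_pow_expR s (b : R) : continuous (fun w : R => w ^+ s * expR (- (b * w))).
Proof.
move=> w; apply: cvgM; first exact: exprn_continuous.
apply: (@continuous_comp _ _ _ (fun w => - (b * w)) expR); last exact: continuous_expR.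
by apply: cvgN; apply: cvgM; [exact: cvg_cst|exact: cvg_id].
Qed.

Lemma continuous_damped s b c : continuous (fun w => complex.Re (damped s b c w)) /\
  continuous (fun w => complex.Im (damped s b c w)).
Proof.
have cl : continuous (fun w : R => c * w).
  by move=> w; apply: cvgM; [exact: cvg_cst|exact: cvg_id].
split.
  rewrite (_ : (fun w => _) = (fun w => w ^+ s * expR (- (b * w)) * cos (c * w))).
    move=> w; apply: cvgM; first exact: continuous_pow_expR.
    by apply: (@continuous_comp _ _ _ (fun w => c * w) cos); [exact: cl|exact: continuous_cos].
  by apply/funext => w; rewrite Re_damped.
rewrite (_ : (fun w => _) = (fun w => w ^+ s * expR (- (b * w)) * sin (c * w))).
  move=> w; apply: cvgM; first exact: continuous_pow_expR.
  by apply: (@continuous_comp _ _ _ (fun w => c * w) sin); [exact: cl|exact: continuous_sin].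
by apply/funext => w; rewrite Im_damped.
Qed.

Lemma cmeasurable_damped s b c D : cmeasurable D (damped s b c).
Proof.
have [c1 c2] := continuous_damped s b c.
by split; apply: measurable_funTS; exact: continuous_measurable_fun.
Qed.

Lemma damped_le s (b c : R) : 0 < b -> exists C : R, 
  forall w, 0 <= w -> cmod (damped s b c w) <= C * (1 + w ^+ 2)^-1.
Proof.
move=> b0; exists (s`!%:R / b ^+ s + (s.+2)`!%:R / b ^+ s.+2) => w w0.
have w1 : 0 < 1 + w ^+ 2 by rewrite ltr_pwDl// sqr_ge0.
rewrite cmod_damped// ler_pdivlMr// mulrDr mulr1; apply: lerD; first exact: pow_expR_le.
by rewrite mulrAC -exprD addn2 pow_expR_le.
Qed.

Lemma cintegrable_damped s (b c : R) : 0 < b -> cintegrable lam `[0, +oo[ (damped s b c).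
Proof.
move=> b0; have [C HC] := damped_le s c b0.
have [i1 _] := @integrable_inv1Dsqr R.
have iC : lam.-integrable `[0, +oo[ (EFin \o (fun w => C * (1 + w ^+ 2)^-1)).
  apply: (@integrableS _ _ _ _ setT) => //.
  exact: (integrableZl measurableT C i1).
apply: (@cintegrable_le _ _ (measurableTypeR R) lam _ _ _ _ (cmeasurable_damped s b c _) iC).
  exact: measurable_itv.
by move=> t /=; rewrite in_itv /= andbT; exact: HC.
Qed.

Let ReIm_lin (n : nat) (b c : R) (x y : R[i]) :
  complex.Re (n%:R * x - (b +i* - c) * y) =
    n%:R * complex.Re x - (b * complex.Re y + c * complex.Im y) /\
  complex.Im (n%:R * x - (b +i* - c) * y) =
    n%:R * complex.Im x - (b * complex.Im y - c * complex.Re y).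
Proof.
rewrite -(rmorph_nat (@real_complex R)); case: x y => [x1 x2] [y1 y2] /=.
by split; ring.
Qed.

Lemma damped_derive s (b c w : R) :
  is_derive w 1 (fun w => complex.Re (damped s b c w))
    (complex.Re (s%:R * damped s.-1 b c w - (b +i* - c) * damped s b c w)) /\
  is_derive w 1 (fun w => complex.Im (damped s b c w))
    (complex.Im (s%:R * damped s.-1 b c w - (b +i* - c) * damped s b c w)).
Proof.
have ds : is_derive w 1 (fun w : R => w ^+ s) (s%:R * w ^+ s.-1).
  split; first exact: exprn_derivable.
  by rewrite exp_derive /GRing.scale /= mulr1.
have de : is_derive w 1 (fun w : R => expR (- (b * w))) (- b * expR (- (b * w))).
  by apply: is_derive_eq; rewrite /GRing.scale /=; ring.
have dc : is_derive w 1 (fun w : R => cos (c * w)) (- c * sin (c * w)).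
  by apply: is_derive_eq; rewrite /GRing.scale /=; ring.
have dsi : is_derive w 1 (fun w : R => sin (c * w)) (c * cos (c * w)).
  by apply: is_derive_eq; rewrite /GRing.scale /=; ring.
split.
  rewrite (_ : (fun w => _) = (fun w => w ^+ s * expR (- (b * w)) * cos (c * w))).
    apply: (is_derive_eq (is_deriveM (is_deriveM ds de) dc)).
    by rewrite (ReIm_lin s b c _ _).1 !Re_damped !Im_damped !fctE /GRing.scale /=; ring.
  by apply/funext => x; rewrite Re_damped.
rewrite (_ : (fun w => _) = (fun w => w ^+ s * expR (- (b * w)) * sin (c * w))).
  apply: (is_derive_eq (is_deriveM (is_deriveM ds de) dsi)).
  by rewrite (ReIm_lin s b c _ _).2 !Re_damped !Im_damped !fctE /GRing.scale /=; ring.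
by apply/funext => x; rewrite Im_damped.
Qed.

Lemma damped_cvg0 s (b c : R) : 0 < b ->
  complex.Re (damped s b c n%:R) @[n --> \oo] --> (0 : R) /\
  complex.Im (damped s b c n%:R) @[n --> \oo] --> (0 : R).
Proof.
move=> b0.
have H : (s.+1)`!%:R / b ^+ s.+1 * (n.+1%:R)^-1 @[n --> \oo] --> (0 : R).
  by rewrite -[X in _ --> X](mulr0 ((s.+1)`!%:R / b ^+ s.+1)); apply: cvgM; [exact: cvg_cst|exact: cvg_harmonic].
have HN : - ((s.+1)`!%:R / b ^+ s.+1 * (n.+1%:R)^-1) @[n --> \oo] --> (0 : R).
  by rewrite -[X in _ --> X]oppr0; apply: cvgN.
have L n : cmod (damped s b c n.+1%:R) <= (s.+1)`!%:R / b ^+ s.+1 * (n.+1%:R)^-1.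
  rewrite cmod_damped ?ler0n// ler_pdivlMr ?ltr0n// mulrAC -exprSr.
  by apply: pow_expR_le.
have S (u : nat -> R) : (forall n, `|u n.+1| <= cmod (damped s b c n.+1%:R)) -> u @ \oo --> (0 : R).
  move=> uL; rewrite -cvg_shiftS; apply: (squeeze_cvgr _ HN H); apply: nearW => n.
  by rewrite -ler_norml; exact: le_trans (uL n) (L n).
by split; apply: S => n; [exact: Re_le_cmod|exact: Im_le_cmod].
Qed.

(** Integration by parts on [0, n], n tending to infinity. *)
Lemma exp_moment_rec s (b c : R) : 0 < b ->
  (b +i* - c) * cintegral lam `[0, +oo[ (damped s b c) =
    s%:R * cintegral lam `[0, +oo[ (damped s.-1 b c) + damped s b c 0.
Proof.
move=> b0; set zeta := b +i* - c.
have m0 : measurable (`[0, +oo[%classic : set (measurableTypeR R)) by exact: measurable_itv.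
have I s' := cintegrable_damped s' c b0.
pose X n := damped s b c n%:R - damped s b c 0.
pose g w := s%:R * damped s.-1 b c w - zeta * damped s b c w.
have Ig : cintegrable lam `[0, +oo[ g.
  by apply: cintegrableB => //; apply: cintegrableZ => //; exact: I.
have cg : continuous (fun w => complex.Re (g w)) /\ continuous (fun w => complex.Im (g w)).
  have [c1 c2] := continuous_damped s b c; have [c3 c4] := continuous_damped s.-1 b c.
  split.
    rewrite (_ : (fun w => _) = (fun w => s%:R * complex.Re (damped s.-1 b c w) -
      (b * complex.Re (damped s b c w) + c * complex.Im (damped s b c w)))).
      move=> w; apply: cvgB; first by apply: cvgM; [exact: cvg_cst|exact: c3].
      by apply: cvgD; apply: cvgM; [exact: cvg_cst|exact: c1|exact: cvg_cst|exact: c2].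
    by apply/funext => w; rewrite (ReIm_lin s b c _ _).1.
  rewrite (_ : (fun w => _) = (fun w => s%:R * complex.Im (damped s.-1 b c w) -
    (b * complex.Im (damped s b c w) - c * complex.Re (damped s b c w)))).
    move=> w; apply: cvgB; first by apply: cvgM; [exact: cvg_cst|exact: c4].
    by apply: cvgB; apply: cvgM; [exact: cvg_cst|exact: c2|exact: cvg_cst|exact: c1].
  by apply/funext => w; rewrite (ReIm_lin s b c _ _).2.
have ftc n : cintegral lam `[0, n%:R] g = X n.
  rewrite /cintegral; rewrite (Rintegral_itv_derive (ler0n _ n)
    (fun w _ => (damped_derive s b c w).1) (fun w _ => cg.1 w)).
  rewrite (Rintegral_itv_derive (ler0n _ n)
    (fun w _ => (damped_derive s b c w).2) (fun w _ => cg.2 w)).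
  by rewrite /X; case: (damped s b c n%:R) (damped s b c 0) => ? ? [].
have ex (k : R -> R) : lam.-integrable `[0, +oo[ (EFin \o k) ->
    \int[lam]_(t in `[0, n%:R]) k t @[n --> \oo] --> \int[lam]_(t in `[0, +oo[) k t.
  move=> ik; apply: (@Rintegral_exhaust _ _ (measurableTypeR R) lam) => //.
  - by move=> n t /=; rewrite !in_itv /= => /andP[->].
  - move=> t /=; rewrite in_itv /= andbT => t0.
    near=> n; rewrite /= in_itv /= t0 /=; near: n; exact: nbhs_infty_ger.
have E : cintegral lam `[0, +oo[ g = - damped s b c 0.
  have [l1 l2] := damped_cvg0 s c b0.
  have C1 : complex.Re (X n) @[n --> \oo] --> 0 - complex.Re (damped s b c 0).
    rewrite (_ : (fun n => _) = (fun n => complex.Re (damped s b c n%:R) - complex.Re (damped s b c 0))).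
      by apply: cvgB => //; exact: cvg_cst.
    by apply/funext => n; rewrite /X ReB.
  have C2 : complex.Im (X n) @[n --> \oo] --> 0 - complex.Im (damped s b c 0).
    rewrite (_ : (fun n => _) = (fun n => complex.Im (damped s b c n%:R) - complex.Im (damped s b c 0))).
      by apply: cvgB => //; exact: cvg_cst.
    by apply/funext => n; rewrite /X ImB.
  have K1 : complex.Re (X n) @[n --> \oo] --> \int[lam]_(t in `[0, +oo[) complex.Re (g t).
    rewrite (_ : (fun n => _) = (fun n => \int[lam]_(t in `[0, n%:R]) complex.Re (g t))); first exact: ex Ig.1.
    by apply/funext => n; rewrite -ftc.
  have K2 : complex.Im (X n) @[n --> \oo] --> \int[lam]_(t in `[0, +oo[) complex.Im (g t).
    rewrite (_ : (fun n => _) = (fun n => \int[lam]_(t in `[0, n%:R]) complex.Im (g t))); first exact: ex Ig.2.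
    by apply/funext => n; rewrite -ftc.
  rewrite /cintegral (cvg_unique _ K1 C1) ?(cvg_unique _ K2 C2) ?sub0r//.
move: E; rewrite /g cintegralB//; last 2 first.
- by apply: cintegrableZ => //; exact: I.
- by apply: cintegrableZ => //; exact: I.
rewrite !cintegralZ// => E.
by rewrite -[damped s b c 0]opprK -E opprB addrC subrK.
Unshelve. all: by end_near.
Qed.

(** The recursion, down to the moment of order 0. *)
Lemma exp_moment s (b c : R) : 0 < b ->
  cintegral lam `[0, +oo[ (damped s b c) = s`!%:R / (b +i* - c) ^+ s.+1.
Proof.
move=> b0; have := fun s => exp_moment_rec s c b0; set zeta := b +i* - c => rec.
have z0 : zeta != 0.
  by apply/eqP => /(congr1 (@complex.Re R)) /= /eqP; rewrite gt_eqF.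
elim: s => [|s IH]; apply: (mulfI z0); rewrite rec.
  rewrite mul0r add0r fact0 expr1 mulrCA divff// mulr1.
  rewrite /damped !mulr0 oppr0 expR0 expr0 mulr1 /expi cos0 sin0.
  by rewrite -[X in _ = X]mulr1.
rewrite /= IH /damped expr0n /= !mul0r addr0.
have zs : zeta ^+ s.+1 != 0 by rewrite expf_neq0.
by rewrite [zeta ^+ s.+2]exprS factS natrM; field; rewrite z0 zs.
Qed.
End ExponentialMoments.

(** * Exchange of integrals and the Poisson kernel *)

Section FubiniReal.
Context {R : realType}.
Local Notation lam := (@lebesgue_measure R).
Local Notation R1 := (measurableTypeR R).

(** Domination by a product of integrable functions is what makes all the
    exchanges of integrals below legitimate. *)
Lemma product_bound_integrable (h : R * R -> R) (a b : R -> R) :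
  measurable_fun (setT : set (R1 * R1)) h ->
  lam.-integrable setT (EFin \o a) -> lam.-integrable setT (EFin \o b) ->
  (forall x, 0 <= a x) -> (forall t, 0 <= b t) ->
  (forall x t, `|h (x, t)| <= a x * b t) ->
  (lam \x lam)%E.-integrable (setT : set (R1 * R1)) (EFin \o h).
Proof.
move=> mh ia ib a0 b0 hab.
apply/(@integrable12ltyP _ _ R1 R1 R lam lam); first exact/measurable_EFinP.
have mb : measurable_fun setT b by apply/measurable_EFinP; exact: measurable_int ib.
have ma : measurable_fun setT a by apply/measurable_EFinP; exact: measurable_int ia.
set B := (\int[lam]_t (b t)%:E)%E.
have B0 : (0 <= B)%E by apply: integral_ge0 => t _; rewrite lee_fin.
have By : (B < +oo)%E.
  have [_] := integrableP _ _ _ ib; congr (_ < _)%E; apply: eq_integral => t _.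
  by rewrite /= ger0_norm.
have Ay : (\int[lam]_t (a t)%:E < +oo)%E.
  have [_] := integrableP _ _ _ ia; congr (_ < _)%E; apply: eq_integral => t _.
  by rewrite /= ger0_norm.
have in1 x : (\int[lam]_t `|(EFin \o h) (x, t)| <= (a x)%:E * B)%E.
  rewrite -ge0_integralZl_EFin//; last 2 first.
  - by move=> t _; rewrite lee_fin.
  - exact/measurable_EFinP.
  apply: ge0_le_integral => //.
  - apply/measurable_EFinP/measurableT_comp => //; exact: measurable_fun_pair2.
  - by apply: measurable_funeM; exact/measurable_EFinP.
  - by move=> t _; rewrite -EFinM lee_fin hab.
apply: (@le_lt_trans _ _ (\int[lam]_x ((a x)%:E * B)%E)%E).
  apply: ge0_le_integral => //.
  - by move=> x _; apply: integral_ge0.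
  - have := @measurable_fun_fubini_tonelli_F _ _ R1 R1 R lam (fun z => `|(EFin \o h) z|%E).
    by apply => //; apply/measurable_EFinP/measurableT_comp.
  - by apply: emeasurable_funM => //; exact/measurable_EFinP.
rewrite ge0_integralZr//; last 2 first.
- exact/measurable_EFinP.
- by move=> x _; rewrite lee_fin.
have A0 : (0 <= \int[lam]_t (a t)%:E)%E by apply: integral_ge0 => t _; rewrite lee_fin.
by apply: lte_mul_pinfty => //; rewrite ge0_fin_numE.
Qed.

Lemma product_bound_fubini (h : R * R -> R) (a b : R -> R) :
  measurable_fun (setT : set (R1 * R1)) h ->
  lam.-integrable setT (EFin \o a) -> lam.-integrable setT (EFin \o b) ->
  (forall x, 0 <= a x) -> (forall t, 0 <= b t) ->
  (forall x t, `|h (x, t)| <= a x * b t) ->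
  \int[lam]_x \int[lam]_t h (x, t) = \int[lam]_t \int[lam]_x h (x, t) /\
  measurable_fun setT (fun x => \int[lam]_t h (x, t)).
Proof.
move=> mh ia ib a0 b0 hab.
have ih := product_bound_integrable mh ia ib a0 b0 hab.
have i1 x : lam.-integrable setT (EFin \o (fun t => h (x, t))).
  apply: (le_integrable measurableT _ _ (integrableZl measurableT (a x) ib)).
    apply/measurable_EFinP; exact: measurable_fun_pair2.
  by move=> t _; rewrite /= lee_fin (le_trans (hab x t))// ler_norm.
have i2 t : lam.-integrable setT (EFin \o (fun x => h (x, t))).
  apply: (le_integrable measurableT _ _ (integrableZl measurableT (b t) ia)).
    apply/measurable_EFinP; exact: measurable_fun_pair1.
  by move=> x _; rewrite /= lee_fin (le_trans (hab x t))// mulrC ler_norm.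
have E1 x : (\int[lam]_t (h (x, t))%:E = (\int[lam]_t h (x, t))%:E)%E.
  by rewrite /Rintegral fineK//; exact: (integrable_fin_num measurableT (i1 x)).
have E2 t : (\int[lam]_x (h (x, t))%:E = (\int[lam]_x h (x, t))%:E)%E.
  by rewrite /Rintegral fineK//; exact: (integrable_fin_num measurableT (i2 t)).
have F := Fubini ih.
split.
  transitivity (fine (\int[lam]_x \int[lam]_t (h (x, t))%:E))%E.
    by rewrite /Rintegral; congr fine; apply: eq_integral => x _; rewrite E1.
  by rewrite [in LHS]F /Rintegral; congr fine; apply: eq_integral => t _; rewrite E2.
apply/measurable_EFinP.
have := measurable_fubini_F ih; congr measurable_fun; apply/funext => x.
by rewrite /fubini_F /= E1.
Qed.

Lemma Rintegral_half (g : R -> R) : lam.-integrable setT (EFin \o g) ->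
  \int[lam]_x g x = \int[lam]_(x in `]0, +oo[) (g x + g (- x)).
Proof.
move=> ig.
pose p x := Num.max (g x) 0; pose q x := Num.max (- g x) 0.
have gpq x : g x = p x - q x by rewrite /p /q; case: (leP (g x) 0) => h; case: (leP (- g x) 0) => h'; lra.
have p0 x : 0 <= p x by rewrite /p le_max lexx orbT.
have q0 x : 0 <= q x by rewrite /q le_max lexx orbT.
have mg : measurable_fun setT g by apply/measurable_EFinP; exact: measurable_int ig.
have mp : measurable_fun setT p by apply: measurable_maxr => //; exact: measurable_cst.
have mq : measurable_fun setT q.
  by apply: measurable_maxr; [exact: measurableT_comp|exact: measurable_cst].
have ip : lam.-integrable setT (EFin \o p).
  apply: (le_integrable measurableT _ _ ig); first exact/measurable_EFinP.
  move=> x _; rewrite /= lee_fin ger0_norm//; rewrite /p ge_max ler_norm normr_ge0//.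
have iq : lam.-integrable setT (EFin \o q).
  apply: (le_integrable measurableT _ _ ig); first exact/measurable_EFinP.
  by move=> x _; rewrite /= lee_fin ger0_norm//; rewrite /q ge_max -normrN ler_norm normr_ge0.
have half (k : R -> R) : measurable_fun setT k -> (forall x, 0 <= k x) -> lam.-integrable setT (EFin \o k) ->
    \int[lam]_x k x = \int[lam]_(x in `]0, +oo[) (k x + k (- x)) /\
    lam.-integrable `]0, +oo[ (EFin \o (fun x => k x + k (- x))).
  move=> mk k0 ik.
  have mk' : measurable_fun setT (EFin \o k) by exact/measurable_EFinP.
  have k0' x : (0 <= (EFin \o k) x)%E by rewrite lee_fin.
  have H := ge0_integral_half mk' k0'.
  split; first by rewrite /Rintegral H.
  have mkN : measurable_fun setT (fun x : R => k (- x)).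
    by apply: (measurableT_comp mk); exact: oppr_measurable.
  apply: ge0_integrable_lty.
  - by apply: measurable_funTS; exact: measurable_funD.
  - by move=> x; rewrite addr_ge0.
  - have [_] := integrableP _ _ _ ik; congr (_ < _)%E; rewrite -[RHS]H.
    by apply: eq_integral => x _; rewrite /= ger0_norm.
have [hp ihp] := half p mp p0 ip; have [hq ihq] := half q mq q0 iq.
transitivity (\int[lam]_x p x - \int[lam]_x q x).
  by rewrite -RintegralB//; apply: eq_Rintegral => x _; rewrite gpq.
rewrite hp hq -RintegralB//; apply: eq_Rintegral => x _.
by rewrite !gpq; ring.
Qed.
End FubiniReal.

Section ComplexFubini.
Context {R : realType}.
Local Notation lam := (@lebesgue_measure R).
Local Notation R1 := (measurableTypeR R).

Lemma cintegral_fubini (H : R * R -> R[i]) (a b : R -> R) :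
  cmeasurable (setT : set (R1 * R1)) H ->
  lam.-integrable setT (EFin \o a) -> lam.-integrable setT (EFin \o b) ->
  (forall x, 0 <= a x) -> (forall t, 0 <= b t) ->
  (forall x t, cmod (H (x, t)) <= a x * b t) ->
  cintegral lam setT (fun x => cintegral lam setT (fun t => H (x, t))) =
    cintegral lam setT (fun t => cintegral lam setT (fun x => H (x, t))) /\
  cmeasurable (setT : set R) (fun x => cintegral lam setT (fun t => H (x, t))).
Proof.
move=> [m1 m2] ia ib a0 b0 Hab.
have [E1 M1] := product_bound_fubini m1 ia ib a0 b0 (fun x t => le_trans (Re_le_cmod _) (Hab x t)).
have [E2 M2] := product_bound_fubini m2 ia ib a0 b0 (fun x t => le_trans (Im_le_cmod _) (Hab x t)).
split; last by split; [exact: M1|exact: M2].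
by rewrite /cintegral E1 E2.
Qed.

Lemma cintegral_mkcond (D : set R) (f : R -> R[i]) :
  cintegral lam D f = cintegral lam setT (fun t => if t \in D then f t else 0).
Proof.
rewrite /cintegral; congr Complex; rewrite Rintegral_mkcond;
  by congr (Rintegral _ _ _); apply/funext => t; rewrite patchE; case: ifP.
Qed.

Lemma cmeasurable_if (D : set R) (f : R -> R[i]) : measurable D -> cmeasurable setT f ->
  cmeasurable setT (fun t => if t \in D then f t else 0).
Proof.
move=> mD [f1 f2]; split.
  rewrite (_ : (fun t => _) = (fun t => complex.Re (f t)) \_ D).
    by apply/(measurable_restrictT _ mD); exact: measurable_funTS.
  by apply/funext => t; rewrite patchE; case: ifP.
rewrite (_ : (fun t => _) = (fun t => complex.Im (f t)) \_ D).
  by apply/(measurable_restrictT _ mD); exact: measurable_funTS.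
by apply/funext => t; rewrite patchE; case: ifP.
Qed.

Lemma cmeasurable_expi d (T : measurableType d) (k : T -> R) : measurable_fun setT k ->
  cmeasurable setT (fun t => expi (k t)).
Proof.
move=> mk; split.
  by apply: (measurableT_comp _ mk); apply: continuous_measurable_fun; exact: continuous_cos.
by apply: (measurableT_comp _ mk); apply: continuous_measurable_fun; exact: continuous_sin.
Qed.

Lemma cmeasurable_real d (T : measurableType d) (k : T -> R) : measurable_fun setT k ->
  cmeasurable setT (fun t => (k t)%:C).
Proof. by move=> mk; split; [exact: mk|exact: measurable_cst]. Qed.

Lemma cmeasurable_comp d (T : measurableType d) (k : T -> R1) (f : R -> R[i]) :
  measurable_fun setT k -> cmeasurable (setT : set R1) f ->
  cmeasurable setT (fun t => f (k t)).
Proof. by move=> mk [f1 f2]; split; [exact: (measurableT_comp f1 mk)|exact: (measurableT_comp f2 mk)]. Qed.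

Definition double_exp (a w : R) : R := expR (- (2 * pi * a * `|w|)).

Lemma double_exp_gt0 a w : 0 < double_exp a w.
Proof. exact: expR_gt0. Qed.

Lemma continuous_double_exp a : continuous (double_exp a).
Proof.
move=> w; apply: (@continuous_comp _ _ _ (fun w => - (2 * pi * a * `|w|)) expR); last exact: continuous_expR.
by apply: cvgN; apply: cvgM; [exact: cvg_cst|exact: norm_continuous].
Qed.

Lemma measurable_double_exp a : measurable_fun setT (double_exp a).
Proof. exact: (continuous_measurable_fun (@continuous_double_exp a)). Qed.

Lemma two_pi_gt0 : 0 < 2 * pi :> R. Proof. by rewrite mulr_gt0// pi_gt0. Qed.

Lemma integrable_double_exp a : 0 < a -> lam.-integrable setT (EFin \o double_exp a).
Proof.
move=> a0; have b0 : 0 < 2 * pi * a by rewrite mulr_gt0// two_pi_gt0.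
have [i1 _] := @integrable_inv1Dsqr R.
have i2 := integrableZl measurableT (0`!%:R / (2 * pi * a) ^+ 0 + 2`!%:R / (2 * pi * a) ^+ 2) i1.
apply: (le_integrable measurableT _ _ i2); first by apply/measurable_EFinP; exact: measurable_double_exp.
move=> w _; rewrite /= lee_fin [leLHS]ger0_norm ?(ltW (double_exp_gt0 _ _))//.
apply: le_trans (ler_norm _).
have w1 : 0 < 1 + w ^+ 2 by rewrite ltr_pwDl// sqr_ge0.
rewrite ler_pdivlMr// mulrDr mulr1; apply: lerD.
  by have := pow_expR_le 0 b0 (normr_ge0 w); rewrite [X in X * _ <= _]expr0 mul1r.
have := pow_expR_le 2 b0 (normr_ge0 w); rewrite real_normK ?num_real// mulrC.
exact.
Qed.

Definition poisson (a u : R) : R := a / (pi * (a ^+ 2 + u ^+ 2)).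

(** The two half lines contribute 1 / (2 pi (a - i u)) and
    1 / (2 pi (a + i u)). *)
Lemma poisson_fourier (a u : R) : 0 < a ->
  cintegral lam setT (fun w => (double_exp a w)%:C * expi (2 * pi * u * w)) = (poisson a u)%:C.
Proof.
move=> a0; have b0 : 0 < 2 * pi * a by rewrite mulr_gt0// two_pi_gt0.
pose g w := (double_exp a w)%:C * expi (2 * pi * u * w).
have mg : cmeasurable setT g.
  apply: cmeasurableM; first by apply: cmeasurable_real; exact: measurable_double_exp.
  by apply: cmeasurable_expi; exact: measurable_funM.
have [g1 g2] : cintegrable lam setT g.
  apply: (@cintegrable_le _ _ R1 lam _ _ _ measurableT mg (integrable_double_exp a0)) => w _.
  by rewrite cmodM cmod_expi mulr1 cmod_real ger0_norm// ltW// double_exp_gt0.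
have [J1 _] := cintegrable_damped 0 (2 * pi * u) b0.
have E := exp_moment 0 (2 * pi * u) b0.
rewrite /cintegral (Rintegral_half g1) (Rintegral_half g2).
have gp w : w \in `]0, +oo[%classic -> g w = damped 0 (2 * pi * a) (2 * pi * u) w.
  rewrite inE /= in_itv /= andbT => w0.
  by rewrite /g /damped /double_exp gtr0_norm// expr0 mul1r.
have gN w : g (- w) = (complex.Re (g w)) +i* (- complex.Im (g w)).
  rewrite /g /double_exp normrN mulrN; apply/eqP; rewrite eq_complex !ReM !ImM /= cosN sinN.
  by apply/andP; split; apply/eqP; ring.
have -> : \int[lam]_(x in `]0, +oo[) (complex.Im (g x) + complex.Im (g (- x))) = 0.
  rewrite (_ : (fun x => _) = (fun=> 0)); last by apply/funext => w; rewrite gN /= subrr.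
  by rewrite /Rintegral integral0.
have -> : \int[lam]_(x in `]0, +oo[) (complex.Re (g x) + complex.Re (g (- x))) =
    2 * \int[lam]_(x in `[0, +oo[) complex.Re (damped 0 (2 * pi * a) (2 * pi * u) x).
  have J1' : lam.-integrable `]0, +oo[ (EFin \o (fun x => complex.Re (damped 0 (2 * pi * a) (2 * pi * u) x))).
    apply: (@integrableS _ R1 _ lam _ _ _ _ _ _ J1) => //.
    by move=> x /=; rewrite !in_itv /= !andbT => /ltW.
  rewrite -Rintegral_itv_obnd_cbnd// -RintegralZl//.
  apply: eq_Rintegral => w wI; have -> : complex.Re (g (- w)) = complex.Re (g w) by rewrite gN.
  by rewrite (gp w wI) [RHS]mulr_natl [RHS]mulr2n.
congr Complex; have -> : \int[lam]_(x in `[0, +oo[) complex.Re (damped 0 (2 * pi * a) (2 * pi * u) x) =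
   complex.Re (cintegral lam `[0, +oo[ (damped 0 (2 * pi * a) (2 * pi * u))) by [].
have A (P : R) : 0 < P -> 2 * (2 * P * a / ((2 * P * a) ^+ 2 + (- (2 * P * u)) ^+ 2)) = a / (P * (a ^+ 2 + u ^+ 2)).
  move=> P0; have n2 : a ^+ 2 + u ^+ 2 != 0 by rewrite gt_eqF// ltr_pwDl ?sqr_ge0// exprn_gt0.
  have -> : (2 * P * a) ^+ 2 + (- (2 * P * u)) ^+ 2 = (2 * P) ^+ 2 * (a ^+ 2 + u ^+ 2) by ring.
  by field; rewrite n2 (gt_eqF P0).
rewrite E fact0 expr1 mul1r /poisson -(A pi (pi_gt0 R)).
by rewrite /= .
Qed.
End ComplexFubini.

(** * Poisson means from the Fourier transform *)

Section WaveletPoisson.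
Context {R : realType}.
Local Notation lam := (@lebesgue_measure R).
Local Notation R1 := (measurableTypeR R).
Implicit Types (psi : R -> R[i]).

Definition window psi (n : nat) (t : R) : R[i] := if t \in `[- n%:R, n%:R]%classic then psi t else 0.

Lemma cmeasurable_window psi n : L2 psi -> cmeasurable setT (window psi n).
Proof. by move=> Lp; apply: cmeasurable_if; [exact: measurable_itv|exact: L2_cmeasurable]. Qed.

(** On [-n, n] one has 1 <= (1 + n^2) / (1 + t^2), and |psi| <= 1 + |psi|^2. *)
Definition window_majorant psi n (t : R) : R := (1 + n%:R ^+ 2) * (1 + t ^+ 2)^-1 + cmod (psi t) ^+ 2.

Lemma window_le psi n t : cmod (window psi n t) <= window_majorant psi n t.
Proof.
have t1 : 0 < 1 + t ^+ 2 by rewrite ltr_pwDl// sqr_ge0.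
have n1 : 0 <= 1 + n%:R ^+ 2 :> R by rewrite addr_ge0// sqr_ge0.
rewrite /window /window_majorant; case: ifPn => [|_]; last first.
  rewrite /cmod ComplexField.Normc.normc0 addr_ge0 ?sqr_ge0// mulr_ge0// invr_ge0; exact: ltW.
rewrite inE /= in_itv /= -ler_norml => tn.
have tn2 : t ^+ 2 <= n%:R ^+ 2 by rewrite -(real_normK (num_real t)) ler_pXn2r ?nnegrE.
have h1 : 1 <= (1 + n%:R ^+ 2) * (1 + t ^+ 2)^-1 by rewrite ler_pdivlMr// mul1r lerD2l.
have := sqr_ge0 (cmod (psi t) - 1); rewrite sqrrB1; have := sqr_ge0 (cmod (psi t)).
move: h1; set A := _ * _^-1; set B := cmod (psi t); clear; lra.
Qed.

Lemma integrable_window_majorant psi n : L2 psi -> lam.-integrable setT (EFin \o window_majorant psi n).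
Proof.
move=> Lp; have [i1 _] := @integrable_inv1Dsqr R.
have i2 := integrableZl measurableT (1 + n%:R ^+ 2) i1.
exact: (integrableD measurableT i2 (L2_integrable Lp)).
Qed.

Lemma window_majorant_ge0 psi n t : 0 <= window_majorant psi n t.
Proof. exact: le_trans (cmod_ge0 _) (window_le psi n t). Qed.

Definition gabor (a x w : R) : R[i] := (double_exp a w)%:C * expi (2 * pi * x * w).

Lemma cmod_gabor a x w : cmod (gabor a x w) = double_exp a w.
Proof. by rewrite cmodM cmod_expi mulr1 cmod_real ger0_norm// ltW// double_exp_gt0. Qed.

Lemma cmeasurable_gabor a x : cmeasurable setT (gabor a x).
Proof.
apply: cmeasurableM; first by apply: cmeasurable_real; exact: measurable_double_exp.
by apply: cmeasurable_expi; exact: measurable_funM.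
Qed.

Lemma truncated_fourierE psi n w :
  truncated_fourier psi n w = cintegral lam setT (fun t => window psi n t * expi (- (2 * pi * t * w))).
Proof.
rewrite /truncated_fourier cintegral_mkcond; congr (cintegral _ _ _); apply/funext => t.
by rewrite /window; case: ifP => // _; rewrite mul0r.
Qed.

Lemma expiD (a b : R) : expi (a + b) = expi a * expi b.
Proof.
apply/eqP; rewrite eq_complex ReM ImM /= cosD sinD; apply/andP; split => //.
by rewrite addrC.
Qed.

Let eq_le1 (c : R) : c = 1 -> c <= 1. Proof. by move=> ->. Qed.

Lemma window_integrable_mul psi n (g : R -> R[i]) : L2 psi -> cmeasurable setT g ->
  (forall t, cmod (g t) <= 1) -> cintegrable lam setT (fun t => window psi n t * g t).
Proof.
move=> Lp mg g1; have mw : cmeasurable setT (fun t => window psi n t * g t).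
  by apply: cmeasurableM => //; exact: cmeasurable_window.
apply: (@cintegrable_le _ _ R1 lam setT _ _ measurableT mw (integrable_window_majorant n Lp)) => t _.
rewrite cmodM; apply: le_trans (window_le psi n t).
by apply: ler_piMr; [exact: cmod_ge0|exact: g1].
Qed.

(** Fubini moves the test function from the frequency side to the time side,
    where its transform is a Poisson kernel. *)
Lemma truncated_fourier_test psi n (a x : R) : L2 psi -> 0 < a ->
  cintegral lam setT (fun w => truncated_fourier psi n w * gabor a x w) =
    cintegral lam `[- n%:R, n%:R] (fun t => psi t * (poisson a (x - t))%:C) /\
  cmeasurable setT (truncated_fourier psi n).
Proof.
move=> Lp a0.
pose H (z : R * R) := gabor a x z.1 * (window psi n z.2 * expi (- (2 * pi * z.2 * z.1))).
have mw : cmeasurable setT (window psi n) := cmeasurable_window n Lp.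
have mH : cmeasurable (setT : set (R1 * R1)) H.
  apply: cmeasurableM.
    by apply: (@cmeasurable_comp _ _ (R1 * R1)%type fst); [exact: measurable_fst|exact: cmeasurable_gabor].
  apply: cmeasurableM.
    by apply: (@cmeasurable_comp _ _ (R1 * R1)%type snd); [exact: measurable_snd|exact: mw].
  apply: (@cmeasurable_expi _ _ (R1 * R1)%type (fun z => - (2 * pi * z.2 * z.1))).
  apply: (measurableT_comp (@oppr_measurable _ _)).
  by apply: measurable_funM; [apply: measurable_funM => //; exact: measurable_snd|exact: measurable_fst].
have Hb w t : cmod (H (w, t)) <= double_exp a w * window_majorant psi n t.
  rewrite /H cmodM cmod_gabor cmodM cmod_expi mulr1 /=.
  by apply: ler_wpM2l; [exact/ltW/double_exp_gt0|exact: window_le].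
have [F M] := cintegral_fubini mH (integrable_double_exp a0) (integrable_window_majorant n Lp)
  (fun w => ltW (double_exp_gt0 a w)) (window_majorant_ge0 psi n) Hb.
have me w : cmeasurable setT (fun t : R => expi (- (2 * pi * t * w))).
  apply: cmeasurable_expi; apply: (measurableT_comp (@oppr_measurable _ _)).
  by apply: measurable_funM => //; exact: measurable_funM.
have inner w : cintegral lam setT (fun t => H (w, t)) = gabor a x w * truncated_fourier psi n w.
  rewrite truncated_fourierE.
  exact: (@cintegralZ _ _ R1 lam setT _ (gabor a x w) measurableT
    (window_integrable_mul n Lp (me w) (fun t => eq_le1 (cmod_expi _)))).
have inner2 t : cintegral lam setT (fun w => H (w, t)) = window psi n t * (poisson a (x - t))%:C.
  have iG : cintegrable lam setT (gabor a (x - t)).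
    apply: (@cintegrable_le _ _ R1 lam setT _ _ measurableT (cmeasurable_gabor a (x - t)) (integrable_double_exp a0)).
    by move=> w _; rewrite cmod_gabor.
  rewrite -(poisson_fourier (x - t) a0).
  rewrite -(@cintegralZ _ _ R1 lam setT (gabor a (x - t)) (window psi n t) measurableT iG).
  congr (cintegral _ _ _); apply/funext => w; rewrite /H /gabor /=.
  rewrite (_ : 2 * pi * (x - t) * w = 2 * pi * x * w + - (2 * pi * t * w)); last by ring.
  by rewrite expiD; ring.
split.
  transitivity (cintegral lam setT (fun w => cintegral lam setT (fun t => H (w, t)))).
    by congr (cintegral _ _ _); apply/funext => w; rewrite inner mulrC.
  rewrite F (@cintegral_mkcond R `[- n%:R, n%:R]%classic); congr (cintegral _ _ _); apply/funext => t; rewrite inner2 /window.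
  by case: (t \in _); [reflexivity|exact: mul0r].
pose Gi w : R[i] := (expR (2 * pi * a * `|w|))%:C * expi (- (2 * pi * x * w)).
have mGi : cmeasurable setT Gi.
  apply: cmeasurableM.
    apply: cmeasurable_real; apply: continuous_measurable_fun => w.
    apply: (@continuous_comp _ _ _ (fun w => 2 * pi * a * `|w|) expR); last exact: continuous_expR.
    by apply: cvgM; [exact: cvg_cst|exact: norm_continuous].
  by apply: cmeasurable_expi; apply: (measurableT_comp (@oppr_measurable _ _)); exact: measurable_funM.
have -> : truncated_fourier psi n = (fun w => Gi w * cintegral lam setT (fun t => H (w, t))).
  apply/funext => w; rewrite inner mulrA -[LHS]mul1r; congr (_ * _).
  rewrite /Gi /gabor mulrACA -expiD addNr -rmorphM /= /double_exp -expRD addrN expR0.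
  by rewrite /expi cos0 sin0 mulr1.
exact: cmeasurableM.
Qed.

(** The exponential weight is square integrable, so convergence in L^2 implies
    convergence of the weighted L^1 norms. *)
Lemma weighted_cvg0 (D : nat -> R -> R[i]) (a : R) : 0 < a ->
  (forall n, cmeasurable setT (D n)) ->
  (fun n => L2_norm (D n)) @ \oo --> 0%:E ->
  (forall n, lam.-integrable setT (EFin \o (fun w => cmod (D n w) * double_exp a w))) ->
  \int[lam]_w (cmod (D n w) * double_exp a w) @[n --> \oo] --> (0 : R).
Proof.
move=> a0 mD D0 iD.
have mc n : measurable_fun setT (fun w => cmod (D n w)) by exact: measurable_cmod.
have me := @measurable_double_exp R a.
set e := Lp_norm lam 2%:E setT (double_exp a).
have ey : (e < +oo)%E.
  rewrite /e Lp_norm2E//.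
  have : (\int[lam]_(t in setT) ((double_exp a t) ^+ 2)%:E < +oo)%E.
    have a20 : 0 < 2 * a by rewrite mulr_gt0.
    have [_] := integrableP _ _ _ (integrable_double_exp a20); congr (_ < _)%E.
    apply: eq_integral => t _; rewrite /= ger0_norm ?(ltW (double_exp_gt0 _ _))//.
    by rewrite /double_exp expr2 -expRD; congr (expR _)%:E; ring.
  by case: (integral _ _ _) => //= r _; rewrite ltry.
have e0 : (0 <= e)%E by exact: Lnorm_ge0.
have L2E n : L2_norm (D n) = 'N[lam]_2%:E [EFin \o (fun w => cmod (D n w))]%E.
  by rewrite /L2_norm /Lp_norm patch_setT.
have eE : e = 'N[lam]_2%:E [EFin \o double_exp a]%E by rewrite /e /Lp_norm patch_setT.
have H n : ((\int[lam]_w (cmod (D n w) * double_exp a w))%:E <= e * L2_norm (D n))%E.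
  have two0 : (0 < 2 :> R) by [].
  have half : 2^-1 + 2^-1 = 1 :> R by field.
  have := @hoelder _ R1 R lam _ _ 2 2 (mc n) me two0 two0 half.
  rewrite muleC L2E eE; apply: le_trans; rewrite Lnorm1.
  rewrite /Rintegral fineK; last exact: (integrable_fin_num measurableT (iD n)).
  rewrite le_eqVlt; apply/orP; left; apply/eqP; apply: eq_integral => w _ /=.
  by rewrite ger0_norm// mulr_ge0 ?cmod_ge0// ltW// double_exp_gt0.
have [e' eE'] : exists e', e = e'%:E by exists (fine e); rewrite fineK// ge0_fin_numE.
have L : ((\int[lam]_w (cmod (D n w) * double_exp a w))%:E)%E @[n --> \oo] --> 0%:E.
  have cv : (e'%:E * L2_norm (D n))%E @[n --> \oo] --> 0%:E.
    by rewrite -[X in _ --> X](mule0 e'%:E); apply: cvgeZl.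
  apply: (squeeze_cvge _ (cvg_cst _) cv); apply: nearW => n; apply/andP; split.
    rewrite lee_fin; apply: Rintegral_ge0 => w _; apply: mulr_ge0; first exact: cmod_ge0.
    exact/ltW/double_exp_gt0.
  by rewrite -eE'.
exact: (fine_cvg L).
Qed.

Lemma poisson_ge0 (a u : R) : 0 < a -> 0 <= poisson a u.
Proof.
move=> a0; apply: divr_ge0; first exact: ltW.
by apply: mulr_ge0; [exact: pi_ge0|apply: addr_ge0; exact: sqr_ge0].
Qed.

Lemma continuous_poisson (a x : R) : 0 < a -> continuous (fun t : R => poisson a (x - t)).
Proof.
move=> a0 t; apply: cvgM; first exact: cvg_cst.
apply: cvgV.
  by rewrite mulf_neq0// gt_eqF ?pi_gt0// ltr_pwDl ?sqr_ge0// exprn_gt0.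
apply: cvgM; first exact: cvg_cst.
apply: cvgD; first exact: cvg_cst.
apply: (@continuous_comp _ _ _ (fun t => x - t) (fun x => x ^+ 2)); last exact: exprn_continuous.
by apply: cvgB; [exact: cvg_cst|exact: cvg_id].
Qed.

Lemma poisson_le_kernel (a x t : R) : 0 < a -> poisson a (x - t) <= cmod (cauchy_kernel (x, a) t).
Proof.
move=> a0; apply: le_trans (Im_le_cmod _); apply: le_trans (ler_norm _).
rewrite cauchy_kernelE//= /poisson.
have h : 0 < a ^+ 2 + (x - t) ^+ 2 by rewrite ltr_pwDl ?sqr_ge0// exprn_gt0.
have -> : (t - x) ^+ 2 + a ^+ 2 = a ^+ 2 + (x - t) ^+ 2 by ring.
rewrite ler_wpM2l ?(ltW a0)// lef_pV2 ?posrE ?mulr_gt0 ?pi_gt0// ler_peMl ?(ltW h)//.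
by apply: le_trans (pi_ge2 R); rewrite ler1n.
Qed.

Lemma poisson_integrable psi (a x : R) : L2 psi -> 0 < a ->
  cintegrable lam setT (fun t => psi t * (poisson a (x - t))%:C).
Proof.
move=> Lp a0.
have m : cmeasurable setT (fun t => psi t * (poisson a (x - t))%:C).
  apply: cmeasurableM; first exact: L2_cmeasurable.
  have mp : measurable_fun setT (fun t : R => poisson a (x - t)).
    exact: (continuous_measurable_fun (@continuous_poisson a x a0)).
  exact: (cmeasurable_real mp).
apply: (@cintegrable_le _ _ R1 lam setT _ _ measurableT m
  (@kernel_majorant_integrable _ psi (x, a) 0 Lp a0)) => t _.
apply: (le_trans _ (kernel_majorantP psi 0 t (z := (x, a)) a0)).
rewrite cmodM expr1; apply: ler_wpM2l; first exact: cmod_ge0.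
by rewrite cmod_real ger0_norm ?poisson_ge0// poisson_le_kernel.
Qed.

(** The definition of the Fourier transform is a limit in L^2, which the
    rapidly decreasing function gabor turns into a limit of numbers; the
    truncated integrals on the time side exhaust the line. *)
Lemma fourier_test psi h (a x : R) : is_fourier psi h -> L2 psi -> 0 < a ->
  cintegral lam setT (fun t => psi t * (poisson a (x - t))%:C) =
  cintegral lam setT (fun w => h w * gabor a x w).
Proof.
move=> [Lh cv] Lp a0.
pose D n w := truncated_fourier psi n w - h w.
have mT n : cmeasurable setT (truncated_fourier psi n) by have [] := truncated_fourier_test n x Lp a0.
have mh := L2_cmeasurable Lh.
have mD n : cmeasurable setT (D n) by exact: cmeasurableB.
have iE := integrable_double_exp a0.
have a20 : 0 < 2 * a by rewrite mulr_gt0.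
have E2 w : double_exp a w ^+ 2 = double_exp (2 * a) w.
  by rewrite /double_exp expr2 -expRD; congr expR; ring.
have mG := cmeasurable_gabor a x.
have ihG : cintegrable lam setT (fun w => h w * gabor a x w).
  apply: (@cintegrable_le _ _ R1 lam setT _ (fun w => cmod (h w) ^+ 2 + double_exp (2 * a) w) measurableT).
  - exact: cmeasurableM.
  - exact: (integrableD measurableT (L2_integrable Lh) (integrable_double_exp a20)).
  - move=> w _; rewrite cmodM cmod_gabor -E2.
    have := sqr_ge0 (cmod (h w) - double_exp a w); rewrite sqrrB.
    have := sqr_ge0 (cmod (h w)); have := sqr_ge0 (double_exp a w); lra.
have iTG n : cintegrable lam setT (fun w => truncated_fourier psi n w * gabor a x w).
  pose B := 2 * \int[lam]_t window_majorant psi n t.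
  apply: (@cintegrable_le _ _ R1 lam setT _ (fun w => B * double_exp a w) measurableT).
  - by apply: cmeasurableM; [exact: mT|exact: mG].
  - exact: (integrableZl measurableT B iE).
  - move=> w _; rewrite cmodM cmod_gabor; apply: ler_wpM2r; first exact/ltW/double_exp_gt0.
    rewrite truncated_fourierE.
    apply: (@cmod_cintegral_le _ _ R1 lam setT _ _ measurableT _ (integrable_window_majorant n Lp)).
      apply: cmeasurableM; first exact: cmeasurable_window.
      apply: cmeasurable_expi; apply: (measurableT_comp (@oppr_measurable _ _)).
      by apply: measurable_funM => //; exact: measurable_funM.
    by move=> t _; rewrite cmodM cmod_expi mulr1 window_le.
have iDG n : cintegrable lam setT (fun w => D n w * gabor a x w).
  have := cintegrableB measurableT (iTG n) ihG.
  by congr cintegrable; apply/funext => w; rewrite -mulrBl.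
have iDE n : lam.-integrable setT (EFin \o (fun w => cmod (D n w) * double_exp a w)).
  have [i1 i2] := iDG n.
  apply: (le_integrable measurableT _ _ (integrableD measurableT (integrable_norm i1) (integrable_norm i2))).
    apply/measurable_EFinP; apply: measurable_funM; first by apply: (measurable_cmod measurableT (mD n)).
    exact: measurable_double_exp.
  move=> w _; rewrite /= lee_fin ger0_norm; last first.
    by apply: mulr_ge0; [exact: cmod_ge0|exact/ltW/double_exp_gt0].
  rewrite [leRHS]ger0_norm ?addr_ge0// -(cmod_gabor a x) -cmodM; exact: cmod_le_ReIm.
have W := weighted_cvg0 a0 mD cv iDE.
have W2 : 2 * \int[lam]_w (cmod (D n w) * double_exp a w) @[n --> \oo] --> (0 : R).
  by rewrite -[X in _ --> X](mulr0 2); apply: cvgM => //; exact: cvg_cst.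
have W2N : - (2 * \int[lam]_w (cmod (D n w) * double_exp a w)) @[n --> \oo] --> (0 : R).
  by rewrite -[X in _ --> X]oppr0; apply: cvgN.
have bound n : cmod (cintegral lam setT (fun w => D n w * gabor a x w)) <=
    2 * \int[lam]_w (cmod (D n w) * double_exp a w).
  apply: (@cmod_cintegral_le _ _ R1 lam setT _ _ measurableT _ (iDE n)).
    by apply: cmeasurableM; [exact: mD|exact: mG].
  by move=> w _; rewrite cmodM cmod_gabor.
have E n : cintegral lam setT (fun w => D n w * gabor a x w) =
    cintegral lam `[- n%:R, n%:R] (fun t => psi t * (poisson a (x - t))%:C) -
    cintegral lam setT (fun w => h w * gabor a x w).
  have [<- _] := truncated_fourier_test n x Lp a0.
  rewrite -(@cintegralB _ _ R1 lam setT _ _ measurableT (iTG n) ihG).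
  by congr (cintegral _ _ _); apply/funext => w; rewrite -mulrBl.
pose g t := psi t * (poisson a (x - t))%:C.
have ig : cintegrable lam setT g by exact: poisson_integrable.
have lim (P : R[i] -> R) : (forall a b, P (a - b) = P a - P b) -> (forall a, `|P a| <= cmod a) ->
   P (cintegral lam `[- n%:R, n%:R] g) @[n --> \oo] --> P (cintegral lam setT (fun w => h w * gabor a x w)).
  move=> PB Pc; set l := P (cintegral lam setT _).
  have -> : (fun n => P (cintegral lam `[- n%:R, n%:R] g)) =
    (fun n => P (cintegral lam setT (fun w => D n w * gabor a x w)) + l).
    by apply/funext => n; rewrite E PB subrK.
  rewrite -[X in _ --> X]add0r; apply: cvgD; last exact: cvg_cst.
  apply: (squeeze_cvgr _ W2N W2); apply: nearW => n; rewrite -ler_norml.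
  exact: le_trans (Pc _) (bound n).
have ex (k : R -> R) : lam.-integrable setT (EFin \o k) ->
    \int[lam]_(t in `[- n%:R, n%:R]) k t @[n --> \oo] --> \int[lam]_(t in setT) k t.
  move=> ik; apply: (@Rintegral_exhaust _ _ R1 lam) => // t _.
  near=> n; rewrite /= in_itv /= -ler_norml; near: n; exact: nbhs_infty_ger.
have L1 := lim (@complex.Re R) ReB (@Re_le_cmod R).
have L2' := lim (@complex.Im R) ImB (@Im_le_cmod R).
apply/eqP; rewrite eq_complex; apply/andP; split; apply/eqP.
  exact: (cvg_unique _ (ex _ ig.1) L1).
exact: (cvg_unique _ (ex _ ig.2) L2').
Unshelve. all: by end_near.
Qed.
End WaveletPoisson.

(** * The closed form of the Cauchy wavelet *)

Section WaveletIdentification.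
Context {R : realType}.
Local Notation lam := (@lebesgue_measure R).
Local Notation R1 := (measurableTypeR R).
Implicit Types (psi : R -> R[i]).

(** As the integrals over intervals vanish, w is 0 almost everywhere in each
    ] -n, n [, where it is integrable. *)
Lemma ae_eq0_locally (w : R -> R) :
  (forall n : nat, lam.-integrable `]- n%:R, n%:R[ (EFin \o w)) ->
  (forall c d : R, c < d -> \int[lam]_(t in `]c, d[) w t = 0) ->
  {ae lam, forall t, w t = 0}.
Proof.
move=> iw w0.
have key n : {ae lam, forall t, `]- n%:R, n%:R[%classic t -> w t = 0}.
  pose f := (EFin \o w) \_ `]- n%:R, n%:R[.
  have mI : measurable (`]- n%:R, n%:R[%classic : set R1) by exact: measurable_itv.
  have intf : lam.-integrable setT f by exact: (iffLR (@integrable_mkcond _ R1 R lam _ _ mI) (iw n)).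
  have inter (c d : R) : (\int[lam]_(t in `]c, d[ `&` `](- n%:R)%R, n%:R%R[) (w t)%:E = 0)%E.
    rewrite setI_itvoo; set c' := Num.max _ _; set d' := Num.min _ _.
    have [cd|dc] := ltP c' d'; last by rewrite set_itv_ge ?bnd_simp -?leNgt// integral_set0.
    have sub : `]c', d'[%classic `<=` `]- n%:R, n%:R[%classic.
      by rewrite /c' /d' -setI_itvoo; exact: subIsetr.
    have i' : lam.-integrable `]c', d'[ (EFin \o w).
      by apply: (@integrableS _ R1 _ lam _ _ _ mI _ sub (iw n)); exact: measurable_itv.
    rewrite -[LHS]fineK; last first.
      by apply: (@integrable_fin_num _ R1 _ lam _ _ _ i'); exact: measurable_itv.
    by rewrite -/(Rintegral _ _ _) w0.
  have : ae_eq lam setT f (cst 0%E).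
    apply: ae_eq0_intervals => //.
      by rewrite -integral_mkcond -[X in integral _ X]setIid inter.
    by move=> c d; rewrite -integral_mkcondr inter.
  apply: filterS => t /(_ I) ft tn; move: ft.
  by rewrite /f patchE mem_set// => -[].
apply: filterS (ae_foralln key) => t Ht.
have [n tn] : exists n : nat, `|t| < n%:R.
  by exists (Num.truncn `|t|).+1; exact: truncnS_gt.
by apply: (Ht n); rewrite /= in_itv /= -ltr_norml.
Qed.

(** The extension of the Cauchy wavelet t |-> s! / (2 pi (1 - i t))^(s+1) to the
    upper half plane; the value at z is s! / (2 pi (1 - i z))^(s+1). *)
Definition wavelet_extension (s : nat) (z : R * R) : R[i] :=
  s`!%:R / ((2 * pi * (1 + z.2)) +i* (- (2 * pi * z.1))) ^+ s.+1.

(** On the frequency side the exponential decay of gabor adds to that of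
    the transform of psi, and the integral is an exponential moment. *)
Lemma poisson_wavelet s psi (a x : R) : is_cauchy_wavelet s psi -> 0 < a ->
  cintegral lam setT (fun t => psi t * (poisson a (x - t))%:C) = wavelet_extension s (x, a).
Proof.
move=> [Lp Fp] a0; rewrite (fourier_test x Fp Lp a0).
have p0 := @pi_gt0 R.
have b0 : 0 < 2 * pi * (1 + a) by rewrite !mulr_gt0// addr_gt0.
rewrite /wavelet_extension /= -(exp_moment s (2 * pi * x) b0).
transitivity (cintegral lam `]0, +oo[ (damped s (2 * pi * (1 + a)) (2 * pi * x))).
  rewrite [RHS]cintegral_mkcond; congr (cintegral _ _ _); apply/funext => w.
  rewrite mem_setE in_itv /= andbT; case: ifP => w0; last by rewrite mul0r.
  have E1 : w ^+ s * expR (- (2 * pi * (1 + a) * w)) =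
      w ^+ s * expR (- (2 * pi * w)) * double_exp a w.
    by rewrite /double_exp gtr0_norm// -[RHS]mulrA -expRD; congr (_ * expR _); ring.
  by rewrite /gabor [LHS]mulrA /damped E1; congr (_ * _); rewrite -rmorphM.
have [i1 i2] := cintegrable_damped s (2 * pi * x) b0.
have S (k : R -> R) : lam.-integrable `[0, +oo[ (EFin \o k) -> lam.-integrable `]0, +oo[ (EFin \o k).
  move=> ik; apply: (@integrableS _ R1 _ lam _ _ _ _ _ _ ik) => //.
  by move=> t /=; rewrite !in_itv /= !andbT => /ltW.
by rewrite /cintegral; congr Complex; apply: Rintegral_itv_obnd_cbnd; apply: S.
Qed.

Lemma wavelet_extension_le s (z : R * R) : 0 <= z.2 -> cmod (wavelet_extension s z) <= s`!%:R.
Proof.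
move=> z2; rewrite cmodM cmodV cmodX.
have -> : cmod (s`!%:R : R[i]) = s`!%:R.
  by rewrite -(rmorph_nat (@real_complex R)) cmod_real ger0_norm.
rewrite ler_piMr// invf_le1.
  rewrite exprn_ege1//; apply: le_trans (Re_le_cmod _); apply: le_trans (ler_norm _).
  rewrite /= mulr_ege1 ?lerDl//; apply: mulr_ege1; first by rewrite ler1n.
  by apply: le_trans (pi_ge2 R); rewrite ler1n.
rewrite exprn_gt0// cmod_gt0; apply/eqP => /(congr1 (@complex.Re R)) /= /eqP.
by rewrite gt_eqF// !mulr_gt0 ?pi_gt0// ltr_pwDl.
Qed.

Lemma wavelet_extension_cderiv s (z : R * R) : 0 <= z.2 ->
  exists d, cderiv (wavelet_extension s) z d.
Proof.
move=> z2.
pose L (w : R * R) : R[i] := (2 * pi * (1 + w.2)) +i* (- (2 * pi * w.1)).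
have dL : cderiv L z (0 -i* (2 * pi)).
  apply: (@cderiv_quadratic _ _ _ _ 0 1) => // v _.
  rewrite mul0r (_ : _ - _ - _ = 0) ?/cmod ?ComplexField.Normc.normc0//.
  by apply/eqP; rewrite eq_complex !ReB !ImB ReM ImM /=; apply/andP; split; apply/eqP; ring.
have Lz : L z != 0.
  apply/eqP => /(congr1 (@complex.Re R)) /= /eqP.
  by rewrite gt_eqF// !mulr_gt0 ?pi_gt0// ltr_pwDl.
have dX n : exists d, cderiv (fun w => L w ^+ n) z d.
  elim: n => [|n [d dn]]; first by exists 0; exact: cderiv_cst.
  exists (- ((2 * pi)%:C * 'i) * L z ^+ n + L z * d).
  have := cderivM dL dn; rewrite (_ : (fun w => _) = (fun w => L w ^+ n.+1)); last first.
    by apply/funext => w; rewrite exprS.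
  congr cderiv; congr (_ * _ + _); apply/eqP; rewrite eq_complex /=.
  by apply/andP; split; apply/eqP; ring.
have [d dn] := dX s.+1.
exists ((0 * L z ^+ s.+1 - s`!%:R * d) / (L z ^+ s.+1) ^+ 2).
by apply: cderiv_div; [rewrite expf_neq0|exact: cderiv_cst|exact: dn].
Qed.

Lemma wavelet_extension_cvg s (x : R) :
  complex.Re (wavelet_extension s (x, (n.+1%:R)^-1)) @[n --> \oo] --> complex.Re (wavelet_extension s (x, 0)) /\
  complex.Im (wavelet_extension s (x, (n.+1%:R)^-1)) @[n --> \oo] --> complex.Im (wavelet_extension s (x, 0)).
Proof.
have [d /cderiv_continuous[c1 c2]] := @wavelet_extension_cderiv s (x, 0) (lexx 0).
have cp : (x, (n.+1%:R)^-1 : R) @[n --> \oo] --> (x, 0 : R).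
  apply: (@cvg_comp _ _ _ (fun n : nat => (n.+1%:R)^-1 : R) (pair x) _ (nbhs (0 : R))).
    exact: cvg_harmonic.
  exact: continuous_pairr.
split.
  exact: (cvg_comp _ _ cp c1).
exact: (cvg_comp _ _ cp c2).
Qed.

Lemma wavelet_extension_measurable s (a : R) : 0 <= a ->
  cmeasurable setT (fun x => wavelet_extension s (x, a)).
Proof.
move=> a0.
have c (x : R) : ccontinuous_at (wavelet_extension s) (x, a).
  by have [d /cderiv_ccontinuous] := @wavelet_extension_cderiv s (x, a) a0.
split; apply: continuous_measurable_fun => x.
  apply: (@continuous_comp _ _ _ (fun x => (x, a)) (fun z => complex.Re (wavelet_extension s z))).
    exact: continuous_pairl.
  by have [] := c x.
apply: (@continuous_comp _ _ _ (fun x => (x, a)) (fun z => complex.Im (wavelet_extension s z))).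
  exact: continuous_pairl.
by have [] := c x.
Qed.
End WaveletIdentification.

Section WaveletFormula.
Context {R : realType}.
Local Notation lam := (@lebesgue_measure R).
Local Notation R1 := (measurableTypeR R).
Implicit Types (psi f : R -> R[i]).

(** The integral of the Poisson kernel of height a over [al, be]: it tends to
    the indicator of the interval as a tends to 0. *)
Definition smoothed_indicator (al be a t : R) : R :=
  (atan ((be - t) / a) - atan ((al - t) / a)) / pi.

Lemma continuous_poissonl (a t : R) : 0 < a -> continuous (fun x : R => poisson a (x - t)).
Proof.
move=> a0 x.
have -> : (fun x : R => poisson a (x - t)) = (fun x => poisson a (t - x)).
  by apply/funext => y; rewrite /poisson -(opprB t y) sqrrN.
exact: continuous_poisson.
Qed.

Lemma poisson_window (al be a t : R) : 0 < a -> al <= be ->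
  \int[lam]_(x in `[al, be]) poisson a (x - t) = smoothed_indicator al be a t.
Proof.
move=> a0 ab.
have d (x : R) : is_derive x 1 (fun x => atan ((x - t) / a) / pi) (poisson a (x - t)).
  have d1 : is_derive x 1 (fun x => (x - t) / a) a^-1.
    by apply: is_derive_eq; rewrite /GRing.scale /=; ring.
  have d2 := @is_derive1_comp _ atan (fun x => (x - t) / a) x _ _ (is_derive1_atan _) d1.
  have d3 := is_deriveM d2 (is_derive_cst (pi^-1 : R) x 1).
  apply: (is_derive_eq d3); rewrite /GRing.scale /= mulr0 add0r /poisson.
  have := pi_gt0 R; move: (pi : R) => P P0.
  have h : a ^+ 2 + (x - t) ^+ 2 != 0 by rewrite gt_eqF// ltr_pwDl ?sqr_ge0// exprn_gt0.
  have -> : 1 + ((x - t) / a) ^+ 2 = (a ^+ 2 + (x - t) ^+ 2) / a ^+ 2 by field; exact: lt0r_neq0.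
  by field; rewrite (lt0r_neq0 a0) (lt0r_neq0 P0) h.
rewrite (Rintegral_itv_derive ab (fun x _ => d x) (fun x _ => @continuous_poissonl a t a0 x)).
by rewrite /smoothed_indicator [RHS]mulrBl.
Qed.

Lemma smoothed_indicator_ge0 (al be a t : R) : 0 < a -> al <= be -> 0 <= smoothed_indicator al be a t.
Proof.
move=> a0 ab; rewrite divr_ge0 ?pi_ge0// subr_ge0 le_atan//.
by rewrite ler_pM2r ?invr_gt0// lerD2r.
Qed.

Lemma smoothed_indicator_le1 (al be a t : R) : smoothed_indicator al be a t <= 1.
Proof.
rewrite /smoothed_indicator ler_pdivrMr ?pi_gt0// mul1r.
have h1 := @atan_ltpi2 R ((be - t) / a); have h2 := @atan_gtNpi2 R ((al - t) / a).
lra.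
Qed.

Lemma poisson_tail (a x t M K : R) : 0 < a -> `|x| <= M -> 
  a * (1 + 2 * M ^+ 2) <= K * a ^+ 2 -> 2 * a <= K -> poisson a (x - t) <= K * (1 + t ^+ 2)^-1.
Proof.
move=> a0 xM h1 h2.
have M0 : 0 <= M by exact: le_trans (normr_ge0 x) xM.
have x2 : x ^+ 2 <= M ^+ 2 by rewrite -(real_normK (num_real x)) ler_pXn2r ?nnegrE.
have den : 0 < a ^+ 2 + (x - t) ^+ 2 by rewrite ltr_pwDl ?sqr_ge0// exprn_gt0.
have t1 : 0 < 1 + t ^+ 2 by rewrite ltr_pwDl// sqr_ge0.
apply: (@le_trans _ _ (a / (a ^+ 2 + (x - t) ^+ 2))).
  rewrite /poisson ler_wpM2l ?(ltW a0)// lef_pV2 ?posrE ?mulr_gt0 ?pi_gt0// ler_peMl ?(ltW den)//.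
  by apply: le_trans (pi_ge2 R); rewrite ler1n.
rewrite ler_pdivlMr// mulrAC ler_pdivrMr//.
have t2 : t ^+ 2 <= 2 * x ^+ 2 + 2 * (x - t) ^+ 2 by have := sqr_ge0 (2 * x - t); clear; lra.
apply: (@le_trans _ _ (a * (1 + 2 * M ^+ 2) + 2 * a * (x - t) ^+ 2)).
  have -> : a * (1 + 2 * M ^+ 2) + 2 * a * (x - t) ^+ 2 = a * (1 + 2 * M ^+ 2 + 2 * (x - t) ^+ 2) by ring.
  by rewrite ler_wpM2l ?(ltW a0)//; move: t2 x2; clear; lra.
rewrite [leRHS]mulrDr; apply: lerD => //; apply: ler_wpM2r => //; exact: sqr_ge0.
Qed.

(** A bound uniform in a, needed for dominated convergence.  For large t
    the distance from t to the interval is at least |t| / 2, and the Poisson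
    kernel is at most a constant times 1 / (1 + t^2). *)
Lemma smoothed_indicator_le (al be : R) : al <= be ->
  exists2 C : R, 0 <= C & forall a t : R, 0 < a -> a <= 1 ->
    smoothed_indicator al be a t <= C * (1 + t ^+ 2)^-1.
Proof.
(* at |t| <= 2 M the smoothed indicator is at most 1, and 1 + t^2 at most 1 + 4 M^2 *)
move=> ab; pose M : R := 1 + `|al| + `|be|.
have M1 : 1 <= M by rewrite /M -addrA lerDl addr_ge0.
have xM x : al <= x -> x <= be -> `|x| <= M.
  move=> ax xb; have := ler_norm be; have := ler_norm (- al); rewrite normrN => h1 h2.
  have := normr_ge0 al; have := normr_ge0 be.
  by rewrite ler_norml /M => h3 h4; apply/andP; split; lra.
have M0 : 0 <= M by lra.
exists (1 + 4 * M ^+ 2 + 16 * M).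
  by rewrite !addr_ge0// ?mulr_ge0// ?exprn_ge0.
move=> a t a0 a1; have t1 : 0 < 1 + t ^+ 2 by rewrite ltr_pwDl// sqr_ge0.
have M2 := sqr_ge0 M.
have [tM|tM] := leP `|t| (2 * M).
  apply: (le_trans (smoothed_indicator_le1 _ _ _ _)); rewrite ler_pdivlMr// mul1r.
  have : t ^+ 2 <= (2 * M) ^+ 2 by rewrite -(real_normK (num_real t)) ler_pXn2r ?nnegrE ?mulr_ge0.
  by rewrite exprMn; lra.
rewrite -poisson_window//.
have B x : `[al, be]%classic x -> poisson a (x - t) <= 8 * (1 + t ^+ 2)^-1.
  rewrite /= in_itv /= => /andP[ax xb]; have xm := xM x ax xb.
  have tt : t ^+ 2 <= 4 * (x - t) ^+ 2.
    rewrite -(real_normK (num_real t)) -(real_normK (num_real (x - t))).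
    have h : `|t| <= 2 * `|x - t|.
      have := ler_normD x (t - x); rewrite addrC subrK distrC; lra.
    have -> : 4 * `|x - t| ^+ 2 = (2 * `|x - t|) ^+ 2 by rewrite exprMn; congr (_ * _); ring.
    by rewrite ler_pXn2r ?nnegrE// mulr_ge0.
  have t21 : 1 <= t ^+ 2.
    rewrite -(real_normK (num_real t)) expr_ge1//; lra.
  have den : 0 < a ^+ 2 + (x - t) ^+ 2 by rewrite ltr_pwDl ?sqr_ge0// exprn_gt0.
  apply: (@le_trans _ _ (1 / (a ^+ 2 + (x - t) ^+ 2))).
    rewrite /poisson; apply: ler_pM => //; [exact: ltW| |].
      by rewrite invr_ge0 mulr_ge0 ?pi_ge0// ltW.
    rewrite lef_pV2 ?posrE ?mulr_gt0 ?pi_gt0// ler_peMl ?(ltW den)//.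
    by apply: le_trans (pi_ge2 R); rewrite ler1n.
  rewrite ler_pdivlMr// mulrAC ler_pdivrMr// mul1r.
  by have := sqr_ge0 a; lra.
apply: (@le_trans _ _ (\int[lam]_(x in `[al, be]) (8 * (1 + t ^+ 2)^-1))).
  apply: le_Rintegral; [exact: measurable_itv| | |exact: B].
    exact: (continuous_itv_integrable al be (@continuous_poissonl a t a0)).
  by apply: continuous_itv_integrable => x; exact: cvg_cst.
have dc (x : R) : is_derive x 1 (fun x => 8 * (1 + t ^+ 2)^-1 * x) (8 * (1 + t ^+ 2)^-1).
  by apply: is_derive_eq; rewrite /GRing.scale /=; ring.
rewrite (Rintegral_itv_derive ab (fun x _ => dc x) (fun x _ => @cvg_cst _ _ _ _ _)).
rewrite -mulrBr mulrAC; apply: ler_wpM2r; first by rewrite invr_ge0 ltW.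
have := xM al (lexx _) ab; have := xM be ab (lexx _); rewrite !ler_norml => /andP[_ h1] /andP[h2 _].
by lra.
Qed.

Definition L2_majorant psi (C t : R) : R := C * (cmod (psi t) ^+ 2 + (1 + t ^+ 2)^-1).

Lemma L2_majorant_integrable psi C : L2 psi -> lam.-integrable setT (EFin \o L2_majorant psi C).
Proof.
move=> Lp; have [i1 _] := @integrable_inv1Dsqr R.
exact: (integrableZl measurableT C (integrableD measurableT (L2_integrable Lp) i1)).
Qed.

Lemma L2_majorantP psi (C q t : R) : 0 <= C -> q <= C * (1 + t ^+ 2)^-1 ->
  cmod (psi t) * q <= L2_majorant psi C t.
Proof.
move=> C0 qC; have t1 : 0 < 1 + t ^+ 2 by rewrite ltr_pwDl// sqr_ge0.
apply: (le_trans (ler_wpM2l (cmod_ge0 _) qC)); rewrite mulrCA; apply: ler_wpM2l => //.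
set v := _^-1; have v0 : 0 <= v by rewrite invr_ge0 ltW.
have v1 : v <= 1 by rewrite invf_le1// lerDl sqr_ge0.
have vv : v ^+ 2 <= v by rewrite expr2 ler_piMr.
have := sqr_ge0 (cmod (psi t) - v); rewrite sqrrB; have := sqr_ge0 (cmod (psi t)); lra.
Qed.

Lemma L2_majorant_ge0 psi C t : 0 <= C -> 0 <= L2_majorant psi C t.
Proof.
move=> C0; apply: mulr_ge0 => //; apply: addr_ge0; first exact: sqr_ge0.
by rewrite invr_ge0; apply: addr_ge0 => //; exact: sqr_ge0.
Qed.

(** Fubini in the integral of poisson_wavelet over x in [al, be]. *)
Lemma wavelet_window s psi (al be a : R) : is_cauchy_wavelet s psi -> 0 < a -> al <= be ->
  cintegral lam setT (fun t => psi t * (smoothed_indicator al be a t)%:C) =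
  cintegral lam `[al, be] (fun x => wavelet_extension s (x, a)).
Proof.
move=> Wp a0 ab; have [Lp _] := Wp.
pose M : R := `|al| + `|be|.
have xM x : al <= x -> x <= be -> `|x| <= M.
  move=> ax xb; have := ler_norm be; have := ler_norm (- al); rewrite normrN => h1 h2.
  have := normr_ge0 al; have := normr_ge0 be.
  by rewrite ler_norml /M => h3 h4; apply/andP; split; lra.
have M0 : 0 <= M by rewrite addr_ge0.
pose K := (1 + 2 * M ^+ 2) / a + 2 * a.
have K0 : 0 <= K.
  by apply: addr_ge0; [apply: divr_ge0; [apply: addr_ge0 => //; apply: mulr_ge0 => //; exact: sqr_ge0|exact: ltW]|apply: mulr_ge0 => //; exact: ltW].
pose I (x : R) : R[i] := if x \in `[al, be]%classic then 1 else 0.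
pose H (z : R * R) := I z.1 * (psi z.2 * (poisson a (z.1 - z.2))%:C).
have mI : cmeasurable setT I.
  by apply: cmeasurable_if; [exact: measurable_itv|exact: cmeasurable_cst].
have mP : measurable_fun (setT : set (R1 * R1)) (fun z => poisson a (z.1 - z.2)).
  have mp : measurable_fun setT (fun u : R => poisson a (u - 0)).
    exact: (continuous_measurable_fun (@continuous_poissonl a 0 a0)).
  have md : measurable_fun (setT : set (R1 * R1)) (fun z => z.1 - z.2 : R1).
    by apply: measurable_funB; [exact: measurable_fst|exact: measurable_snd].
  have := measurableT_comp mp md; congr measurable_fun; apply/funext => z /=; by rewrite subr0.
have mH : cmeasurable (setT : set (R1 * R1)) H.
  apply: cmeasurableM.
    by apply: (@cmeasurable_comp _ _ (R1 * R1)%type fst); [exact: measurable_fst|exact: mI].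
  apply: cmeasurableM; last exact: cmeasurable_real.
  by apply: (@cmeasurable_comp _ _ (R1 * R1)%type snd); [exact: measurable_snd|exact: L2_cmeasurable].
pose A x := (1 + M ^+ 2) * (1 + x ^+ 2)^-1.
have iA : lam.-integrable setT (EFin \o A).
  by have [i1 _] := @integrable_inv1Dsqr R; exact: (integrableZl measurableT (1 + M ^+ 2) i1).
have A0 x : 0 <= A x.
  by apply: mulr_ge0; [|rewrite invr_ge0]; apply: addr_ge0 => //; exact: sqr_ge0.
have A1 x : al <= x -> x <= be -> 1 <= A x.
  move=> ax xb; rewrite /A ler_pdivlMr ?ltr_pwDl ?sqr_ge0// mul1r lerD2l.
  by rewrite -(real_normK (num_real x)) ler_pXn2r ?nnegrE// xM.
have KP x t : `|x| <= M -> poisson a (x - t) <= K * (1 + t ^+ 2)^-1.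
  move=> xm; apply: (poisson_tail t a0 xm).
    have -> : K * a ^+ 2 = a * (1 + 2 * M ^+ 2) + 2 * a * a ^+ 2.
      by rewrite /K; field; exact: lt0r_neq0.
    by rewrite lerDl; apply: mulr_ge0; [apply: mulr_ge0 => //; exact: ltW|exact: sqr_ge0].
  rewrite /K lerDr; apply: divr_ge0; last exact: ltW.
  by apply: addr_ge0 => //; apply: mulr_ge0 => //; exact: sqr_ge0.
have Hb x t : cmod (H (x, t)) <= A x * L2_majorant psi K t.
  have -> : H (x, t) = I x * (psi t * (poisson a (x - t))%:C) by [].
  rewrite cmodM cmodM /I; case: ifPn => [|_]; last first.
    rewrite /cmod ComplexField.Normc.normc0 mul0r; apply: mulr_ge0; first exact: A0.
    exact: L2_majorant_ge0.
  move=> xI; have /andP[ax xb] : al <= x <= be by move: xI; rewrite inE /= in_itv.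
  have xm := xM x ax xb; apply: ler_pM; [exact: cmod_ge0|by apply: mulr_ge0; exact: cmod_ge0| |].
    by rewrite /cmod ComplexField.Normc.normc1; exact: A1.
  by rewrite cmod_real (ger0_norm (poisson_ge0 (x - t) a0)); apply: L2_majorantP; [exact: K0|exact: KP].
have [F _] := cintegral_fubini mH iA (L2_majorant_integrable K Lp) A0 (fun t => L2_majorant_ge0 psi t K0) Hb.
transitivity (cintegral lam setT (fun t => cintegral lam setT (fun x => H (x, t)))).
  congr (cintegral _ _ _); apply/funext => t.
  pose P x : R[i] := if x \in `[al, be]%classic then (poisson a (x - t))%:C else 0.
  have iP : cintegrable lam setT P.
    have mp : measurable_fun setT (fun x : R => poisson a (x - t)).
      exact: (continuous_measurable_fun (@continuous_poissonl a t a0)).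
    have mPx : cmeasurable setT P.
      by apply: cmeasurable_if; [exact: measurable_itv|exact: cmeasurable_real].
    apply: (@cintegrable_le _ _ R1 lam setT P _ measurableT mPx
      (integrableZl measurableT (K * (1 + t ^+ 2)^-1) iA)) => x _.
    have Kt : 0 <= K * (1 + t ^+ 2)^-1.
      apply: mulr_ge0; first exact: K0.
      rewrite invr_ge0; apply: addr_ge0; [exact: ler01|exact: sqr_ge0].
    rewrite /P; case: ifPn => [|_]; last first.
      by rewrite /cmod ComplexField.Normc.normc0; apply: mulr_ge0; [exact: Kt|exact: A0].
    move=> xI; have /andP[ax xb] : al <= x <= be by move: xI; rewrite inE /= in_itv.
    rewrite cmod_real (ger0_norm (poisson_ge0 (x - t) a0)); apply: (le_trans (KP x t (xM x ax xb))).
    by apply: ler_peMr; [exact: Kt|exact: A1].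
  have -> : (fun x => H (x, t)) = (fun x => psi t * P x).
    apply/funext => x; rewrite /H /I /P /=; case: ifP => _; first by rewrite mul1r.
    by rewrite mul0r mulr0.
  rewrite (@cintegralZ _ _ R1 lam setT P (psi t) measurableT iP); congr (_ * _).
  rewrite -cintegral_mkcond /cintegral /= (poisson_window t a0 ab); congr Complex.
  by rewrite /Rintegral integral0.
rewrite -F [RHS]cintegral_mkcond; congr (cintegral _ _ _); apply/funext => x.
rewrite /H /I /=; case: ifP => _.
  rewrite -(poisson_wavelet x Wp a0); congr (cintegral _ _ _); apply/funext => t; exact: mul1r.
rewrite /cintegral; have -> : (fun t => complex.Re (0 * (psi t * (poisson a (x - t))%:C))) = (fun=> 0).
  by apply/funext => t; rewrite mul0r.
have -> : (fun t => complex.Im (0 * (psi t * (poisson a (x - t))%:C))) = (fun=> 0).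
  by apply/funext => t; rewrite mul0r.
by rewrite /Rintegral integral0.
Qed.
End WaveletFormula.

Section ClosedForm.
Context {R : realType}.
Local Notation lam := (@lebesgue_measure R).
Local Notation R1 := (measurableTypeR R).
Implicit Types (psi f : R -> R[i]).

Lemma cvg_atan_scale (k : R) : 0 < k -> atan (k / (n.+1%:R)^-1) @[n --> \oo] --> (pi / 2 : R).
Proof.
move=> k0; apply: (@cvg_comp _ _ _ (fun n : nat => k / (n.+1%:R)^-1) atan _ (pinfty_nbhs R)); last exact: cvgy_atan.
apply/cvgryPge => A; near=> n; rewrite invrK -ler_pdivrMl// mulrC.
have : A / k <= n%:R by near: n; exact: nbhs_infty_ger.
by move=> h; apply: (le_trans h); rewrite ler_nat.
Unshelve. all: by end_near.
Qed.

Lemma cvg_atan_scaleN (k : R) : k < 0 -> atan (k / (n.+1%:R)^-1) @[n --> \oo] --> (- (pi / 2) : R).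
Proof.
rewrite -oppr_gt0 => k0.
have -> : (fun n : nat => atan (k / (n.+1%:R)^-1)) = (fun n => - atan (- k / (n.+1%:R)^-1)).
  by apply/funext => n; rewrite mulNr atanN opprK.
by apply: cvgN; exact: cvg_atan_scale.
Qed.

Lemma smoothed_indicator_cvg (al be t : R) : al < be -> t != al -> t != be ->
  smoothed_indicator al be (n.+1%:R)^-1 t @[n --> \oo] -->
    (if t \in `]al, be[%classic then 1 else 0 : R).
Proof.
move=> ab ta tb; have p0 := pi_gt0 R.
have E (x y : R) : (fun n : nat => atan ((be - t) / (n.+1%:R)^-1)) @ \oo --> x ->
    (fun n : nat => atan ((al - t) / (n.+1%:R)^-1)) @ \oo --> y ->
    smoothed_indicator al be (n.+1%:R)^-1 t @[n --> \oo] --> (x - y) / pi.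
  by move=> hx hy; apply: cvgM; [exact: cvgB|exact: cvg_cst].
have pn0 : (pi : R) != 0 by exact: lt0r_neq0.
rewrite mem_setE in_itv /=; move: ta tb; rewrite !neq_lt => /orP[ta|ta] /orP[tb|tb].
- rewrite ltNge (ltW ta) /=.
  have -> : 0 = (pi / 2 - pi / 2) / pi :> R by rewrite subrr mul0r.
  by apply: E; apply: cvg_atan_scale; rewrite subr_gt0.
- by have := lt_trans ta (lt_trans ab tb); rewrite ltxx.
- rewrite ta tb /=.
  rewrite [X in _ --> X](_ : 1 = (pi / 2 - - (pi / 2)) / pi :> R); last by rewrite opprK -splitr divff.
  by apply: E; [apply: cvg_atan_scale; rewrite subr_gt0|apply: cvg_atan_scaleN; rewrite subr_lt0].
- rewrite (ltNge t be) (ltW tb) andbF.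
  have -> : 0 = (- (pi / 2) - - (pi / 2)) / pi :> R by rewrite subrr mul0r.
  by apply: E; apply: cvg_atan_scaleN; rewrite subr_lt0.
Qed.

Section Component.
(* P stands for the real or for the imaginary part *)
Variables (P : R[i] -> R) (s : nat) (psi : R -> R[i]).
Hypotheses (PZ : forall z q, P (z * q%:C) = P z * q)
  (PB : forall z w, P (z - w) = P z - P w)
  (Pc : forall z, `|P z| <= cmod z)
  (mP : forall g : R -> R[i], cmeasurable setT g -> measurable_fun setT (fun t => P (g t)))
  (PI : forall D g, P (cintegral lam D g) = \int[lam]_(t in D) P (g t))
  (Pcv : forall x : R, P (wavelet_extension s (x, (n.+1%:R)^-1)) @[n --> \oo] --> P (wavelet_extension s (x, 0)))
  (Wp : is_cauchy_wavelet s psi).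

Let Lp : L2 psi. Proof. by case: Wp. Qed.

Let inv_gt0 n : 0 < (n.+1%:R)^-1 :> R. Proof. by rewrite invr_gt0. Qed.

(** The limit a = 1 / (n + 1) of wavelet_window.  Both sides converge by
    dominated convergence, away from the two endpoints on the left side. *)
Lemma component_interval (al be : R) : al < be ->
  \int[lam]_(t in `]al, be[) P (psi t) = \int[lam]_(x in `[al, be]) P (wavelet_extension s (x, 0)).
Proof.
move=> ab.
have [C C0 HC] := smoothed_indicator_le (ltW ab).
have mpsi := mP (L2_cmeasurable Lp).
pose q n t := smoothed_indicator al be (n.+1%:R)^-1 t.
have mq n : measurable_fun setT (q n).
  have c (k : R) : continuous (fun t : R => atan ((k - t) / (n.+1%:R)^-1)).
    move=> t; apply: (@continuous_comp _ _ _ (fun t => (k - t) / (n.+1%:R)^-1) atan).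
      by apply: cvgM; [apply: cvgB; [exact: cvg_cst|exact: cvg_id]|exact: cvg_cst].
    exact: continuous_atan.
  apply: measurable_funM; last exact: measurable_cst.
  by apply: measurable_funB; apply: continuous_measurable_fun; exact: c.
have L1 : \int[lam]_(t in setT) (P (psi t) * q n t) @[n --> \oo] -->
    \int[lam]_(t in setT) ((fun t => P (psi t)) \_ `]al, be[) t.
  apply: (@Rintegral_dominated _ _ R1 lam setT (fun n t => P (psi t) * q n t) _ (L2_majorant psi C)).
  - exact: measurableT.
  - by move=> n; apply: measurable_funM; [exact: mpsi|exact: mq].
  - apply/(measurable_restrictT _ (measurable_itv _)); exact: measurable_funTS.
  - exists [set al; be]; split.
    + by apply: measurableU; exact: measurable_set1.
    + have m1 (k : R) : measurable ([set k] : set R1) by exact: measurable_set1.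
      exact: (@null_set_setU _ R1 _ lam _ _ (m1 al) (m1 be) (lebesgue_measure_set1 al) (lebesgue_measure_set1 be)).
    + move=> t /= Ht; apply: contrapT => tab; apply: Ht => _.
      have ta : t != al by apply/eqP => e; apply: tab; left.
      have tb : t != be by apply/eqP => e; apply: tab; right.
      rewrite patchE; have := smoothed_indicator_cvg ab ta tb.
      case: ifP => _ cv.
        by rewrite -[X in _ --> X]mulr1; apply: cvgM; [exact: cvg_cst|exact: cv].
      by rewrite -[X in _ --> X](mulr0 (P (psi t))); apply: cvgM; [exact: cvg_cst|exact: cv].
  - exact: L2_majorant_integrable.
  - move=> n t _; have q0 : 0 <= q n t by exact: smoothed_indicator_ge0 (inv_gt0 n) (ltW ab).
    rewrite normrM (ger0_norm q0); apply: (le_trans (ler_wpM2r q0 (Pc _))).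
    apply: L2_majorantP => //; apply: HC; first exact: inv_gt0.
    by rewrite invf_le1// ler1n.
have L2' : \int[lam]_(x in `[al, be]) P (wavelet_extension s (x, (n.+1%:R)^-1)) @[n --> \oo] -->
    \int[lam]_(x in `[al, be]) P (wavelet_extension s (x, 0)).
  have mI : measurable (`[al, be]%classic : set R1) by exact: measurable_itv.
  apply: (@Rintegral_dominated _ _ R1 lam `[al, be] (fun n x => P (wavelet_extension s (x, (n.+1%:R)^-1))) _ (fun=> s`!%:R)).
  - exact: mI.
  - by move=> n; apply: measurable_funTS; apply: mP; exact: (wavelet_extension_measurable s (ltW (inv_gt0 n))).
  - by apply: measurable_funTS; apply: mP; exact: (wavelet_extension_measurable s (lexx (0 : R))).
  - by apply: aeW => x _; exact: Pcv.
  - by apply: continuous_itv_integrable => x; exact: cvg_cst.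
  - move=> n x _; apply: (le_trans (Pc _)); exact: (wavelet_extension_le s (z := (x, (n.+1%:R)^-1)) (ltW (inv_gt0 n))).
have E n : \int[lam]_(t in setT) (P (psi t) * q n t) =
    \int[lam]_(x in `[al, be]) P (wavelet_extension s (x, (n.+1%:R)^-1)).
  have := congr1 P (wavelet_window Wp (inv_gt0 n) (ltW ab)); rewrite !PI => <-.
  by apply: eq_Rintegral => t _; rewrite PZ.
have L3 : \int[lam]_(t in setT) (P (psi t) * q n t) @[n --> \oo] -->
    \int[lam]_(x in `[al, be]) P (wavelet_extension s (x, 0)).
  rewrite (_ : (fun n => _) = (fun n => \int[lam]_(x in `[al, be]) P (wavelet_extension s (x, (n.+1%:R)^-1)))).
    exact: L2'.
  by apply/funext => n; exact: E.
by rewrite [LHS]Rintegral_mkcond; exact: (cvg_unique _ L1 L3).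
Qed.

Lemma component_ae : {ae lam, forall t, P (psi t) - P (wavelet_extension s (t, 0)) = 0}.
Proof.
have mpsi := mP (L2_cmeasurable Lp).
have mext := mP (wavelet_extension_measurable s (lexx (0 : R))).
have one n t : `]- n%:R, n%:R[%classic t -> 1 <= window_majorant psi n t.
  rewrite /= in_itv /= -ltr_norml => /ltW tn; rewrite /window_majorant.
  apply: (@le_trans _ _ ((1 + n%:R ^+ 2) * (1 + t ^+ 2)^-1)); last by rewrite lerDl sqr_ge0.
  rewrite ler_pdivlMr ?ltr_pwDl ?sqr_ge0// mul1r lerD2l.
  by rewrite -(real_normK (num_real t)) ler_pXn2r ?nnegrE.
have mI n : measurable (`]- n%:R, n%:R[%classic : set R1) by exact: measurable_itv.
have iM n : lam.-integrable `]- n%:R, n%:R[ (EFin \o window_majorant psi n).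
  by apply: (@integrableS _ R1 _ lam _ _ _ measurableT (mI n) _ (integrable_window_majorant n Lp)).
have i1 n : lam.-integrable `]- n%:R, n%:R[ (EFin \o (fun t => P (psi t))).
  apply: (le_integrable (mI n) _ _ (iM n)).
    by apply/measurable_EFinP; exact: measurable_funTS.
  move=> t tn; rewrite /= lee_fin; apply: le_trans (ler_norm _); apply: (le_trans (Pc _)).
  have := window_le psi n t; rewrite /window mem_set//.
  by move: tn; rewrite /= !in_itv /= => /andP[/ltW -> /ltW ->].
have i2 n : lam.-integrable `]- n%:R, n%:R[ (EFin \o (fun t => P (wavelet_extension s (t, 0)))).
  apply: (le_integrable (mI n) _ _ (integrableZl (mI n) s`!%:R (iM n))).
    by apply/measurable_EFinP; exact: measurable_funTS.
  move=> t tn; rewrite /= lee_fin; apply: le_trans (ler_norm _); apply: (le_trans (Pc _)).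
  apply: (le_trans (wavelet_extension_le s (z := (t, 0)) (lexx _))).
  by rewrite ler_peMr// one.
apply: ae_eq0_locally => [n|c d cd]; first exact: (integrableB (mI n) (i1 n) (i2 n)).
have [n [cn dn]] : exists n : nat, - n%:R < c /\ d < n%:R.
  exists (Num.truncn (`|c| + `|d|)).+1.
  have h := truncnS_gt (`|c| + `|d|); have := ler_norm d; have := ler_norm (- c); rewrite normrN.
  have := normr_ge0 c; have := normr_ge0 d; move: h; set N := _%:R => h h1 h2 h3 h4; split; lra.
have sub : `[c, d]%classic `<=` `]- n%:R, n%:R[%classic.
  move=> t /=; rewrite !in_itv /= => /andP[ct td].
  by rewrite (lt_le_trans cn ct) (le_lt_trans td dn).
have m1 : measurable (`[c, d]%classic : set R1) by exact: measurable_itv.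
have m2 : measurable (`]c, d]%classic : set R1) by exact: measurable_itv.
have m3 : measurable (`]c, d[%classic : set R1) by exact: measurable_itv.
have s21 : `]c, d]%classic `<=` `[c, d]%classic by exact: subset_itv_oc_cc.
have s32 : `]c, d[%classic `<=` `]c, d]%classic by exact: subset_itv_oo_oc.
have s31 := subset_trans s32 s21.
have j1 := @integrableS _ R1 _ lam _ _ _ (mI n) m3 (subset_trans s31 sub) (i1 n).
have j2 := @integrableS _ R1 _ lam _ _ _ (mI n) m3 (subset_trans s31 sub) (i2 n).
have j2' := @integrableS _ R1 _ lam _ _ _ (mI n) m2 (subset_trans s21 sub) (i2 n).
rewrite (RintegralB m3 j1 j2) (component_interval cd).
by rewrite -(Rintegral_itv_obnd_cbnd j2') -(Rintegral_itv_bndo_bndc j2) subrr.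
Qed.
End Component.

Lemma ae1_mono2 (P Q S : R -> Prop) :
  {ae lam, forall t, P t} -> {ae lam, forall t, Q t} ->
  (forall t, P t -> Q t -> S t) -> {ae lam, forall t, S t}.
Proof.
move=> aeP aeQ PQS; have FF := @ae_filter_ringOfSetsType _ R1 R lam.
exact: (@filterS2 _ _ FF _ _ _ PQS aeP aeQ).
Qed.

Lemma ae1_mono (P S : R -> Prop) : {ae lam, forall t, P t} ->
  (forall t, P t -> S t) -> {ae lam, forall t, S t}.
Proof. by move=> aeP PS; apply: (ae1_mono2 aeP aeP) => t Pt _; exact: PS. Qed.

(** The real and the imaginary part separately: both are instances of the
    same abstract component P. *)
Lemma cauchy_wavelet_ae s psi : is_cauchy_wavelet s psi ->
  {ae lam, forall t, psi t = wavelet_extension s (t, 0)}.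
Proof.
move=> Wp.
have ReZ (z : R[i]) q : complex.Re (z * q%:C) = complex.Re z * q by rewrite ReM /= mulr0 subr0.
have ImZ (z : R[i]) q : complex.Im (z * q%:C) = complex.Im z * q by rewrite ImM /= mulr0 add0r.
have A1 := component_ae ReZ (@Re_le_cmod R) (fun g mg => mg.1) (fun _ _ => erefl)
  (fun x => (wavelet_extension_cvg s x).1) Wp.
have A2 := component_ae ImZ (@Im_le_cmod R) (fun g mg => mg.2) (fun _ _ => erefl)
  (fun x => (wavelet_extension_cvg s x).2) Wp.
apply: (ae1_mono2 A1 A2) => t /eqP; rewrite subr_eq0 => /eqP h1 /eqP; rewrite subr_eq0 => /eqP h2.
by apply/eqP; rewrite eq_complex h1 h2 !eqxx.
Qed.

Lemma ae_affine (x y : R) (Q : R -> Prop) : 0 < y -> {ae lam, forall t, Q t} ->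
  {ae lam, forall t, Q ((t - x) / y)}.
Proof.
move=> y0 [N [mN N0 QN]].
pose g (t : R) : R := (t - x) / y.
have mg : measurable_fun setT g.
  by apply: measurable_funM; [exact: measurable_funB|exact: measurable_cst].
have mgN : measurable (g @^-1` N) by rewrite -[X in measurable X]setTI; exact: mg.
exists (g @^-1` N); split; [exact: mgN| |by move=> t nQ; apply: QN].
have mI : measurable_fun setT (fun t => (\1_(g @^-1` N) t)%:E : \bar R).
  by apply/measurable_EFinP; exact: measurable_indic.
have I0 t : (0 <= (\1_(g @^-1` N) t)%:E :> \bar R)%E by rewrite lee_fin.
have := ge0_integral_affine x y0 mI I0.
rewrite integral_indic// setIT => ->.
have -> : (fun u : R => (\1_(g @^-1` N) (y * u + x))%:E : \bar R) = (fun u => (\1_N u)%:E).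
  apply/funext => u; rewrite !indicE; congr (_%:R%:E); congr nat_of_bool.
  apply/idP/idP; rewrite !inE /g /= addrK mulrC mulKf//; exact: lt0r_neq0.
transitivity (y%:E * lam N)%E; last by rewrite N0 mule0.
by congr (_ * _)%E; rewrite -[in RHS](setIT N); exact: (@integral_indic _ R1 R lam setT measurableT N mN).
Qed.

Definition wavelet_constant (s : nat) : R[i] := s`!%:R / (0 +i* (2 * pi)) ^+ s.+1.

Lemma wavelet_constant_neq0 s : wavelet_constant s != 0.
Proof.
apply: mulf_neq0; first by rewrite pnatr_eq0 -lt0n fact_gt0.
rewrite invr_eq0 expf_neq0//; apply/eqP => /(congr1 (@complex.Im R)) /= /eqP.
by rewrite gt_eqF// mulr_gt0// pi_gt0.
Qed.

(** 1 + i (t - x) / y = i (t - (x + iy)) / y, and the conjugate of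
    the wavelet at (t - x) / y is a power of its inverse. *)
Lemma conj_wavelet_extension s (z : R * R) t : 0 < z.2 ->
  conjc (wavelet_extension s ((t - z.1) / z.2, 0)) =
  wavelet_constant s * (z.2 ^+ s.+1)%:C * cauchy_kernel z t ^+ s.+1.
Proof.
move=> z2; have nk := kernel_nonzero t z2.
have n2 : (0 +i* (2 * pi) : R[i]) != 0.
  apply/eqP => /(congr1 (@complex.Im R)) /= /eqP; by rewrite gt_eqF// mulr_gt0// pi_gt0.
have nz : (z.2%:C : R[i]) != 0 by apply/eqP => /(congr1 (@complex.Re R)) /= /eqP; rewrite gt_eqF.
have C : @conjc R ((2 * pi * (1 + 0)) +i* (- (2 * pi * ((t - z.1) / z.2)))) =
   (0 +i* (2 * pi)) * (t%:C - toC z) / z.2%:C.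
  apply: (mulIf nz); rewrite divfK//; apply/eqP; rewrite eq_complex !ReM !ImM ReB ImB /=.
  by apply/andP; split; apply/eqP; field; exact: lt0r_neq0.
rewrite /wavelet_extension /wavelet_constant rmorphM rmorph_nat fmorphV rmorphXn.
transitivity ((s`!%:R : R[i]) / ((0 +i* (2 * pi)) * (t%:C - toC z) / z.2%:C) ^+ s.+1).
  by congr (_ / _ ^+ _); exact: C.
rewrite /cauchy_kernel rmorphXn /= !exprMn !exprVn.
have F (a n k w : R[i]) : n != 0 -> k != 0 -> w != 0 -> a / (n * k / w) = a / n * w * k^-1.
  by move=> n0 k0 w0; field; rewrite n0 k0 w0.
by apply: F; apply: expf_neq0.
Qed.

(** The wavelet may be replaced by its closed form, because an affine change of
    variable preserves null sets. *)
Lemma wavelet_transformE s psi f (z : R * R) : is_cauchy_wavelet s psi -> L2 f -> 0 < z.2 ->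
  wavelet_transform psi f z =
  (wavelet_constant s * ((Num.sqrt z.2)^-1 * z.2 ^+ s.+1)%:C) * cauchy_integral f s.+1 z.
Proof.
move=> Wp Lf z2; have [Lp _] := Wp.
pose g t := f t * cauchy_kernel z t ^+ s.+1.
have ig : cintegrable lam setT g by exact: kernel_power_integrable.
have mg : cmeasurable setT (fun t => (wavelet_constant s * (z.2 ^+ s.+1)%:C) * g t).
  by apply: cmeasurableM; [exact: cmeasurable_cst|exact: kernel_power_measurable].
have mw : cmeasurable setT (fun t => f t * conjc (psi ((t - z.1) / z.2))).
  apply: cmeasurableM; first exact: L2_cmeasurable.
  have ma : measurable_fun setT (fun t : R1 => (t - z.1) / z.2 : R1).
    by apply: measurable_funM; [exact: measurable_funB|exact: measurable_cst].
  exact: (cmeasurable_conj (@cmeasurable_comp _ _ R1 _ psi ma (L2_cmeasurable Lp))).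
have A : {ae lam, forall t, f t * conjc (psi ((t - z.1) / z.2)) = (wavelet_constant s * (z.2 ^+ s.+1)%:C) * g t}.
  apply: (ae1_mono (ae_affine z.1 z2 (cauchy_wavelet_ae Wp))) => t ->.
  by rewrite conj_wavelet_extension// /g mulrCA.
have E : cintegral lam setT (fun t => f t * conjc (psi ((t - z.1) / z.2))) =
    cintegral lam setT (fun t => (wavelet_constant s * (z.2 ^+ s.+1)%:C) * g t).
  have [w1 w2] := mw; have [g1 g2] := mg.
  rewrite /cintegral /Rintegral; congr (fine _ +i* fine _).
    apply: (@ae_eq_integral _ R1 R lam setT) => //; [exact/measurable_EFinP|exact/measurable_EFinP|].
    by apply: (ae1_mono A) => t /= -> _.
  apply: (@ae_eq_integral _ R1 R lam setT) => //; [exact/measurable_EFinP|exact/measurable_EFinP|].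
  by apply: (ae1_mono A) => t /= -> _.
rewrite /wavelet_transform gtr0_norm// E.
rewrite (@cintegralZ _ _ R1 lam setT g _ measurableT ig) /cauchy_integral rmorphM -/g.
by rewrite mulrA (mulrCA _ (wavelet_constant s)).
Qed.
End ClosedForm.

(** * Discs and the real axis *)

Section Geometry.
Context {R : realType}.
Implicit Types (z w : R * R).

(** The closure of the open disc lies in the closed one. *)
Lemma annulus_subset z0 (r S : R) : annulus z0 r S `<=` disc S z0 `\` closure (disc r z0).
Proof.
move=> w /andP[rw wS]; split=> // wr.
have cl : closed [set w | enorm (w - z0) <= r].
  rewrite (_ : [set w | _] = (fun w => enorm (w - z0)) @^-1` [set x | x <= r])//.
  by apply: closed_comp; [move=> v _; exact: continuous_enormB|exact: closed_le].
have sub : disc r z0 `<=` [set w | enorm (w - z0) <= r] by move=> v /ltW.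
have : [set w | enorm (w - z0) <= r] w.
  by rewrite (iffLR (closure_id _) cl); exact: (closure_subset sub).
by rewrite /= leNgt rw.
Qed.

Lemma snd_le_enorm z0 w : `|w.2 - z0.2| <= enorm (w - z0).
Proof. by rewrite -[_ - _]/((w - z0).2) enorm_toC; exact: (Im_le_cmod (toC (w - z0))). Qed.

Lemma disc_upper_half (z0 : R * R) (S : R) : S <= z0.2 -> disc S z0 `<=` [set z | 0 < z.2].
Proof.
move=> Sy w wS /=; have := le_lt_trans (snd_le_enorm z0 w) (lt_le_trans wS Sy).
by rewrite ltr_norml => /andP[]; lra.
Qed.

(** If S exceeded the height of the center, then some circle of radius between
    r and S would meet the real axis. *)
Lemma radius_le_height (u : R * R -> R) (z0 : R * R) (r S : R) : 0 <= r -> r < S -> 0 < z0.2 ->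
  (forall z, annulus z0 r S z -> 0 < u z) -> (forall x, u (x, 0) = 0) -> S <= z0.2.
Proof.
move=> r0 rS y0 u0 uz; rewrite leNgt; apply/negP => yS.
(* a radius p in ]r, S[ larger than the height; the circle meets the axis at distance sqrt (p^2 - y0^2) from x0 *)
pose m := Num.max r z0.2; pose p := (m + S) / 2.
have mS : m < S by rewrite /m gt_max rS.
have rm : r <= m by rewrite le_max lexx.
have ym : z0.2 <= m by rewrite le_max lexx orbT.
have pm : m < p by rewrite /p; lra.
have pS : p < S by rewrite /p; lra.
have p0 : 0 <= p by lra.
have py : 0 <= p ^+ 2 - z0.2 ^+ 2.
  by rewrite subr_ge0 ler_pXn2r ?nnegrE//; lra.
have := u0 (z0.1 + Num.sqrt (p ^+ 2 - z0.2 ^+ 2), 0); rewrite uz ltxx => H.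
apply: notF; apply: H; rewrite /annulus /= /enorm /= (addrC z0.1) addrK sub0r sqrrN sqr_sqrtr//.
by rewrite subrK sqrtr_sqr ger0_norm// (le_lt_trans rm pm) pS.
Qed.
End Geometry.

(** * Constants *)

Section Constants.
Context {R : realType}.

(** The function rho of the statement. *)
Definition hole_factor (s : nat) (q : R) : R := 1 + 2 ^+ (2 * s + 2) / (1 - q) ^+ s.+1.

Lemma hole_factor_ge1 s q : q < 1 -> 1 <= hole_factor s q.
Proof. by move=> q1; rewrite lerDl divr_ge0// exprn_ge0// subr_ge0 ltW. Qed.

Lemma hole_factor_mono s (q q' : R) : q <= q' -> q' < 1 -> hole_factor s q <= hole_factor s q'.
Proof.
move=> qq q1; rewrite lerD2l ler_wpM2l// lef_pV2 ?posrE ?exprn_gt0 ?subr_gt0//; last exact: le_lt_trans q1.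
rewrite lerXn2r ?nnegrE ?subr_ge0 ?lerB ?(ltW q1)//; apply: ltW; exact: le_lt_trans q1.
Qed.

Lemma hole_factor_half s : 2 <= hole_factor s (1 / 2 : R).
Proof.
have h : 0 < (1 - 1 / 2 : R) ^+ s.+1 by apply: exprn_gt0; lra.
rewrite /hole_factor -[leLHS]/(1 + 1 : R) lerD2l ler_pdivlMr// [1 * _ ^+ _]mul1r.
apply: (@le_trans _ _ 1); last by rewrite exprn_ege1// ler1n.
by apply: exprn_ile1; lra.
Qed.

Lemma hole_factor_continuous s : {within `[0, 1[, continuous (hole_factor s)}.
Proof.
apply: continuous_in_subspaceT => q; rewrite inE /= in_itv /= => /andP[_ q1].
apply: cvgD; first exact: cvg_cst.
apply: cvgM; first exact: cvg_cst.
apply: cvgV; first by rewrite expf_neq0// gt_eqF// subr_gt0.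
apply: (@continuous_comp _ _ _ (fun q : R => 1 - q) (fun x => x ^+ s.+1)); last exact: exprn_continuous.
by apply: cvgB; [exact: cvg_cst|exact: cvg_id].
Qed.

(** The left side is the constant of disc_le_annulus for the intermediate radius
    (r + S) / 2 and the weight y^(2s+1): with q = r / S it equals
    1 + (4 / (1 - q))^(2s+1) 2 q / (1 - q), at most 1 + (4 / (1 - q))^(2s+2),
    and (4 / (1 - q))^(2s+2) is the square of hole_factor - 1. *)
Lemma hole_factor_sqr s (r S y : R) : 0 <= r -> r < S -> 0 < y ->
  1 + (2 * y) ^+ (2 * s + 1) / (y * (1 - r / S) / 2) ^+ (2 * s + 1) * (r / ((r + S) / 2 - r))
    <= hole_factor s (r / S) ^+ 2.
Proof.
move=> r0 rS y0; have S0 : 0 < S by exact: le_lt_trans rS.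
set q := r / S; have q0 : 0 <= q by rewrite divr_ge0// ltW.
have q1 : q < 1 by rewrite ltr_pdivrMr// mul1r.
have e0 : 0 < 1 - q by rewrite subr_gt0.
have -> : r / ((r + S) / 2 - r) = 2 * q / (1 - q).
  by rewrite /q; field; rewrite !gt_eqF ?subr_gt0//=; lra.
have -> : (2 * y) ^+ (2 * s + 1) / (y * (1 - q) / 2) ^+ (2 * s + 1) = (4 / (1 - q)) ^+ (2 * s + 1).
  by rewrite -expr_div_n; congr (_ ^+ _); field; rewrite !gt_eqF.
set B := 2 ^+ (2 * s + 2) / (1 - q) ^+ s.+1.
have B0 : 0 <= B by rewrite divr_ge0// exprn_ge0// ltW.
have -> : hole_factor s q = 1 + B by [].
have -> : (1 + B) ^+ 2 = 1 + (2 * B + B ^+ 2) by ring.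
rewrite lerD2l; apply: (@le_trans _ _ (B ^+ 2)); last by rewrite lerDr mulr_ge0.
have B2 : B ^+ 2 = (4 / (1 - q)) ^+ (2 * s + 1) * (4 / (1 - q)).
  rewrite -exprSr /B expr_div_n -!exprM [in RHS]expr_div_n; congr (_ / _).
    by rewrite (_ : 4 = 2 ^+ 2 :> R); [rewrite -exprM; congr (_ ^+ _); lia|ring].
  by congr (_ ^+ _); lia.
rewrite B2; apply: ler_wpM2l; first by rewrite exprn_ge0// divr_ge0// ltW.
by rewrite ler_pM2r ?invr_gt0//; lra.
Qed.

(** Write q = r / S and H for hole_factor at q.  If q <= 1/2 then H is bounded
    and 1 + H S already dominates 1 + S.  If q > 1/2 then
    sqrt r (sqrt S + 1 / sqrt S) = sqrt q (1 + S) is comparable to 1 + S, so the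
    second factor supplies H (1 + S).  The power is at least 1 throughout. *)
Lemma radius_constant (s : nat) (P r S y e : R) : 0 < P -> 0 <= r -> r < S -> S <= y -> 0 <= e ->
  hole_factor s (r / S) * (P * S + 2) <=
  (P + 2) * hole_factor s (1 / 2) *
   ((1 + hole_factor s (r / S) * S) *
    (1 + Num.sqrt r * hole_factor s (r / S) * (Num.sqrt S + (Num.sqrt S)^-1) * `|1 / (1 - r / y)| `^ e)).
Proof.
move=> P0 r0 rS Sy e0; have S0 : 0 < S by exact: le_lt_trans rS.
have y0 : 0 < y by exact: lt_le_trans Sy.
set q := r / S; have q0 : 0 <= q by rewrite divr_ge0// ltW.
have q1 : q < 1 by rewrite ltr_pdivrMr// mul1r.
have X1 : 1 <= `|1 / (1 - r / y)| `^ e.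
  have ry1 : r / y < 1 by rewrite ltr_pdivrMr// mul1r; exact: lt_le_trans Sy.
  have ry0 : 0 <= r / y by rewrite divr_ge0// ltW.
  have h : 1 <= `|1 / (1 - r / y)|.
    by rewrite ger0_norm ?divr_ge0 ?subr_ge0 ?(ltW ry1)// ler_pdivlMr ?subr_gt0// mul1r lerBlDr lerDl.
  have e1 : 1 `^ e = 1 :> R by rewrite powR1.
  by rewrite -[leLHS]e1; apply: ge0_ler_powR; rewrite ?nnegrE.
have H1 := hole_factor_ge1 s q1; have H2 := hole_factor_half s.
set H := hole_factor s q in H1 *; set K := hole_factor s (1 / 2) in H2 *.
set X := _ `^ _ in X1 *.
have sq : Num.sqrt r * (Num.sqrt S + (Num.sqrt S)^-1) = Num.sqrt q * (S + 1).
  have sS : 0 < Num.sqrt S by rewrite sqrtr_gt0.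
  have -> : Num.sqrt r = Num.sqrt q * Num.sqrt S by rewrite -sqrtrM// divfK// gt_eqF.
  have SS : Num.sqrt S * Num.sqrt S = S by rewrite -expr2 sqr_sqrtr// ltW.
  by rewrite -mulrA mulrDr SS divff// gt_eqF.
have sq0 : 0 <= Num.sqrt q by exact: sqrtr_ge0.
have HS0 : 0 <= H * S by apply: mulr_ge0; lra.
have base : P * S + 2 <= (P + 2) * (1 + S) by nra.
have E : Num.sqrt r * H * (Num.sqrt S + (Num.sqrt S)^-1) * X = H * (Num.sqrt q * (S + 1)) * X.
  by rewrite -sq; ring.
rewrite E; set Y := H * _ * X.
have Y0 : 0 <= Y.
  by apply: mulr_ge0; [apply: mulr_ge0; [lra|apply: mulr_ge0; lra]|lra].
have [qh|qh] := leP q (1 / 2).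
  have HK : H <= K by apply: hole_factor_mono => //; lra.
  apply: (@le_trans _ _ (K * ((P + 2) * (1 + S)))).
    by apply: ler_pM => //; [lra|apply: addr_ge0 => //; apply: mulr_ge0; lra].
  rewrite mulrA (mulrC K); apply: ler_wpM2l; first by apply: mulr_ge0; lra.
  apply: (@le_trans _ _ (1 + H * S)); last by rewrite ler_peMr//; lra.
  by rewrite lerD2l ler_peMl// ltW.
have sqh : 1 / 2 <= Num.sqrt q.
  have -> : 1 / 2 = Num.sqrt ((1 / 2) ^+ 2) :> R by rewrite sqrtr_sqr ger0_norm//; lra.
  by rewrite ler_wsqrtr//; lra.
have YH : H * (S + 1) <= 2 * Y.
  rewrite /Y -!mulrA (mulrCA 2); apply: ler_wpM2l; first by lra.
  apply: (@le_trans _ _ (2 * (Num.sqrt q * (S + 1)))); first by nra.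
  by apply: ler_wpM2l => //; rewrite mulrA; apply: ler_peMr => //; apply: mulr_ge0; lra.
apply: (@le_trans _ _ ((P + 2) * (H * (S + 1)))).
  by rewrite mulrCA (addrC S); apply: ler_wpM2l => //; lra.
rewrite -mulrA; apply: ler_wpM2l; first by lra.
apply: (le_trans YH); apply: ler_pM => //.
apply: (@le_trans _ _ (1 + Y)); first by lra.
by apply: ler_peMl; lra.
Qed.

(** sqrt (x + y) <= sqrt x + sqrt y, allowing infinite values. *)
Lemma sqrte_le_split (a : R) (X x y : \bar R) : 0 < a -> (0 <= x)%E -> (0 <= y)%E ->
  (X <= (a ^+ 2)%:E * (x + y))%E -> (sqrte X <= a%:E * (sqrte x + sqrte y))%E.
Proof.
move=> a0; case: x => [x| |] //; case: y => [y| |] //= x0 y0; last 3 first.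
- by move=> _; rewrite addey// gt0_muley ?lte_fin// leey.
- by move=> _; rewrite addye// gt0_muley ?lte_fin// leey.
- by move=> _; rewrite gt0_muley ?lte_fin// leey.
rewrite !lee_fin in x0 y0.
case: X => [X| |] //=; last by move=> _; rewrite -EFinD -EFinM lee_fin mulr_ge0 ?(ltW a0)// addr_ge0 ?sqrtr_ge0.
rewrite -!EFinD -!EFinM !lee_fin => HX.
have b0 : 0 <= a * (Num.sqrt x + Num.sqrt y) by rewrite mulr_ge0 ?(ltW a0)// addr_ge0 ?sqrtr_ge0.
rewrite -(ger0_norm b0) -sqrtr_sqr ler_wsqrtr// (le_trans HX)// exprMn ler_wpM2l ?sqr_ge0//.
have := sqrtr_ge0 x; have := sqrtr_ge0 y => h1 h2.
have := mulr_ge0 h1 h2; rewrite sqrrD !sqr_sqrtr// => h3; lra.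
Qed.
End Constants.

(** * Wavelet transforms on discs *)

Section WaveletDiscs.
Context {R : realType}.
Local Notation R1 := (measurableTypeR R).
Implicit Types (psi f g : R -> R[i]) (z w : R * R).

(** The square of the modulus of the factor between W f and the Cauchy
    integral of f. *)
Definition wavelet_weight (s : nat) z : R := cmod (@wavelet_constant R s) ^+ 2 * z.2 ^+ (2 * s + 1).

Lemma wavelet_constant_sqr_gt0 s : 0 < cmod (@wavelet_constant R s) ^+ 2.
Proof. by rewrite exprn_gt0// cmod_gt0 wavelet_constant_neq0. Qed.

Lemma wavelet_factor_sqr s (y : R) : 0 < y ->
  ((Num.sqrt y)^-1 * y ^+ s.+1) ^+ 2 = y ^+ (2 * s + 1).
Proof.
move=> y0; rewrite exprMn exprVn sqr_sqrtr ?(ltW y0)// -exprM.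
have -> : (s.+1 * 2 = (2 * s + 1).+1)%N by lia.
by rewrite exprS mulKf// gt_eqF.
Qed.

Lemma cmod_wavelet_combination s psi f g (k : R[i]) z :
  is_cauchy_wavelet s psi -> L2 f -> L2 g -> 0 < z.2 ->
  cmod (wavelet_transform psi f z - k * wavelet_transform psi g z) ^+ 2 =
  wavelet_weight s z * cmod (cauchy_integral f s.+1 z - k * cauchy_integral g s.+1 z) ^+ 2.
Proof.
move=> Wp Lf Lg z2; rewrite (wavelet_transformE Wp Lf z2) (wavelet_transformE Wp Lg z2).
rewrite mulrCA -mulrBr cmodM (cmodM (wavelet_constant s)) cmod_real exprMn (exprMn 2 (cmod _)).
by rewrite real_normK ?num_real// wavelet_factor_sqr.
Qed.

Lemma cauchy_combination_holomorphic s f g (k : R[i]) : L2 f -> L2 g ->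
  holomorphic [set z : R * R | 0 < z.2]
    (fun z => cauchy_integral f s.+1 z - k * cauchy_integral g s.+1 z)
    (fun z => s.+1%:R * cauchy_integral f s.+2 z - k * (s.+1%:R * cauchy_integral g s.+2 z)).
Proof.
move=> Lf Lg z /= z2; split.
  exact: cderiv_lin (cauchy_integral_cderiv s Lf z2) (cauchy_integral_cderiv s Lg z2).
apply: cderiv_ccontinuous; apply: cderiv_lin.
  exact: (cderivM (cderiv_cst _ z) (cauchy_integral_cderiv s.+1 Lf z2)).
exact: (cderivM (cderiv_cst _ z) (cauchy_integral_cderiv s.+1 Lg z2)).
Qed.

(** The combination is a weight times a holomorphic function.  In the hole
    y <= 2 y0 since r <= y0, and on the annulus up to the radius (r + S) / 2
    one has y >= y0 (1 - r / S) / 2 since S <= y0. *)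
Lemma wavelet_disc_le_annulus s psi f g (k : R[i]) z0 (r S : R) :
  is_cauchy_wavelet s psi -> L2 f -> L2 g -> 0 <= r -> r < S -> S <= z0.2 ->
  (\int[@mu2 R]_(z in disc S z0)
     (cmod (wavelet_transform psi f z - k * wavelet_transform psi g z) ^+ 2)%:E <=
   (hole_factor s (r / S) ^+ 2)%:E * \int[@mu2 R]_(z in annulus z0 r S)
     (cmod (wavelet_transform psi f z - k * wavelet_transform psi g z) ^+ 2)%:E)%E.
Proof.
move=> Wp Lf Lg r0 rS Sy.
have up := disc_upper_half Sy.
have rd : annulus z0 r S `<=` disc S z0 by move=> z /andP[].
have S0 : 0 < S by exact: le_lt_trans rS.
have y0 : 0 < z0.2 by exact: lt_le_trans Sy.
pose F z := cauchy_integral f s.+1 z - k * cauchy_integral g s.+1 z.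
have -> : (\int[@mu2 R]_(z in disc S z0)
     (cmod (wavelet_transform psi f z - k * wavelet_transform psi g z) ^+ 2)%:E =
   \int[@mu2 R]_(z in disc S z0) (wavelet_weight s z * cmod (F z) ^+ 2)%:E)%E.
  by apply: eq_integral => z; rewrite inE => /up z2; rewrite (cmod_wavelet_combination k Wp Lf Lg z2).
have -> : (\int[@mu2 R]_(z in annulus z0 r S)
     (cmod (wavelet_transform psi f z - k * wavelet_transform psi g z) ^+ 2)%:E =
   \int[@mu2 R]_(z in annulus z0 r S) (wavelet_weight s z * cmod (F z) ^+ 2)%:E)%E.
  by apply: eq_integral => z; rewrite inE => /rd/up z2; rewrite (cmod_wavelet_combination k Wp Lf Lg z2).
have q1 : r / S < 1 by rewrite ltr_pdivrMr// mul1r.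
have e0 : 0 < 1 - r / S by rewrite subr_gt0.
set c2 := cmod (@wavelet_constant R s) ^+ 2; have c20 : 0 < c2 := wavelet_constant_sqr_gt0 s.
pose Mw := c2 * (2 * z0.2) ^+ (2 * s + 1).
pose m := c2 * (z0.2 * (1 - r / S) / 2) ^+ (2 * s + 1).
have m0 : 0 < m.
  by apply: mulr_gt0 => //; apply: exprn_gt0; apply: divr_gt0 => //; exact: mulr_gt0.
have Mw0 : 0 <= Mw by apply: mulr_ge0; [exact: ltW|apply: exprn_ge0; lra].
have hF : holomorphic (disc S z0) F _ := fun z zS => cauchy_combination_holomorphic s k Lf Lg (up z zS).
have rr' : r < (r + S) / 2 by lra.
have r'S : (r + S) / 2 <= S by lra.
have cw z : {for z, continuous (wavelet_weight s)}.
  apply: cvgM; first exact: cvg_cst.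
  by apply: (@continuous_comp _ _ _ snd (fun x : R => x ^+ (2 * s + 1))); [exact: cvg_snd|exact: exprn_continuous].
have w0 z : disc S z0 z -> 0 <= wavelet_weight s z.
  by move=> /up /= z2; apply: mulr_ge0; [exact: ltW|apply: exprn_ge0; exact: ltW].
have wM z : enorm (z - z0) <= r -> wavelet_weight s z <= Mw.
  move=> zr; have := le_trans (snd_le_enorm z0 z) zr; rewrite ler_norml => /andP[h1 h2].
  apply: ler_wpM2l; first exact: ltW.
  by apply: lerXn2r; rewrite ?nnegrE; lra.
have wm z : r < enorm (z - z0) < (r + S) / 2 -> m <= wavelet_weight s z.
  move=> /andP[_ zr]; have := le_lt_trans (snd_le_enorm z0 z) zr; rewrite ltr_norml => /andP[h1 h2].
  have hz : z0.2 * (1 - r / S) / 2 <= z.2.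
    have : 0 <= z0.2 / S - 1 by rewrite subr_ge0 ler_pdivlMr// mul1r.
    move=> h3; have := mulr_ge0 r0 h3.
    have -> : r * (z0.2 / S - 1) = z0.2 * (r / S) - r by field; exact: lt0r_neq0.
    by move=> h4; lra.
  have h0 : 0 <= z0.2 * (1 - r / S) / 2 by apply: divr_ge0 => //; apply: mulr_ge0; exact: ltW.
  apply: ler_wpM2l; first exact: ltW.
  by apply: lerXn2r; rewrite ?nnegrE//; exact: le_trans hz.
have := disc_le_annulus r0 rr' r'S m0 Mw0 hF (fun z _ => cw z) w0 wM wm.
move=> H; apply: (le_trans H); apply: lee_wpmul2r.
  by apply: integral_ge0 => z /rd zd; rewrite lee_fin; apply: mulr_ge0; [exact: w0|exact: sqr_ge0].
rewrite lee_fin /Mw /m.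
have -> : c2 * (2 * z0.2) ^+ (2 * s + 1) / (c2 * (z0.2 * (1 - r / S) / 2) ^+ (2 * s + 1)) =
  (2 * z0.2) ^+ (2 * s + 1) / (z0.2 * (1 - r / S) / 2) ^+ (2 * s + 1).
  by rewrite invfM mulrACA divff ?mul1r// gt_eqF.
exact: hole_factor_sqr.
Qed.

(** W f vanishes on the real axis, where the factor 1 / sqrt |y| is read as 0. *)
Lemma atoll_height psi f z0 (r S delta Delta : R) : 0 <= r -> r < S -> 0 < z0.2 -> 0 < delta ->
  atoll (disc S z0) (disc r z0) delta Delta (wavelet_transform psi f) -> S <= z0.2.
Proof.
move=> r0 rS y0 d0 [_ _ _ lo].
apply: (@radius_le_height _ (fun z => cmod (wavelet_transform psi f z)) z0 r S r0 rS y0).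
  by move=> z /annulus_subset zr; exact: lt_le_trans (lo z zr).
move=> x; rewrite /wavelet_transform cmodM cmod_real.
have -> : Num.sqrt `|(x, 0 : R).2| = 0 by rewrite /= normr0 sqrtr0.
rewrite invr0 normr0.
exact: mul0r.
Qed.

(** The factors that depend on y only cancel in W g / W f, which leaves a
    quotient of Cauchy integrals. *)
Lemma wavelet_quotient s psi f g (A : set (R * R)) : is_cauchy_wavelet s psi -> L2 f -> L2 g ->
  A `<=` [set z | 0 < z.2] -> (forall z, A z -> wavelet_transform psi f z != 0) ->
  exists h h', holomorphic A h h' /\
    forall z, A z -> wavelet_transform psi g z = wavelet_transform psi f z * h z.
Proof.
move=> Wp Lf Lg up f0.
pose p := cauchy_integral f s.+1; pose q := cauchy_integral g s.+1.
pose p' z := s.+1%:R * cauchy_integral f s.+2 z.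
pose q' z := s.+1%:R * cauchy_integral g s.+2 z.
have p0 z : A z -> p z != 0.
  move=> Az; apply: contra_neq (f0 z Az); rewrite (wavelet_transformE Wp Lf (up z Az)) -/(p z) => ->.
  exact: mulr0.
exists (fun z => q z / p z), (fun z => (q' z * p z - 1 * (q z * p' z)) / (p z * p z)); split.
  move=> z Az; have z2 := up z Az.
  have dp := cauchy_integral_cderiv s Lf z2; have dq := cauchy_integral_cderiv s Lg z2.
  have dp' := cderivM (cderiv_cst s.+1%:R z) (cauchy_integral_cderiv s.+1 Lf z2).
  have dq' := cderivM (cderiv_cst s.+1%:R z) (cauchy_integral_cderiv s.+1 Lg z2).
  split.
    have := cderiv_div (p0 z Az) dq dp; congr cderiv.
    by rewrite mul1r expr2.
  apply: cderiv_ccontinuous.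
  have pp : p z * p z != 0 by rewrite mulf_neq0// p0.
  exact: (cderiv_div pp (cderiv_lin 1 (cderivM dq' dp) (cderivM dq dp')) (cderivM dp dp)).
move=> z Az; rewrite (wavelet_transformE Wp Lf (up z Az)) (wavelet_transformE Wp Lg (up z Az)).
rewrite -[RHS]mulrA; congr (_ * _); rewrite -/(p z) -/(q z) mulrCA divff ?mulr1//.
exact: p0.
Qed.

Lemma measurable_wavelet_modulus s psi f (U : set (R * R)) : is_cauchy_wavelet s psi -> L2 f ->
  open U -> U `<=` [set z | 0 < z.2] ->
  measurable_fun (U : set (R1 * R1)) (fun z => cmod (wavelet_transform psi f z)).
Proof.
move=> Wp Lf oU up.
apply: (@eq_measurable_fun _ _ (R1 * R1)%type R1 U
  (fun z => Num.sqrt (wavelet_weight s z * cmod (cauchy_integral f s.+1 z) ^+ 2))).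
  move=> z; rewrite inE => /up z2; have := cmod_wavelet_combination 0 Wp Lf Lf z2.
  by rewrite !mul0r !subr0 => <-; rewrite sqrtr_sqr ger0_norm// cmod_ge0.
apply: open_continuous_measurable_plane => // z Uz; have z2 := up z Uz.
apply: (@continuous_comp _ _ _ (fun z => wavelet_weight s z * cmod (cauchy_integral f s.+1 z) ^+ 2) Num.sqrt).
  apply: cvgM.
    apply: cvgM; first exact: cvg_cst.
    by apply: (@continuous_comp _ _ _ snd (fun x : R => x ^+ (2 * s + 1))); [exact: cvg_snd|exact: exprn_continuous].
  exact: (ccontinuous_cmod_sqr (cderiv_ccontinuous (cauchy_integral_cderiv s Lf z2))).
exact: sqrt_continuous.
Qed.

(** One phase for one disc: it is chosen on the annulus, and the estimate
    extends to the hole because W f - e^(it) W g is a weighted holomorphic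
    function on the whole disc.  The constants are squared under the
    integrals: (8 pi S + 2)^2 dominates 64 pi^2 S^2 + 2. *)
Lemma disc_alignment s psi f g (U : set (R * R)) (V : R * R -> R * R) z0 (r S delta Delta : R) :
  is_cauchy_wavelet s psi -> L2 f -> L2 g -> 0 < z0.2 -> 0 <= r -> r < S -> 0 < delta <= Delta ->
  atoll (disc S z0) (disc r z0) delta Delta (wavelet_transform psi f) ->
  open U -> U `<=` [set z | 0 < z.2] -> disc S z0 `\` closure (disc r z0) `<=` U ->
  weak_gradient U (fun w => cmod (wavelet_transform psi f w) - cmod (wavelet_transform psi g w)) V ->
  exists t : R,
  (Lp_norm (@mu2 R) 2%:E (disc S z0)
    (fun w => cmod (wavelet_transform psi f w - expi t * wavelet_transform psi g w)%R) <=
   (hole_factor s (r / S) * (Delta ^+ 2 / delta ^+ 2) * (8 * pi * S + 2))%:E *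
   (Lp_norm (@mu2 R) 2%:E U
      (fun w => (cmod (wavelet_transform psi f w) - cmod (wavelet_transform psi g w))%R) +
    Lp_norm (@mu2 R) 2%:E U (fun z => enorm (V z))))%E.
Proof.
move=> Wp Lf Lg y0 r0 rS dD at1 oU up dU wV; have /andP[d0 dD'] := dD.
have Sy := atoll_height r0 rS y0 d0 at1.
have [CR CI hi lo] := at1.
set A := annulus z0 r S.
have Ad : A `<=` disc S z0 by move=> z /andP[].
have AU : A `<=` U by exact: subset_trans (@annulus_subset _ z0 r S) dU.
have lo' z : A z -> delta <= cmod (wavelet_transform psi f z) by move=> /annulus_subset; exact: lo.
have f0 z : A z -> wavelet_transform psi f z != 0.
  by move=> /lo' h; rewrite -cmod_gt0; exact: lt_le_trans h.
have [h [h' [hh hE]]] := wavelet_quotient Wp Lf Lg (subset_trans AU up) f0.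
have [t Ht] := @annulus_alignment _ U _ _ h h' V z0 r S delta Delta r0 rS oU AU dD
  (fun z Az => CR z (Ad z Az)) (fun z Az => CI z (Ad z Az))
  (fun z Az => introT andP (conj (lo' z Az) (hi z (Ad z Az)).1))
  (fun z Az => (hi z (Ad z Az)).2) hh hE wV.
exists t.
have mU : measurable (U : set (R1 * R1)) by exact: open_measurable_plane.
have mA : measurable (A : set (R1 * R1)) by apply: open_measurable_plane; exact: open_annulus.
have mD : measurable (disc S z0 : set (R1 * R1)) by apply: open_measurable_plane; exact: open_disc.
rewrite (@Lp_norm2E _ _ (R1 * R1)%type _ _ _ mD) !(@Lp_norm2E _ _ (R1 * R1)%type _ _ _ mU).
have [mV1 mV2 _ _ _] := wV.
have mu1 : measurable_fun (U : set (R1 * R1)) (fun w => (cmod (wavelet_transform psi f w) - cmod (wavelet_transform psi g w)) ^+ 2).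
  apply: measurable_funX; apply: measurable_funB; exact: (measurable_wavelet_modulus Wp).
have mv1 : measurable_fun (U : set (R1 * R1)) (fun z => enorm (V z) ^+ 2).
  have -> : (fun z => enorm (V z) ^+ 2) = (fun z => (V z).1 ^+ 2 + (V z).2 ^+ 2).
    by apply/funext => z; rewrite sqr_sqrtr// addr_ge0 ?sqr_ge0.
  by apply: measurable_funD; exact: measurable_funX.
have sub (k : R * R -> R) : measurable_fun (U : set (R1 * R1)) k -> (forall z, 0 <= k z) ->
    (\int[@mu2 R]_(z in A) (k z)%:E <= \int[@mu2 R]_(z in U) (k z)%:E)%E.
  move=> mk k0; apply: (@ge0_subset_integral _ (R1 * R1)%type R (@mu2 R) A U mA mU) => //.
    exact/measurable_EFinP.
  by move=> z _; rewrite lee_fin.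
have S0 : 0 < S by exact: le_lt_trans rS.
have D0 : 0 < Delta by exact: lt_le_trans dD'.
have P0 := pi_gt0 R.
have q1 : r / S < 1 by rewrite ltr_pdivrMr// mul1r.
have H1 := hole_factor_ge1 s q1.
set H := hole_factor s (r / S) in H1 *.
have dd0 : 0 < Delta ^+ 2 / delta ^+ 2 by rewrite divr_gt0// exprn_gt0.
have PS : 0 < pi * S by exact: mulr_gt0.
have a0 : 0 < H * (Delta ^+ 2 / delta ^+ 2) * (8 * pi * S + 2).
  by apply: mulr_gt0; [apply: mulr_gt0; lra|lra].
apply: (sqrte_le_split a0).
- by apply: integral_ge0 => z _; rewrite lee_fin sqr_ge0.
- by apply: integral_ge0 => z _; rewrite lee_fin sqr_ge0.
apply: (le_trans (wavelet_disc_le_annulus (expi t) Wp Lf Lg r0 rS Sy)).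
apply: (le_trans (lee_wpmul2l _ Ht)); first by rewrite lee_fin sqr_ge0.
rewrite muleA -EFinM; apply: lee_pmul.
- rewrite lee_fin; apply: mulr_ge0; first exact: sqr_ge0.
  have := sqr_ge0 (pi * S); rewrite exprMn => h3.
  by apply: mulr_ge0; [apply: divr_ge0; apply: exprn_ge0; exact: ltW|lra].
- by apply: adde_ge0; apply: integral_ge0 => z _; rewrite lee_fin sqr_ge0.
- rewrite lee_fin.
  have -> : Delta ^+ 4 / delta ^+ 4 = (Delta ^+ 2 / delta ^+ 2) ^+ 2.
    by rewrite expr_div_n -!exprM.
  set E := Delta ^+ 2 / delta ^+ 2.
  have sq3 (a b c : R) : (a * b * c) ^+ 2 = a ^+ 2 * (b ^+ 2 * c ^+ 2) by ring.
  rewrite sq3.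
  apply: ler_wpM2l; first exact: sqr_ge0.
  apply: ler_wpM2l; first exact: sqr_ge0.
  have -> : (8 * pi * S + 2) ^+ 2 = 64 * pi ^+ 2 * S ^+ 2 + (32 * (pi * S) + 4) by ring.
  by rewrite lerD2l; lra.
- by apply: leeD; [exact: (sub _ mu1 (fun=> sqr_ge0 _))|exact: (sub _ mv1 (fun=> sqr_ge0 _))].
Qed.
End WaveletDiscs.

(** The Sobolev norm is an infimum over weak gradients, equal to +oo when
    there is none, in which case the bound is trivial. *)
Lemma ereal_inf_bound {R : realType} (L N : \bar R) (K : R) (X : set \bar R) : 0 < K ->
  (0 <= N)%E -> (forall x, X x -> 0 <= x)%E -> (forall x, X x -> L <= K%:E * (N + x))%E ->
  (L <= K%:E * (N + ereal_inf X))%E.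
Proof.
move=> K0 N0 X0 H.
have i0 : (0 <= ereal_inf X)%E by apply: le_ereal_inf_tmp => x /X0.
case: N N0 H => [N| |] // N0 H; last by rewrite addye ?gt0_muley ?lte_fin ?leey// gt_eqF// (lt_le_trans _ i0).
have : (K^-1%:E * L - N%:E <= ereal_inf X)%E.
  apply: le_ereal_inf_tmp => x Xx; rewrite leeBlDl//.
  by rewrite lee_pdivrMl//; exact: H.
by rewrite leeBlDl// lee_pdivrMl.
Qed.

Theorem theorem3p9 (R : realType) (s : nat) (psi : R -> R[i])
    (hpsi : is_cauchy_wavelet s psi) :
  exists (rho : R -> R) (c : R),
    [/\ {within `[0, 1[, continuous rho},
        (forall t, 0 <= t < 1 -> 0 < rho t),
        0 < c &
    forall (f : R -> R[i]) (k : nat) (z : 'I_k -> R * R)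
      (r sr delta Delta : 'I_k -> R),
      analytic_signal f ->
      (1 <= k)%N ->
      (forall j, 0 < (z j).2) ->
      (forall j, 0 <= r j < sr j) ->
      (forall j, 0 < delta j <= Delta j) ->
      (forall j, atoll (disc (sr j) (z j)) (disc (r j) (z j))
                   (delta j) (Delta j) (wavelet_transform psi f)) ->
    forall g : R -> R[i], analytic_signal g ->
      (ereal_inf (range (fun alpha : 'I_k -> R =>
         \sum_(j < k) Lp_norm mu2 2%:E (disc (sr j) (z j))
           (fun w => cmod (wavelet_transform psi f w
                           - expi (alpha j) * wavelet_transform psi g w)%R)))
       <=
       (c * \sum_(j < k)
          (Delta j ^+ 2 / delta j ^+ 2
           * (1 + rho (r j / sr j) * sr j)
           * (1 + Num.sqrt (r j) * rho (r j / sr j)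
                  * (Num.sqrt (sr j) + (Num.sqrt (sr j))^-1)
                  * `|1 / (1 - r j / (z j).2)| `^ (s%:R + 1 / 2))))%R%:E
       * sobolev_norm 2%:E
           (\bigcup_(j in [set: 'I_k])
              (disc (sr j) (z j) `\` closure (disc (r j) (z j))))
           (fun w => (cmod (wavelet_transform psi f w)
                      - cmod (wavelet_transform psi g w))%R))%E].
Proof.
have P0 : 0 < 8 * pi :> R by rewrite mulr_gt0// pi_gt0.
have H2 := @hole_factor_half R s.
exists (hole_factor s), ((8 * pi + 2) * hole_factor s (1 / 2)); split.
- exact: hole_factor_continuous.
- by move=> t /andP[_ t1]; exact: lt_le_trans ltr01 (hole_factor_ge1 s t1).
- by apply: mulr_gt0; lra.
move=> f k z r sr delta Delta [Lf _] k1 y0 rs dD at1 g [Lg _].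
set U := \bigcup_(j in _) _; set u := fun w => _ - _.
have height j : sr j <= (z j).2.
  have /andP[r0 rS] := rs j; have /andP[d0 _] := dD j.
  exact: atoll_height r0 rS (y0 j) d0 (at1 j).
have oU : open U.
  apply: bigcup_open => j _; apply: openI; first exact: open_disc.
  by apply: closed_openC; exact: closed_closure.
have up : U `<=` [set w | 0 < w.2] by move=> w [j _ [wj _]]; exact: (disc_upper_half (height j) wj).
have dU j : disc (sr j) (z j) `\` closure (disc (r j) (z j)) `<=` U by move=> w wj; exists j.
pose T j := Delta j ^+ 2 / delta j ^+ 2 * (1 + hole_factor s (r j / sr j) * sr j) *
  (1 + Num.sqrt (r j) * hole_factor s (r j / sr j) * (Num.sqrt (sr j) + (Num.sqrt (sr j))^-1) *
    `|1 / (1 - r j / (z j).2)| `^ (s%:R + 1 / 2)).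
pose B j := hole_factor s (r j / sr j) * (Delta j ^+ 2 / delta j ^+ 2) * (8 * pi * sr j + 2).
have BT j : B j <= (8 * pi + 2) * hole_factor s (1 / 2) * T j.
  have /andP[r0 rS] := rs j; have /andP[d0 dd] := dD j.
  have e0 : 0 <= s%:R + 1 / 2 :> R by rewrite addr_ge0//; lra.
  have := radius_constant s P0 r0 rS (height j) e0.
  have q0 : 0 <= Delta j ^+ 2 / delta j ^+ 2 by rewrite divr_ge0 ?sqr_ge0.
  move=> /(ler_wpM2l q0); congr (_ <= _); rewrite /B /T; ring.
have B0 j : 0 < B j.
  have /andP[r0 rS] := rs j; have /andP[d0 dd] := dD j.
  have S0 : 0 < sr j by exact: le_lt_trans rS.
  have q1 : r j / sr j < 1 by rewrite ltr_pdivrMr// mul1r.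
  have h1 := hole_factor_ge1 s q1.
  apply: mulr_gt0; last by have := mulr_gt0 P0 S0; lra.
  apply: mulr_gt0; first by lra.
  by rewrite divr_gt0// exprn_gt0//; exact: lt_le_trans dd.
have K0 : 0 < (8 * pi + 2) * hole_factor s (1 / 2) * \sum_(j < k) T j.
  rewrite mulr_sumr; apply: (@lt_le_trans _ _ (\sum_(j < k) B j)); last exact: ler_sum.
  case: k k1 z r sr delta Delta y0 rs dD at1 @U @T u height oU up dU B BT B0 => // k' _ z r sr delta Delta _ _ _ _ U T u _ _ _ _ B _ B0.
  by rewrite big_ord_recl ltr_wpDr// sumr_ge0// => j _; exact: ltW.
rewrite /sobolev_norm; apply: (ereal_inf_bound K0).
- exact: Lnorm_ge0.
- by move=> _ [V _ <-]; exact: Lnorm_ge0.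
move=> _ [V wV <-].
(* one phase for each disc; the discs do not interact *)
have [alpha Ha] := choice (fun j => 
  let: conj r0 rS := andP (rs j) in
  disc_alignment hpsi Lf Lg (y0 j) r0 rS (dD j) (at1 j) oU up (dU j) wV).
apply: (@le_trans _ _ (\sum_(j < k) Lp_norm mu2 2%:E (disc (sr j) (z j))
           (fun w => cmod (wavelet_transform psi f w
                           - expi (alpha j) * wavelet_transform psi g w)%R))%E).
  by apply: ereal_inf_lbound; exists alpha.
set N := (X in (_ * X)%E).
have N0 : (0 <= N)%E by apply: adde_ge0; exact: Lnorm_ge0.
rewrite mulr_sumr -sumEFin ge0_sume_distrl; last first.
  by move=> j _; rewrite lee_fin; apply: le_trans (BT j); exact: ltW.
apply: lee_sum => j _; apply: (le_trans (Ha j)); apply: lee_wpmul2r => //.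
by rewrite lee_fin; exact: BT.
Qed.
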